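(* Let $(V,\Upsilon(z),c,\rho)$ be a graded vertex operator coalgebra with $V_0\not\subseteq\ker c$ and $V_2\not\subseteq\ker\rho$, and let $(\mathcal V,Y,\mathbf 1,\omega)$ be a vertex operator algebra. Let $g\in\mathrm{Aut}\,V$ and $h\in\mathrm{Aut}\,\mathcal V$ have finite orders $T_g$ and $T_h$. Let $(\mathcal M,\Upsilon_{\mathcal M}(z))$ be an admissible $g$-twisted $V$-comodule with grading $\mathcal M=\bigoplus_{s\in\frac1{T_g}\mathbb N}M_s$, and let $(\mathcal N,Y_{\mathcal N})$ be an admissible $h$-twisted $\mathcal V$-module with grading $\mathcal N=\bigoplus_{s\in\frac1{T_h}\mathbb N}N_s$. Then: (i) $\mathcal N'=\bigoplus_{s\in\frac1{T_h}\mathbb N}N_s^*$ is an admissible $h^{-1}$-twisted $\mathcal V'$-comodule with $(\Upsilon_{\mathcal N'}(z)n^*,v\otimes n)=(n^*,Y_{\mathcal N}(v,z)n)$ for $n^*\in\mathcal N'$, $v\in\mathcal V$, $n\in\mathcal N$. (ii) $\mathcal M'=\bigoplus_{s\in\frac1{T_g}\mathbb N}M_s^*$ is an admissible $g^{-1}$-twisted $V'$-module with $(Y_{\mathcal M'}(v^*,z)m^*,m)=(v^*\otimes m^*,\Upsilon_{\mathcal M}(z)m)$ for $v^*\in V'$, $m^*\in\mathcal M'$, $m\in\mathcal M$.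
   Context: All vector spaces are over $\mathbb C$; $\mathbb N=\{0,1,2,\dots\}$; $\tau(v\otimes w)=w\otimes v$; $(z_1+z_2)^n$ is expanded in nonnegative powers of $z_2$; $\delta(x)=\sum_{n\in\mathbb Z}x^n$; $(\cdot,\cdot)$ is the natural pairing. Graded vertex operator coalgebra $(V,\Upsilon(z),c,\rho)$: $V=\bigoplus_{s\in\mathbb Z}V_s$, $\dim V_s<\infty$, $V_s=0$ for $s\ll0$; linear maps $c,\rho:V\to\mathbb C$ and $\Upsilon(z):V\to(V\otimes V)[[z,z^{-1}]]$, $\Upsilon(z)v=\sum_{k\in\mathbb Z}\Delta_k(v)z^{-k-1}$, with: (1) $\Delta_k(v)=0$ for $k\ll0$ and $\Delta_k(V_s)\subseteq(V\otimes V)_{s+k+1}$; (2) $(c\otimes\mathrm{Id})\Upsilon(z)v=v$, $(\mathrm{Id}\otimes c)\Upsilon(z)v\in V[[z]]$ with constant term $v$; (3) Jacobi identity $z_0^{-1}\delta(\frac{z_1-z_2}{z_0})(\mathrm{Id}\otimes\Upsilon(z_2))\Upsilon(z_1)-z_0^{-1}\delta(\frac{z_2-z_1}{-z_0})(\tau\otimes\mathrm{Id})(\mathrm{Id}\otimes\Upsilon(z_1))\Upsilon(z_2)=z_1^{-1}\delta(\frac{z_2+z_0}{z_1})(\Upsilon(z_0)\otimes\mathrm{Id})\Upsilon(z_2)$; (4) writing $(\rho\otimes\mathrm{Id})\Upsilon(z)=\sum_kL(k)z^{k-2}$, the operators $L(k)\in\mathrm{End}(V)$ satisfy $[L(k),L(j)]=(k-j)L(k+j)+\frac{k^3-k}{12}\delta_{k+j,0}d$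 for a constant $d$, $V_s$ is the $s$-eigenspace of $L(0)$, and $(L(1)\otimes\mathrm{Id})\Upsilon(z)=\frac{d}{dz}\Upsilon(z)$. Automorphisms of $V$: linear bijections $g$ with $c\circ g=c$, $\rho\circ g=\rho$, $\Upsilon(z)g=(g\otimes g)\Upsilon(z)$. For $g$ of order $T$: $V^{(r)}=\{v: gv=e^{2\pi ir/T}v\}$, $0\le r\le T-1$. $\frac{\ln g}{2\pi i}$ acts on $V^{(r)}$ as $\frac rT$; $z^\phi v=z^\lambda v$ if $\phi v=\lambda v$. Weak $g$-twisted $V$-comodule: a vector space $\mathcal M$ with a linear map $\Upsilon_{\mathcal M}(z)m=\sum_{k\in\mathbb Z}(z^{-\frac{\ln g}{2\pi i}}\otimes\mathrm{Id})\Delta_{\mathcal M,k}(m)z^{-k-1}$, $\Delta_{\mathcal M,k}:\mathcal M\to V\otimes\mathcal M$, with: (i) $\Delta_{\mathcal M,k}(m)=0$ for $k\ll0$, $(c\otimes\mathrm{Id})\Upsilon_{\mathcal M}(z)=\mathrm{Id}$; (ii) $z_0^{-1}\delta(\frac{z_1-z_2}{z_0})(\mathrm{Id}\otimes\Upsilon_{\mathcal M}(z_2))\Upsilon_{\mathcal M}(z_1)-z_0^{-1}\delta(\frac{z_2-z_1}{-z_0})(\tau\otimes\mathrm{Id})(\mathrm{Id}\otimes\Upsilon_{\mathcal M}(z_1))\Upsilon_{\mathcal M}(z_2)=z_2^{-1}\delta(\frac{z_1-z_0}{z_2})((\frac{z_1-z_0}{z_2})^{-\frac{\ln g}{2\pi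 i}}\otimes\mathrm{Id}\otimes\mathrm{Id})(\Upsilon(z_0)\otimes\mathrm{Id})\Upsilon_{\mathcal M}(z_2)$; (iii) writing $(\rho\otimes\mathrm{Id})\Upsilon_{\mathcal M}(z)=\sum_kL(k)z^{k-2}$, $L(k)\in\mathrm{End}(\mathcal M)$ satisfy the same Virasoro relations; (iv) $(L(1)\otimes\mathrm{Id})\Upsilon_{\mathcal M}(z)=\frac d{dz}\Upsilon_{\mathcal M}(z)=\Upsilon_{\mathcal M}(z)L(1)-(\mathrm{Id}\otimes L(1))\Upsilon_{\mathcal M}(z)$. It is admissible if $\mathcal M=\bigoplus_{t\in\frac1T\mathbb N}M_t$ with $\Delta_{\mathcal M,k}(M_t)\subseteq\bigoplus_{r=0}^{T-1}(V^{(r)}\otimes\mathcal M)_{t+k+1+\frac rT}$. (Homogeneous subspaces $M_t$ may be infinite-dimensional.) Twisted modules: for $h\in\mathrm{Aut}\,\mathcal V$ of order $T$, $\mathcal V^{(r)}=\{v:hv=e^{2\pi ir/T}v\}$. A weak $h$-twisted $\mathcal V$-module is a vector space $\mathcal N$ with $Y_{\mathcal N}(u,z)=\sum_{t\in\mathbb Z+r/T}u_tz^{-t-1}$ ($u\in\mathcal V^{(r)}$, $u_t\in\mathrm{End}\,\mathcal N$), $u_tn=0$ for $t\gg0$, $Y_{\mathcal N}(\mathbf 1,z)=\mathrm{Id}$, and for $u\in\mathcal V^{(r)},v\in\mathcal V$: $z_0^{-1}\delta(\frac{z_1-z_2}{z_0})Y_{\mathcal N}(u,z_1)Y_{\mathcal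 N}(v,z_2)-z_0^{-1}\delta(\frac{-z_2+z_1}{z_0})Y_{\mathcal N}(v,z_2)Y_{\mathcal N}(u,z_1)=z_2^{-1}\delta(\frac{z_1-z_0}{z_2})(\frac{z_1-z_0}{z_2})^{-r/T}Y_{\mathcal N}(Y(u,z_0)v,z_2)$. It is admissible if $\mathcal N=\bigoplus_{t\in\frac1T\mathbb N}N_t$ with $a_sN_t\subseteq N_{\mathrm{wt}\,a+t-s-1}$ for homogeneous $a$. Duals: $V'=\bigoplus_sV_s^*$ is a vertex operator algebra with $\mathbf 1=c|_{V_0}$, $\omega=\rho|_{V_2}$, $(Y(u^*,z)v^*,v)=(u^*\otimes v^*,\Upsilon(z)v)$. $\mathcal V'=\bigoplus_s\mathcal V_s^*$ is a graded vertex operator coalgebra with $c(v^* )=(v^*,\mathbf 1)$, $\rho(v^* )=(v^*,\omega)$, $(\Upsilon(z)v^*,u\otimes v)=(v^*,Y(u,z)v)$. An automorphism $g$ of $V$ (resp. $h$ of $\mathcal V$) acts on $V'$ (resp. $\mathcal V'$) by $(g(v^* ),v)=(v^*,g^{-1}(v))$. *)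

(* Defs.v *)
From HB Require Import structures.
From mathcomp Require Import all_boot all_order all_algebra generic_quotient.
From mathcomp Require Import finmap complex.
From mathcomp Require Import all_classical reals trigo.

Set Implicit Arguments.
Unset Strict Implicit.
Unset Printing Implicit Defensive.
Import Order.TTheory GRing.Theory Num.Theory.
Local Open Scope classical_set_scope.
Local Open Scope ring_scope.
Local Open Scope quotient_scope.

(* V (x) W is the type of formal sums of pairs (v, w), two formal sums being
   identified when every bilinear map out of V x W takes the same value on
   them. [tlift_pure], [tlift_linear] and [tlift_unique] are the universal
   property. *)
Section Tensor.
Context (F : fieldType) (V W : lmodType F).

Definition bilin (U : lmodType F) (f : V -> W -> U) : Prop :=
  (forall v, linear (f v)) /\ (forall w, linear (f ^~ w)).

Definition sum_of (U : lmodType F) (f : V -> W -> U) (s : seq (V * W)) : U :=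
  \sum_(p <- s) f p.1 p.2.

Definition teq (s t : seq (V * W)) : bool :=
  `[< forall (U : lmodType F) (f : V -> W -> U),
        bilin f -> sum_of f s = sum_of f t >].

Lemma teq_refl : reflexive teq. Proof. by move=> s; apply/asboolP. Qed.

Lemma teq_sym : symmetric teq.
Proof. by move=> s t; apply/asboolP/asboolP => h U f bf; rewrite h. Qed.

Lemma teq_trans : transitive teq.
Proof.
by move=> t s u /asboolP h /asboolP k; apply/asboolP => U f bf; rewrite h// k.
Qed.

Canonical teq_equiv := EquivRel teq teq_refl teq_sym teq_trans.
Canonical teq_direct := defaultEncModRel teq.

Definition tensor := {eq_quot teq}.
HB.instance Definition _ := Quotient.on tensor.
HB.instance Definition _ := Choice.on tensor.

Definition tlift (U : lmodType F) (f : V -> W -> U) (x : tensor) : U :=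
  sum_of f (repr x).

Definition tpure (v : V) (w : W) : tensor := \pi_tensor [:: (v, w)].

Lemma tlift_pi (U : lmodType F) (f : V -> W -> U) s :
  bilin f -> tlift f (\pi_tensor s) = sum_of f s.
Proof.
move=> bf.
have /eqmodP/asboolP h : repr (\pi_tensor s) = s %[mod tensor] by rewrite reprK.
exact: h.
Qed.

Lemma tensor_ext (x y : tensor) :
  (forall (U : lmodType F) (f : V -> W -> U), bilin f -> tlift f x = tlift f y) ->
  x = y.
Proof.
move=> h; rewrite -(reprK x) -(reprK y); apply/eqmodP/asboolP.
by move=> U f bf; apply: h.
Qed.

Definition tadd (x y : tensor) : tensor := \pi_tensor (repr x ++ repr y).
Definition tscale (a : F) (x : tensor) : tensor :=
  \pi_tensor [seq (a *: p.1, p.2) | p <- repr x].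
Definition tzero : tensor := \pi_tensor [::].

Lemma tliftD (U : lmodType F) (f : V -> W -> U) x y :
  bilin f -> tlift f (tadd x y) = tlift f x + tlift f y.
Proof. by move=> bf; rewrite tlift_pi// /sum_of big_cat. Qed.

Lemma tliftZ (U : lmodType F) (f : V -> W -> U) a x :
  bilin f -> tlift f (tscale a x) = a *: tlift f x.
Proof.
move=> bf; rewrite tlift_pi// /sum_of big_map scaler_sumr.
by apply: eq_bigr => p _ /=; apply: (scalable_linear (bf.2 p.2)).
Qed.

Lemma tlift0 (U : lmodType F) (f : V -> W -> U) : bilin f -> tlift f tzero = 0.
Proof. by move=> bf; rewrite tlift_pi// /sum_of big_nil. Qed.

Definition topp (x : tensor) : tensor := tscale (-1) x.

Fact taddA : associative tadd.
Proof. by move=> x y z; apply: tensor_ext => U f bf; rewrite !tliftD// addrA. Qed.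

Fact taddC : commutative tadd.
Proof. by move=> x y; apply: tensor_ext => U f bf; rewrite !tliftD// addrC. Qed.

Fact tadd0 : left_id tzero tadd.
Proof. by move=> x; apply: tensor_ext => U f bf; rewrite tliftD// tlift0// add0r. Qed.

Fact taddN : left_inverse tzero topp tadd.
Proof.
move=> x; apply: tensor_ext => U f bf.
by rewrite tliftD// tliftZ// tlift0// scaleN1r addNr.
Qed.

HB.instance Definition _ := GRing.isZmodule.Build tensor taddA taddC tadd0 taddN.

Fact tscaleA a b x : tscale a (tscale b x) = tscale (a * b) x.
Proof. by apply: tensor_ext => U f bf; rewrite !tliftZ// scalerA. Qed.

Fact tscale1 : left_id 1 tscale.
Proof. by move=> x; apply: tensor_ext => U f bf; rewrite tliftZ// scale1r. Qed.

Fact tscaleDr : right_distributive tscale +%R.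
Proof.
by move=> a x y; apply: tensor_ext => U f bf; rewrite !(tliftZ, tliftD)// scalerDr.
Qed.

Fact tscaleDl x : {morph tscale^~ x : a b / a + b}.
Proof.
by move=> a b; apply: tensor_ext => U f bf; rewrite !(tliftZ, tliftD)// scalerDl.
Qed.

HB.instance Definition _ :=
  GRing.Zmodule_isLmodule.Build F tensor tscaleA tscale1 tscaleDr tscaleDl.

Lemma tlift_linear (U : lmodType F) (f : V -> W -> U) :
  bilin f -> linear (tlift f).
Proof. by move=> bf a x y; rewrite -tliftZ// -tliftD. Qed.

Lemma tlift_pure (U : lmodType F) (f : V -> W -> U) v w :
  bilin f -> tlift f (tpure v w) = f v w.
Proof. by move=> bf; rewrite tlift_pi// /sum_of big_seq1. Qed.

Lemma tpure_bilin : bilin tpure.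
Proof.
split=> [v a w w' | w a v v']; apply: tensor_ext => U f bf.
  by rewrite tliftD// tliftZ// !tlift_pure// (bf.1 v).
by rewrite tliftD// tliftZ// !tlift_pure// (bf.2 w).
Qed.

Lemma tensor_sum_pure (x : tensor) : x = sum_of tpure (repr x).
Proof.
apply: tensor_ext => U f bf.
pose g := tlift f; have lg : linear g := tlift_linear bf.
pose gL : {linear tensor -> U} :=
  HB.pack g (GRing.isLinear.Build F tensor U *:%R g lg).
rewrite -[RHS]/(gL _) /sum_of linear_sum /= /tlift {1}/sum_of.
by apply: eq_bigr => p _; rewrite [RHS]tlift_pure.
Qed.

Lemma tlift_unique (U : lmodType F) (f : V -> W -> U) (g : {linear tensor -> U}) :
  (forall v w, g (tpure v w) = f v w) -> g =1 tlift f.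
Proof.
move=> h x; rewrite {1}[x]tensor_sum_pure /sum_of linear_sum.
by apply: eq_bigr => p _; rewrite h.
Qed.

End Tensor.

Notation "V ⊗ W" := (tensor V W) (at level 40, left associativity) : type_scope.

Section TensorOps.
Context (F : fieldType).
Implicit Types U V W : lmodType F.

Definition tmap V W V' W' (f : V -> V') (g : W -> W') : V ⊗ W -> V' ⊗ W' :=
  tlift (fun v w => tpure (f v) (g w)).

Definition tassoc U V W : (U ⊗ V) ⊗ W -> U ⊗ (V ⊗ W) :=
  tlift (fun x w => tlift (fun u v => tpure u (tpure v w)) x).

(* tau (x) Id *)
Definition tswap12 U V W : U ⊗ (V ⊗ W) -> V ⊗ (U ⊗ W) :=
  tlift (fun u x => tlift (fun v w => tpure v (tpure u w)) x).

(* c (x) Id and Id (x) c, with values in F (x) W = W and V (x) F = V *)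
Definition tcontr_l V W (c : V -> F) : V ⊗ W -> W :=
  tlift (fun v w => c v *: w).
Definition tcontr_r V W (c : W -> F) : V ⊗ W -> V :=
  tlift (fun v w => c w *: v).

Definition tpair V W (f : V -> F) (g : W -> F) : V ⊗ W -> F :=
  tlift (fun v w => f v * g w : F^o).

(* the linear span of the v (x) w with P v w *)
Definition tspan V W (P : V -> W -> Prop) : set (V ⊗ W) :=
  [set x | exists s : seq (F * V * W),
     (forall p, p \in s -> P p.1.2 p.2) /\
     x = \sum_(p <- s) p.1.1 *: tpure p.1.2 p.2].

Lemma tmap_bilin V W V' W' (f : {linear V -> V'}) (g : {linear W -> W'}) :
  bilin (fun v w => tpure (f v) (g w)).
Proof.
have [br bl] := @tpure_bilin F V' W'.
by split=> [v a w w' | w a v v'] /=; rewrite linearP; [apply: br | apply: bl].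
Qed.

Lemma tmap_pure V W V' W' (f : {linear V -> V'}) (g : {linear W -> W'}) v w :
  tmap f g (tpure v w) = tpure (f v) (g w).
Proof. exact: (tlift_pure _ _ (tmap_bilin f g)). Qed.

Lemma tmap_linear V W V' W' (f : {linear V -> V'}) (g : {linear W -> W'}) :
  linear (tmap f g).
Proof. exact/tlift_linear/tmap_bilin. Qed.

Lemma tensor_linear_eq V W U (f g : V ⊗ W -> U) : linear f -> linear g ->
  (forall v w, f (tpure v w) = g (tpure v w)) -> f =1 g.
Proof.
move=> lf lg h.
pose fL : {linear V ⊗ W -> U} := HB.pack f (GRing.isLinear.Build F _ U *:%R f lf).
pose gL : {linear V ⊗ W -> U} := HB.pack g (GRing.isLinear.Build F _ U *:%R g lg).
move=> x; pose k v w := g (tpure v w).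
have -> : f x = tlift k x by apply: (@tlift_unique F V W U k fL).
by apply/esym/(@tlift_unique F V W U k gL).
Qed.

Lemma tmapK V W V' W' (f : {linear V -> V'}) (g : {linear W -> W'})
    (f' : {linear V' -> V}) (g' : {linear W' -> W}) :
  cancel f f' -> cancel g g' -> cancel (tmap f g) (tmap f' g').
Proof.
move=> fK gK; apply: tensor_linear_eq => [a x y|//|v w].
  by rewrite tmap_linear tmap_linear.
by rewrite !tmap_pure fK gK.
Qed.

End TensorOps.

(* A decomposition V = \bigoplus_(s : I) V_s, given by its projections
   V -> V_s; V_s itself is [homog gr s]. *)
Record grading (F : fieldType) (I : choiceType) (V : lmodType F) := Grading {
  gproj : I -> {linear V -> V};
  gproj_orth : forall s t v,
    gproj s (gproj t v) = if s == t then gproj t v else 0;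
  gproj_fin : forall v, finite_set [set s | gproj s v != 0];
  gproj_sum : forall v, \sum_(s \in [set: I]) gproj s v = v
}.

Section Hom.
Context (F : fieldType) (I : choiceType) (V : lmodType F) (gr : grading I V).

Definition homog (s : I) : set V := [set v | gproj gr s v = v].

Definition finite_dim (A : set V) : Prop :=
  exists (n : nat) (b : 'I_n -> V),
    forall v, A v -> exists a : 'I_n -> F, v = \sum_i a i *: b i.

End Hom.

(* \bigoplus_s V_s^*: an element of V_s^* is extended by 0 on V_t, t != s, so
   the direct sum consists of the functionals on V that vanish on V_s for all
   but finitely many s, and the natural pairing is evaluation. *)
Section GradedDual.
Context (F : fieldType) (I : choiceType) (V : lmodType F) (gr : grading I V).

Definition gdual_pred : {pred V -> F^o} :=
  fun f => `[< linear f /\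
    finite_set [set s | exists v, f (gproj gr s v) != 0] >].

Record gdual := GDual { gdual_val :> V -> F^o; _ : gdual_val \in gdual_pred }.

HB.instance Definition _ := [isSub for gdual_val].
HB.instance Definition _ := [Choice of gdual by <:].

Fact gdual_submod_closed : submod_closed gdual_pred.
Proof.
split=> [|a f g]; rewrite !unfold_in.
  apply/asboolP; split; first by move=> a x y; rewrite scaler0 addr0.
  rewrite [X in finite_set X](_ : _ = set0); first exact: finite_set0.
  by apply/seteqP; split=> s //= -[v]; rewrite eqxx.
move=> /asboolP[lf ff] /asboolP[lg fg]; apply/asboolP; split.
  move=> b x y; rewrite -[LHS]/(a *: f (b *: x + y) + g (b *: x + y)).
  rewrite -[in RHS]/(a *: f x + g x) -[in RHS]/(a *: f y + g y) lf lg.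
  rewrite !scalerDr !scalerA (mulrC a b) -!addrA; congr (_ + _).
  by rewrite addrCA.
apply: (@sub_finite_set _ _ ([set s | exists v, f (gproj gr s v) != 0] `|`
  [set s | exists v, g (gproj gr s v) != 0])); last by rewrite finite_setU.
move=> s /= [v h]; case: (eqVneq (f (gproj gr s v)) 0) => [f0|f0]; last by left; exists v.
right; exists v; apply: contra h => /eqP g0.
rewrite -[X in X == 0]/(a *: f (gproj gr s v) + g (gproj gr s v)).
by rewrite f0 g0 scaler0 addr0.
Qed.

HB.instance Definition _ :=
  GRing.isSubmodClosed.Build F (V -> F^o) gdual_pred gdual_submod_closed.
HB.instance Definition _ := [SubChoice_isSubLmodule of gdual by <:].

Lemma gdual_linear (f : gdual) : linear f.
Proof. by case: f => f /= /asboolP[]. Qed.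
HB.instance Definition _ (f : gdual) :=
  GRing.isLinear.Build F V F^o *:%R f (gdual_linear f).

Lemma gdual_fin (f : gdual) :
  finite_set [set s | exists v, f (gproj gr s v) != 0].
Proof. by case: f => f /= /asboolP[]. Qed.

Lemma gdual_ext (f g : gdual) : (forall v, f v = g v) -> f = g.
Proof. by move=> h; apply/val_inj/funext. Qed.

Fact gdual_proj_subproof (s : I) (f : gdual) :
  (fun v => f (gproj gr s v)) \in gdual_pred.
Proof.
apply/asboolP; split; first by move=> a x y; rewrite !linearP.
apply: (@sub_finite_set _ _ [set s]); last exact: finite_set1.
move=> t /= [v]; rewrite gproj_orth; case: (eqVneq s t) => [->//|_].
by rewrite linear0 eqxx.
Qed.

Definition gdual_proj (s : I) (f : gdual) : gdual :=
  GDual (gdual_proj_subproof s f).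

Fact gdual_proj_linear s : linear (gdual_proj s).
Proof. by move=> a f g; apply: gdual_ext => v. Qed.
HB.instance Definition _ s :=
  GRing.isLinear.Build F gdual gdual *:%R (gdual_proj s) (gdual_proj_linear s).

Fact gdual_proj_orth s t (f : gdual) :
  gdual_proj s (gdual_proj t f) = if s == t then gdual_proj t f else 0.
Proof.
apply: gdual_ext => v /=; rewrite gproj_orth eq_sym.
by case: (eqVneq s t) => [->|_] //; rewrite linear0.
Qed.

Fact gdual_proj_fin (f : gdual) : finite_set [set s | gdual_proj s f != 0].
Proof.
apply: sub_finite_set (gdual_fin f) => s /= h; apply: contrapT => n.
move/negP: h; apply; apply/eqP/gdual_ext => v /=.
by apply/eqP; apply: contrapT => /negP h; apply: n; exists v.
Qed.

Fact gdual_proj_sum (f : gdual) : \sum_(s \in [set: I]) gdual_proj s f = f.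
Proof.
apply: gdual_ext => v.
have [X hX] : exists X : {fset I},
    [set s | gdual_proj s f != 0] `|` [set s | gproj gr s v != 0] = [set` X].
  apply/finite_fsetP; rewrite finite_setU.
  by split; [exact: gdual_proj_fin | exact: gproj_fin].
have inX s : s \notin X -> gdual_proj s f = 0 /\ gproj gr s v = 0.
  move=> sX; have : ~ [set` X] s by apply/negP.
  by rewrite -hX => /not_orP[/= /negP/negPn/eqP + /negP/negPn/eqP].
rewrite (@fsbigTE _ _ _ _ X); last by move=> s /inX[].
rewrite -[in RHS](gproj_sum gr v) (@fsbigTE _ _ _ _ X); last by move=> s /inX[].
rewrite [RHS]linear_sum /=.
by elim/big_rec2: _ => [//|s a b _ <-].
Qed.

Definition gdual_grading : grading I gdual :=
  Grading gdual_proj_orth gdual_proj_fin gdual_proj_sum.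

End GradedDual.

(* Formal series in z0, z1, z2 with rational exponents, as functions from
   exponents to coefficients. *)
Section Series.
Context (R : realType).
Local Notation C := R[i].

Definition expo := {ffun 'I_3 -> rat}.
Definition z0 : 'I_3 := @Ordinal 3 0 isT.
Definition z1 : 'I_3 := @Ordinal 3 1 isT.
Definition z2 : 'I_3 := @Ordinal 3 2 isT.

Definition series (W : Type) := expo -> W.

Definition xpow (x : 'I_3) (q : rat) : expo :=
  [ffun y => if y == x then q else 0].

Definition monom (x : 'I_3) (q : rat) : series C^o :=
  fun e => (e == xpow x q)%:R.

(* the Cauchy product; every product below has finitely many nonzero terms in
   each coefficient *)
Definition smul (W : lmodType C) (S : series C^o) (A : series W) : series W :=
  fun e => \sum_(d \in [set: expo]) S d *: A (e - d).

(* \sum_(a, b) B a b x^a y^b, for distinct variables x and y *)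
Definition series2 (W : lmodType C) (x y : 'I_3) (B : rat -> rat -> W) :
    series W :=
  fun e => if e == xpow x (e x) + xpow y (e y) then B (e x) (e y) else 0.

Definition gbinom (a : C) (i : nat) : C :=
  (\prod_(j < i) (a - j%:R)) / i`!%:R.

(* (x + s y)^a, expanded in nonnegative powers of y *)
Definition binpow (x : 'I_3) (s : C) (y : 'I_3) (a : rat) : series C^o :=
  fun e => \sum_(i \in [set: nat])
    gbinom (ratr a) i * s ^+ i * (e == xpow x (a - i%:R) + xpow y i%:R)%:R.

(* ((x + s y) / w)^a *)
Definition ratio (x : 'I_3) (s : C) (y w : 'I_3) (a : rat) : series C^o :=
  smul (binpow x s y a) (monom w (- a)).

(* delta ((x + s y) / (t w)) *)
Definition delta (x : 'I_3) (s : C) (y : 'I_3) (t : C) (w : 'I_3) :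
    series C^o :=
  fun e => \sum_(n \in [set: int]) t ^ (- n) * ratio x s y w n%:~R e.

(* z0^-1 delta ((z1 - z2) / z0), and so on; the prefactor comes first in the
   name. *)
Definition delta_z0_12 : series C^o :=
  smul (monom z0 (-1)) (delta z1 (-1) z2 1 z0).
(* delta ((z2 - z1) / - z0) is also the delta ((- z2 + z1) / z0) of the Jacobi
   identity of vertex algebras, as (- z2 + z1)^n = (-1)^n (z2 - z1)^n *)
Definition delta_z0_21 : series C^o :=
  smul (monom z0 (-1)) (delta z2 (-1) z1 (-1) z0).
Definition delta_z1_20 : series C^o :=
  smul (monom z1 (-1)) (delta z2 1 z0 1 z1).
Definition delta_z2_10 : series C^o :=
  smul (monom z2 (-1)) (delta z1 (-1) z0 1 z2).

Definition dz (W : lmodType C) (A : rat -> W) : rat -> W :=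
  fun q => ratr (q + 1) *: A (q + 1).

(* e^(2 pi i r / T) *)
Definition zeta (T r : nat) : C :=
  let x : R := 2 * pi * r%:R / T%:R in (cos x +i* sin x)%C.

Definition eigen (V : lmodType C) (g : V -> V) (T r : nat) : set V :=
  [set v | g v = zeta T r *: v].

(* For g of order T, the projection of V onto eigen g T r along the other
   eigenspaces of g; it extends the operators z^(- ln g / (2 pi i)), given on
   the eigenspaces, to all of V. *)
Definition eigproj (V : lmodType C) (g : V -> V) (T r : nat) (v : V) : V :=
  T%:R^-1 *: \sum_(j < T) zeta T r ^- j *: iter j g v.

Definition has_order (V : Type) (g : V -> V) (T : nat) : Prop :=
  [/\ (0 < T)%N, forall v, iter T g v = v &
      forall m, (0 < m < T)%N -> ~ (forall v, iter m g v = v)].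

Definition virasoro (M : lmodType C) (L : int -> M -> M) (d : C) : Prop :=
  forall j k m, L k (L j m) - L j (L k m) =
    (k - j)%:~R *: L (k + j) m +
    ((k ^+ 3 - k)%:~R / 12 * (k + j == 0)%:R * d) *: m.

End Series.

Section Coalgebra.
Context (R : realType).
Local Notation C := R[i].

(* The coefficient of z^q in \sum_k (Delta k v) z^(-k-1). *)
Definition coser (V W : lmodType C) (Delta : int -> V -> W) (q : rat) (v : V) :
    W :=
  \sum_(k \in [set: int]) if q == - k%:~R - 1 then Delta k v else 0.

(* L(k), from (rho (x) Id) Upsilon(z) = \sum_k L(k) z^(k-2). *)
Definition colie (V M : lmodType C) (rho : V -> C) (U : rat -> M -> V ⊗ M)
    (k : int) (m : M) : M :=
  tcontr_l rho (U (k%:~R - 2) m).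

Record voc (V : lmodType C) (gr : grading int V) := Voc {
  voc_delta : int -> {linear V -> V ⊗ V};
  voc_c : {scalar V};
  voc_rho : {scalar V};
  voc_d : C;
  voc_U := coser voc_delta;
  voc_L := colie voc_rho voc_U;
  voc_fin : forall s, finite_dim (homog gr s);
  voc_bound : exists s0 : int, forall s, s < s0 -> homog gr s = [set 0];
  voc_trunc : forall v, exists k0 : int, forall k, k < k0 -> voc_delta k v = 0;
  voc_deg : forall k s v, homog gr s v ->
    tspan (fun u w => exists a b : int,
             [/\ homog gr a u, homog gr b w & a + b = s + k + 1])
          (voc_delta k v);
  voc_counit : forall q v,
    tcontr_l voc_c (voc_U q v) = if q == 0 then v else 0;
  voc_cocreation : forall v,
    (forall q, q < 0 -> tcontr_r voc_c (voc_U q v) = 0) /\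
    tcontr_r voc_c (voc_U 0 v) = v;
  voc_jacobi : forall v e,
    smul (delta_z0_12 R)
      (series2 z1 z2 (fun a b => tmap id (voc_U b) (voc_U a v))) e
    - smul (delta_z0_21 R)
      (series2 z1 z2 (fun a b => tswap12 (tmap id (voc_U a) (voc_U b v)))) e
    = smul (delta_z1_20 R)
      (series2 z0 z2 (fun a b => tassoc (tmap (voc_U a) id (voc_U b v)))) e;
  voc_virasoro : virasoro voc_L voc_d;
  voc_weight : forall s v, homog gr s v <-> voc_L 0 v = s%:~R *: v;
  voc_deriv : forall v q,
    tmap (voc_L 1) id (voc_U q v) = dz (fun p => voc_U p v) q
}.

Record voc_aut (V : lmodType C) (gr : grading int V) (cV : voc gr) := VocAut {
  voc_aut_fun :> {linear V -> V};
  voc_aut_finv : {linear V -> V};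
  voc_autK : cancel voc_aut_fun voc_aut_finv;
  voc_autVK : cancel voc_aut_finv voc_aut_fun;
  voc_aut_c : forall v, voc_c cV (voc_aut_fun v) = voc_c cV v;
  voc_aut_rho : forall v, voc_rho cV (voc_aut_fun v) = voc_rho cV v;
  voc_aut_delta : forall k v,
    voc_delta cV k (voc_aut_fun v) =
    tmap voc_aut_fun voc_aut_fun (voc_delta cV k v)
}.

Section Inverse.
Context (V : lmodType C) (gr : grading int V) (cV : voc gr) (g : voc_aut cV).
Let gV := voc_aut_finv g.

Fact voc_aut_inv_c v : voc_c cV (gV v) = voc_c cV v.
Proof. by rewrite -(voc_aut_c g) (voc_autVK g). Qed.

Fact voc_aut_inv_rho v : voc_rho cV (gV v) = voc_rho cV v.
Proof. by rewrite -(voc_aut_rho g) (voc_autVK g). Qed.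

Fact voc_aut_inv_delta k v :
  voc_delta cV k (gV v) = tmap gV gV (voc_delta cV k v).
Proof.
rewrite -[in RHS](voc_autVK g v) voc_aut_delta.
by rewrite (tmapK (voc_autK g) (voc_autK g)).
Qed.

Definition voc_aut_inv : voc_aut cV :=
  VocAut (voc_autVK g) (voc_autK g)
    voc_aut_inv_c voc_aut_inv_rho voc_aut_inv_delta.

End Inverse.

(* The coefficient of z^q in
   \sum_k (z^(- ln g / (2 pi i)) (x) Id) (Delta k m) z^(-k-1). *)
Definition tcoser (V M : lmodType C) (g : V -> V) (T : nat)
    (Delta : int -> M -> V ⊗ M) (q : rat) (m : M) : V ⊗ M :=
  \sum_(k \in [set: int]) \sum_(r < T)
    if q == - (r%:R / T%:R) - k%:~R - 1 then
      tmap (eigproj g T r) id (Delta k m) else 0.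

Record weak_comodule (V : lmodType C) (gr : grading int V) (cV : voc gr)
    (g : voc_aut cV) (T : nat) (M : lmodType C) := WeakComodule {
  wc_delta : int -> {linear M -> V ⊗ M};
  wc_U := tcoser g T wc_delta;
  wc_L := colie (voc_rho cV) wc_U;
  wc_trunc : forall m, exists k0 : int, forall k, k < k0 -> wc_delta k m = 0;
  wc_counit : forall q m,
    tcontr_l (voc_c cV) (wc_U q m) = if q == 0 then m else 0;
  wc_jacobi : forall m e,
    smul (delta_z0_12 R)
      (series2 z1 z2 (fun a b => tmap id (wc_U b) (wc_U a m))) e
    - smul (delta_z0_21 R)
      (series2 z1 z2 (fun a b => tswap12 (tmap id (wc_U a) (wc_U b m)))) e
    = \sum_(r < T)
      smul (smul (delta_z2_10 R) (ratio z1 (-1) z0 z2 (- (r%:R / T%:R))))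
        (series2 z0 z2 (fun a b => tmap (eigproj g T r) id
           (tassoc (tmap (voc_U cV a) id (wc_U b m))))) e;
  wc_virasoro : virasoro wc_L (voc_d cV);
  wc_deriv : forall m q,
    tmap (voc_L cV 1) id (wc_U q m) = dz (fun p => wc_U p m) q;
  wc_comm : forall m q,
    dz (fun p => wc_U p m) q = wc_U q (wc_L 1 m) - tmap id (wc_L 1) (wc_U q m)
}.

(* M = \bigoplus_t M_t with t in (1/T) N: the gradings of comodules and modules
   are indexed by all rationals, the components outside (1/T) N being zero. *)
Definition frac_supported (M : lmodType C) (gr : grading rat M) (T : nat) :
    Prop :=
  forall t, ~ (exists n : nat, t = n%:R / T%:R) -> homog gr t = [set 0].

Definition comodule_admissible (V : lmodType C) (gr : grading int V)
    (cV : voc gr) (g : voc_aut cV) (T : nat) (M : lmodType C)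
    (cM : weak_comodule g T M) (grM : grading rat M) : Prop :=
  frac_supported grM T /\
  forall k t m, homog grM t m ->
    tspan (fun v n => exists (r : nat) (a : int) (b : rat),
             [/\ (r < T)%N, eigen g T r v, homog gr a v, homog grM b n &
                 a%:~R + b = t + k%:~R + 1 + r%:R / T%:R])
          (wc_delta cM k m).

End Coalgebra.

Section Algebra.
Context (R : realType).
Local Notation C := R[i].

(* [voa_Y u k] is the mode u_k of Y(u,z) = \sum_k u_k z^(-k-1), and [voa_S u q]
   is the coefficient of z^q in Y(u,z). *)
Record voa (V : lmodType C) (gr : grading int V) := Voa {
  voa_Y : V -> int -> {linear V -> V};
  voa_one : V;
  voa_omega : V;
  voa_d : C;
  voa_S := (fun u (q : rat) v => coser (voa_Y u) q v);
  voa_L := (fun k : int => voa_Y voa_omega (k + 1) : V -> V);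
  voa_linear : forall k v, linear (fun u => voa_Y u k v);
  voa_fin : forall s, finite_dim (homog gr s);
  voa_bound : exists s0 : int, forall s, s < s0 -> homog gr s = [set 0];
  voa_trunc : forall u v, exists k0 : int, forall k, k0 < k -> voa_Y u k v = 0;
  voa_vacuum : forall q v, voa_S voa_one q v = if q == 0 then v else 0;
  voa_creation : forall v,
    (forall q, q < 0 -> voa_S v q voa_one = 0) /\ voa_S v 0 voa_one = v;
  voa_jacobi : forall u v w e,
    smul (delta_z0_12 R)
      (series2 z1 z2 (fun a b => voa_S u a (voa_S v b w))) e
    - smul (delta_z0_21 R)
      (series2 z1 z2 (fun a b => voa_S v b (voa_S u a w))) e
    = smul (delta_z2_10 R)
      (series2 z0 z2 (fun a b => voa_S (voa_S u a v) b w)) e;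
  voa_virasoro : virasoro voa_L voa_d;
  voa_weight : forall s v, homog gr s v -> voa_L 0 v = s%:~R *: v;
  voa_deriv : forall u v q,
    voa_S (voa_L (-1) u) q v = dz (fun p => voa_S u p v) q
}.

Record voa_aut (V : lmodType C) (gr : grading int V) (aV : voa gr) := VoaAut {
  voa_aut_fun :> {linear V -> V};
  voa_aut_finv : {linear V -> V};
  voa_autK : cancel voa_aut_fun voa_aut_finv;
  voa_autVK : cancel voa_aut_finv voa_aut_fun;
  voa_aut_one : voa_aut_fun (voa_one aV) = voa_one aV;
  voa_aut_omega : voa_aut_fun (voa_omega aV) = voa_omega aV;
  voa_aut_Y : forall u k v,
    voa_aut_fun (voa_Y aV u k v) = voa_Y aV (voa_aut_fun u) k (voa_aut_fun v)
}.

Section Inverse.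
Context (V : lmodType C) (gr : grading int V) (aV : voa gr) (h : voa_aut aV).
Let hV := voa_aut_finv h.

Fact voa_aut_inv_one : hV (voa_one aV) = voa_one aV.
Proof. by rewrite -{1}(voa_aut_one h) (voa_autK h). Qed.

Fact voa_aut_inv_omega : hV (voa_omega aV) = voa_omega aV.
Proof. by rewrite -{1}(voa_aut_omega h) (voa_autK h). Qed.

Fact voa_aut_inv_Y u k v : hV (voa_Y aV u k v) = voa_Y aV (hV u) k (hV v).
Proof.
rewrite -{1}(voa_autVK h u) -{1}(voa_autVK h v) -voa_aut_Y.
by rewrite /hV (voa_autK h).
Qed.

Definition voa_aut_inv : voa_aut aV :=
  VoaAut (voa_autVK h) (voa_autK h)
    voa_aut_inv_one voa_aut_inv_omega voa_aut_inv_Y.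

End Inverse.

(* [wm_Y u t] is the mode u_t of Y_N(u,z) = \sum_t u_t z^(-t-1), and
   [wm_S u q] is the coefficient of z^q in Y_N(u,z). *)
Record weak_module (V : lmodType C) (gr : grading int V) (aV : voa gr)
    (h : voa_aut aV) (T : nat) (N : lmodType C) := WeakModule {
  wm_Y : V -> rat -> {linear N -> N};
  wm_S := (fun u (q : rat) n => wm_Y u (- q - 1) n);
  wm_linear : forall t n, linear (fun u => wm_Y u t n);
  wm_modes : forall r u t n, (r < T)%N -> eigen h T r u ->
    ~ (exists k : int, t = k%:~R + r%:R / T%:R) -> wm_Y u t n = 0;
  wm_trunc : forall u n, exists t0 : rat, forall t, t0 < t -> wm_Y u t n = 0;
  wm_vacuum : forall q n, wm_S (voa_one aV) q n = if q == 0 then n else 0;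
  wm_jacobi : forall r u v n e, (r < T)%N -> eigen h T r u ->
    smul (delta_z0_12 R)
      (series2 z1 z2 (fun a b => wm_S u a (wm_S v b n))) e
    - smul (delta_z0_21 R)
      (series2 z1 z2 (fun a b => wm_S v b (wm_S u a n))) e
    = smul (smul (delta_z2_10 R) (ratio z1 (-1) z0 z2 (- (r%:R / T%:R))))
      (series2 z0 z2 (fun a b => wm_S (voa_S aV u a v) b n)) e
}.

Definition module_admissible (V : lmodType C) (gr : grading int V)
    (aV : voa gr) (h : voa_aut aV) (T : nat) (N : lmodType C)
    (mN : weak_module h T N) (grN : grading rat N) : Prop :=
  frac_supported grN T /\
  forall (a : V) (w : int) (s t : rat) (n : N), homog gr w a -> homog grN t n ->
    homog grN (w%:~R + t - s - 1) (wm_Y mN a s n).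

End Algebra.

Section Duality.
Context (R : realType).
Local Notation C := R[i].

(* The vertex operator algebra structure of V', for V a coalgebra:
   1 = c|_{V_0}, omega = rho|_{V_2}, and
   (Y(f, z) f', v) = (f (x) f', Upsilon(z) v). *)
Record is_dual_voa (V : lmodType C) (gr : grading int V) (cV : voc gr)
    (aD : voa (gdual_grading gr)) : Prop := IsDualVoa {
  dual_voa_one : forall v, voa_one aD v = voc_c cV (gproj gr 0 v);
  dual_voa_omega : forall v, voa_omega aD v = voc_rho cV (gproj gr 2 v);
  dual_voa_Y : forall (f f' : gdual gr) q v,
    voa_S aD f q f' v = tpair f f' (voc_U cV q v)
}.

(* The coalgebra structure of V', for V a vertex operator algebra. *)
Record is_dual_voc (V : lmodType C) (gr : grading int V) (aV : voa gr)
    (cD : voc (gdual_grading gr)) : Prop := IsDualVoc {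
  dual_voc_c : forall f : gdual gr, voc_c cD f = f (voa_one aV);
  dual_voc_rho : forall f : gdual gr, voc_rho cD f = f (voa_omega aV);
  dual_voc_U : forall (f : gdual gr) q u v,
    tpair (fun f1 : gdual gr => f1 u) (fun f2 : gdual gr => f2 v)
      (voc_U cD q f) = f (voa_S aV u q v)
}.

(* The action on V' of the map with inverse ginv. *)
Definition is_dual_action (V : lmodType C) (gr : grading int V)
    (ginv : V -> V) (gD : gdual gr -> gdual gr) : Prop :=
  forall f v, gD f v = f (ginv v).

End Duality.

(* Main.v *)
Require Import Defs.
From HB Require Import structures.
From mathcomp Require Import all_boot all_order all_algebra.
From mathcomp Require Import finmap complex ring lra zify.
From mathcomp Require Import all_classical reals trigo.

Set Implicit Arguments.
Unset Strict Implicit.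
Unset Printing Implicit Defensive.
Import Order.TTheory GRing.Theory Num.Theory.
Local Open Scope classical_set_scope.
Local Open Scope ring_scope.

(** Both halves are transpositions along the natural pairing. Contracting the
    first tensor factor of a coaction U with a functional f on V gives
    operators m |-> (f (x) Id)(U_q m) on the comodule, where U_q is the
    coefficient of z^q, and their transposes are the modes of f on the dual
    ([comode]). Conversely the transposes of the modes of a module are the
    contractions of a coaction ([coact]): an element of A' (x) W is determined
    by its contractions with the vectors of A ([gdual_tensor_ext]), and every
    linear map A -> W that is supported in finitely many degrees is obtained
    from such an element ([tensor_of_map]). Both facts express that each
    homogeneous subspace of A is finite-dimensional, hence has a dual basis
    ([dual_basis]). The module enters only through its degrees, which are
    bounded below.

    Once the delta functions are expanded, a coefficient of each term of a
    Jacobi identity is a sum of numbers times B_(p+k, q-k) over the natural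
    numbers k ([strip], [jacobi12], [jacobi21], [jacobi_twist]). This sum is
    finite for modes because their exponents are bounded below, and for
    coactions because their exponents are bounded above. Linear maps commute
    with it ([strip_lin]), so that contraction with functionals or with vectors
    carries the Jacobi identity for tensors to the one for operators and back.
    The two ways of writing the delta function on the right-hand side agree by
    the reflection formula for binomial coefficients, and the twisting factor is
    absorbed by Vandermonde's identity.

    Some axioms are not mere transposes. That the modes of a vertex operator
    algebra are homogeneous comes from their commutators with L(0)
    ([voa_S_deg]). A comodule must satisfy the L(-1)-derivative property and the
    Virasoro relations, and for a twisted module both are consequences of its
    Jacobi identity ([wm_deriv], [wm_virasoro_modes]). In the other direction
    the vacuum and the conformal vector of V' are only the restrictions of c and
    rho to V_0 and V_2. They act like c and rho themselves, because the counit
    identity and the operators L(k) are homogeneous ([dvoa_one_contr],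
    [dvoa_omega_contr], [dmod_vacuum]).

    Finally, an automorphism g of order T acts on the dual by f |-> f o g^-1,
    and an eigenfunctional of f |-> f o g vanishes on the eigenspaces of g for
    all other eigenvalues. So transposition exchanges the eigenprojections of g
    with those of the inverse of the dual action ([eigproj_gpull]), which is why
    a g-twisted structure dualizes to a g^-1-twisted one with the same fractional
    exponents. *)

(** * Contractions of tensors *)

Section Contraction.
Context (F : fieldType).
Implicit Types U V W : lmodType F.

(** Maps built from [tlift] carry no linear structure of their own; this and the
    next lemmas give access to the theory of linear maps from a proof of
    linearity. *)
Definition linear_of V W (f : V -> W) (lf : linear f) : {linear V -> W} :=
  HB.pack f (GRing.isLinear.Build F V W *:%R f lf).

Lemma linear_comp V W U (f : V -> W) (g : W -> U) :
  linear f -> linear g -> linear (g \o f).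
Proof. by move=> lf lg a x y /=; rewrite lf lg. Qed.

Lemma linear_sum_bare V W (f : V -> W) (lf : linear f) I (r : seq I) P E :
  f (\sum_(i <- r | P i) E i) = \sum_(i <- r | P i) f (E i).
Proof. exact: (linear_sum (linear_of lf)). Qed.

Lemma linear0_bare V W (f : V -> W) : linear f -> f 0 = 0.
Proof. by move=> lf; exact: (linear0 (linear_of lf)). Qed.

Lemma linearZ_bare V W (f : V -> W) : linear f -> forall a x, f (a *: x) = a *: f x.
Proof. by move=> lf a x; exact: (scalable_linear lf). Qed.

Lemma linearD_bare V W (f : V -> W) : linear f -> {morph f : x y / x + y}.
Proof. by move=> lf x y; exact: (linearD (linear_of lf)). Qed.

Lemma linearB_bare V W (f : V -> W) : linear f -> {morph f : x y / x - y}.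
Proof. by move=> lf x y; exact: (linearB (linear_of lf)). Qed.

Lemma tpure_linr V W (v : V) : linear (@tpure F V W v).
Proof. exact: (tpure_bilin V W).1. Qed.

Lemma tpure_linl V W (w : W) : linear (fun v : V => tpure v w).
Proof. exact: (tpure_bilin V W).2. Qed.

Lemma tpureZr V W (v : V) a (w : W) : tpure v (a *: w) = a *: tpure v w.
Proof. exact: linearZ_bare (tpure_linr v) a w. Qed.

Lemma tpureZl V W a (v : V) (w : W) : tpure (a *: v) w = a *: tpure v w.
Proof. exact: linearZ_bare (tpure_linl w) a v. Qed.

Lemma tpure0r V W (v : V) : tpure v (0 : W) = 0.
Proof. exact: linear0_bare (tpure_linr v). Qed.

Lemma tmap_tpure V W V' W' (f : V -> V') (g : W -> W') :
  linear f -> linear g ->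
  forall v w, tmap f g (tpure v w) = tpure (f v) (g w).
Proof. by move=> lf lg v w; exact: (tmap_pure (linear_of lf) (linear_of lg)). Qed.

Lemma tmap_lin V W V' W' (f : V -> V') (g : W -> W') :
  linear f -> linear g -> linear (tmap f g).
Proof. by move=> lf lg; exact: (tmap_linear (linear_of lf) (linear_of lg)). Qed.

Lemma linear_id V : linear (id : V -> V). Proof. by []. Qed.

Lemma tcontr_l_bilin V W (c : V -> F) :
  scalar c -> bilin (fun v w => c v *: w : W).
Proof.
move=> lc; split=> [v a x y | w a x y].
  by rewrite scalerDr !scalerA mulrC.
by rewrite lc scalerDl scalerA.
Qed.

Lemma tcontr_r_bilin V W (c : W -> F) :
  scalar c -> bilin (fun v w => c w *: v : V).
Proof.
move=> lc; split=> [w a x y | v a x y].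
  by rewrite lc scalerDl scalerA.
by rewrite scalerDr !scalerA mulrC.
Qed.

Lemma tcontr_l_pure V W (c : V -> F) : scalar c ->
  forall v (w : W), tcontr_l c (tpure v w) = c v *: w.
Proof. by move=> lc v w; exact/tlift_pure/tcontr_l_bilin. Qed.

Lemma tcontr_r_pure V W (c : W -> F) : scalar c ->
  forall (v : V) w, tcontr_r c (tpure v w) = c w *: v.
Proof. by move=> lc v w; exact/tlift_pure/tcontr_r_bilin. Qed.

Lemma tcontr_l_lin V W (c : V -> F) : scalar c -> linear (@tcontr_l F V W c).
Proof. by move=> lc; exact: (tlift_linear (tcontr_l_bilin W lc)). Qed.

Lemma tcontr_r_lin V W (c : W -> F) : scalar c -> linear (@tcontr_r F V W c).
Proof. by move=> lc; exact: (tlift_linear (tcontr_r_bilin V lc)). Qed.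

Lemma tpair_bilin V W (f : V -> F) (g : W -> F) :
  scalar f -> scalar g -> bilin (fun v w => f v * g w : F^o).
Proof.
move=> lf lg; split=> [v a x y | w a x y].
  by rewrite lg mulrDr mulrCA.
by rewrite lf mulrDl -mulrA.
Qed.

Lemma tpair_scalar V W (f : V -> F) (g : W -> F) :
  scalar f -> scalar g -> scalar (tpair f g).
Proof. by move=> lf lg; exact: (tlift_linear (tpair_bilin lf lg)). Qed.

(** A pairing of two tensors may be computed one factor at a time; everything
    below is phrased with one-sided contractions. *)
Lemma tpair_contr V W (f : V -> F) (g : W -> F) : scalar f -> scalar g ->
  forall x, tpair f g x = g (tcontr_l f x).
Proof.
move=> lf lg; apply: (@tensor_linear_eq F V W F^o) => [||v w].
- exact: tpair_scalar.
- exact: (linear_comp (U := F^o) (tcontr_l_lin lf) lg).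
rewrite tcontr_l_pure// /tpair tlift_pure; last exact: tpair_bilin.
by rewrite (linearZ_bare (W := F^o) lg).
Qed.

Lemma tcontr_l_tmap V W V' W' (c : V' -> F) (f : V -> V') (g : W -> W') :
  scalar c -> linear f -> linear g ->
  forall x, tcontr_l c (tmap f g x) = g (tcontr_l (c \o f) x).
Proof.
move=> lc lf lg.
have lcf : scalar (c \o f) by move=> a x y /=; rewrite lf lc.
apply: tensor_linear_eq => [||v w].
- exact: (linear_comp (tmap_lin lf lg) (tcontr_l_lin lc)).
- exact: (linear_comp (tcontr_l_lin lcf) lg).
by rewrite tmap_tpure// !tcontr_l_pure//= (linearZ_bare lg).
Qed.

(** Contractions of the two factors commute, so a contraction on the right, as in
    the cocreation axiom, can be tested through contractions on the left. *)
Lemma tcontr_lr V W (c : V -> F) (d : W -> F) : scalar c -> scalar d ->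
  forall x : V ⊗ W, d (tcontr_l c x) = c (tcontr_r d x).
Proof.
move=> lc ld; apply: (@tensor_linear_eq F V W F^o) => [||v w].
- exact: (linear_comp (U := F^o) (tcontr_l_lin lc) ld).
- exact: (linear_comp (U := F^o) (tcontr_r_lin ld) lc).
rewrite tcontr_l_pure// tcontr_r_pure// (linearZ_bare (W := F^o) ld).
rewrite (linearZ_bare (W := F^o) lc). exact: mulrC.
Qed.

Lemma tswap12_bilin U V W :
  (forall u : U, bilin (fun (v : V) (w : W) => tpure v (tpure u w))) /\
  bilin (fun (u : U) (x : V ⊗ W) => tlift (fun v w => tpure v (tpure u w)) x).
Proof.
have b1 (u : U) : bilin (fun (v : V) (w : W) => tpure v (tpure u w)).
  split=> [v a x y | w a x y]; last by rewrite ((tpure_bilin _ _).2 _).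
  by rewrite ((tpure_bilin _ _).1 u) ((tpure_bilin _ _).1 v).
split=> //; split=> [u|x a u u']; first exact: tlift_linear.
move: x; apply: tensor_linear_eq.
- exact: tlift_linear.
- by move=> b x y; rewrite !tlift_linear// !scalerDr !scalerA mulrC addrACA.
move=> v w; rewrite !tlift_pure//.
by rewrite ((tpure_bilin _ _).2 w) ((tpure_bilin _ _).1 v).
Qed.

Lemma tswap12_pure U V W (u : U) (v : V) (w : W) :
  tswap12 (tpure u (tpure v w)) = tpure v (tpure u w).
Proof.
have [b1 b2] := tswap12_bilin U V W.
by rewrite /tswap12 !tlift_pure.
Qed.

Lemma tswap12_lin U V W : linear (@tswap12 F U V W).
Proof. exact: (tlift_linear (tswap12_bilin U V W).2). Qed.

Lemma tensor3_linear_eq U V W (X : lmodType F) (f g : U ⊗ (V ⊗ W) -> X) :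
  linear f -> linear g ->
  (forall u v w, f (tpure u (tpure v w)) = g (tpure u (tpure v w))) -> f =1 g.
Proof.
move=> lf lg h; apply: tensor_linear_eq => // u.
have lp := (tpure_bilin U (V ⊗ W)).1 u.
apply: tensor_linear_eq => [||v w]; last exact: h.
- exact: (linear_comp lp lf).
- exact: (linear_comp lp lg).
Qed.

(** Together with [tcontr_assoc] and [tcontr_l_tmap], this turns the three terms
    of a coalgebraic Jacobi identity into compositions of contracted operators. *)
Lemma tcontr_swap12 U V W (c : U -> F) (d : V -> F) : scalar c -> scalar d ->
  forall x : U ⊗ (V ⊗ W),
  tcontr_l c (tcontr_l d (tswap12 x)) = tcontr_l d (tcontr_l c x).
Proof.
move=> lc ld; apply: tensor3_linear_eq => [||u v w].
- apply: (linear_comp (f := tcontr_l d \o @tswap12 F U V W) (g := tcontr_l c)); last exact: tcontr_l_lin.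
  by apply: linear_comp; [exact: tswap12_lin | exact: tcontr_l_lin].
- exact: (linear_comp (tcontr_l_lin lc) (tcontr_l_lin ld)).
rewrite tswap12_pure !tcontr_l_pure//.
rewrite (linearZ_bare (tcontr_l_lin lc)) (linearZ_bare (tcontr_l_lin ld)).
by rewrite !tcontr_l_pure// !scalerA mulrC.
Qed.

Lemma tassoc_bilin U V W :
  (forall w : W, bilin (fun (u : U) (v : V) => tpure u (tpure v w))) /\
  bilin (fun (x : U ⊗ V) (w : W) => tlift (fun u v => tpure u (tpure v w)) x).
Proof.
have b1 (w : W) : bilin (fun (u : U) (v : V) => tpure u (tpure v w)).
  split=> [u a x y | v a x y]; last by rewrite ((tpure_bilin _ _).2 _).
  by rewrite ((tpure_bilin _ _).2 w) ((tpure_bilin _ _).1 u).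
split=> //; split=> [x a w w'|w]; last exact: tlift_linear.
move: x; apply: tensor_linear_eq.
- exact: tlift_linear.
- by move=> b x y; rewrite !tlift_linear// !scalerDr !scalerA mulrC addrACA.
move=> u v; rewrite !tlift_pure//.
by rewrite ((tpure_bilin _ _).1 v) ((tpure_bilin _ _).1 u).
Qed.

Lemma tassoc_pure U V W (u : U) (v : V) (w : W) :
  tassoc (tpure (tpure u v) w) = tpure u (tpure v w).
Proof.
have [b1 b2] := tassoc_bilin U V W.
by rewrite /tassoc !tlift_pure.
Qed.

Lemma tassoc_lin U V W : linear (@tassoc F U V W).
Proof. exact: (tlift_linear (tassoc_bilin U V W).2). Qed.

Lemma tcontr_assoc U V W (c : U -> F) (d : V -> F) : scalar c -> scalar d ->
  forall x : (U ⊗ V) ⊗ W,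
  tcontr_l d (tcontr_l c (tassoc x)) = tcontr_l (tpair c d) x.
Proof.
move=> lc ld; have lcd := tpair_scalar lc ld.
have l1 : linear (fun x : (U ⊗ V) ⊗ W => tcontr_l d (tcontr_l c (tassoc x))).
  apply: (linear_comp (f := tcontr_l c \o @tassoc F U V W) (g := tcontr_l d)); last exact: tcontr_l_lin.
  by apply: linear_comp; [exact: tassoc_lin | exact: tcontr_l_lin].
apply: tensor_linear_eq => [||y w] //; first exact: tcontr_l_lin.
have lw := (tpure_bilin (U ⊗ V) W).2 w.
rewrite [RHS]tcontr_l_pure//; move: y; apply: tensor_linear_eq.
- exact: (linear_comp lw l1).
- by move=> a x y; rewrite lcd scalerDl scalerA.
move=> u v; rewrite tassoc_pure tcontr_l_pure// (linearZ_bare (tcontr_l_lin ld)).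
rewrite tcontr_l_pure// scalerA /tpair tlift_pure//; exact: tpair_bilin.
Qed.

(** How homogeneity of a coaction is used: two linear maps agree on a homogeneous
    component of the tensor product when they agree on its generators. *)
Lemma tspan_contr V W U (P : V -> W -> Prop) (f g : V ⊗ W -> U) :
  linear f -> linear g -> (forall v w, P v w -> f (tpure v w) = g (tpure v w)) ->
  forall x, tspan P x -> f x = g x.
Proof.
move=> lf lg h x [s [sP ->]].
rewrite !linear_sum_bare// !big_seq; apply: eq_bigr => p /sP ps.
by rewrite !linearZ_bare// h.
Qed.

End Contraction.

(** * Formal series supported on lines of exponents *)

Section Finsum.

Lemma fsum_single (T : choiceType) (V : nmodType) (F : T -> V) i :
  (forall j, j != i -> F j = 0) -> \sum_(j \in [set: T]) F j = F i.
Proof.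
move=> h; rewrite -(fsbig_widen [set i]) ?fsbig_set1//.
by move=> j [_ /= /eqP]; apply: h.
Qed.

(** Sums over an infinite set are 0 by convention unless the summand has finite
    support, so every product of series below must come with a bound. *)
Lemma fsum_trunc (V : nmodType) (F : nat -> V) N :
  (forall k, (N <= k)%N -> F k = 0) ->
  \sum_(k \in [set: nat]) F k = \sum_(k < N) F k.
Proof.
move=> h; rewrite fsbig_ord -(fsbig_widen `I_N)//.
by move=> j [_ /= /negP]; rewrite -leqNgt; apply: h.
Qed.

End Finsum.

Section Gbinom.
Context (R : realType).
Local Notation C := R[i].
Implicit Types a b : C.

Lemma gbinom0 a : gbinom a 0 = 1.
Proof. by rewrite /gbinom big_ord0 divr1. Qed.

(** The recurrence that characterizes generalized binomial coefficients; it
    replaces manipulations of the defining product. *)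
Lemma gbinomS a k : k.+1%:R * gbinom a k.+1 = (a - k%:R) * gbinom a k.
Proof.
rewrite /gbinom big_ord_recr /= factS natrM invfM.
have k0 : k.+1%:R != 0 :> C by rewrite pnatr_eq0.
have f0 : k`!%:R != 0 :> C by rewrite pnatr_eq0 -lt0n fact_gt0.
by field; rewrite f0 nat1r.
Qed.

Lemma gbinom1 a : gbinom a 1 = a.
Proof. by have := gbinomS a 0; rewrite mul1r gbinom0 subr0 mulr1. Qed.

(** Vandermonde's identity for arbitrary exponents, by induction on k: multiply by
    k + 1 and distribute this factor as i + (k + 1 - i) over the sum. *)
Lemma gbinomD a b k :
  gbinom (a + b) k = \sum_(i < k.+1) gbinom a i * gbinom b (k - i).
Proof.
elim: k => [|k IH]; first by rewrite big_ord1 !gbinom0 mulr1.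
have k0 : k.+1%:R != 0 :> C by rewrite pnatr_eq0.
apply: (mulfI k0); rewrite gbinomS {}IH !mulr_sumr.
transitivity (\sum_(i < k.+2) (i%:R * gbinom a i * gbinom b (k.+1 - i) +
    gbinom a i * ((k.+1 - i)%:R * gbinom b (k.+1 - i)))); last first.
  apply: eq_bigr => i _; have ik : (i <= k.+1)%N by rewrite -ltnS.
  by rewrite natrB//; ring.
rewrite [RHS]big_split /= [X in _ = X + _]big_ord_recl /= 2!mul0r add0r.
rewrite [X in _ = _ + X]big_ord_recr /= subnn mul0r mulr0 addr0 -[RHS]big_split /=.
apply: eq_bigr => i _; have ik : (i <= k)%N by rewrite -ltnS.
rewrite /bump /= add1n subSS gbinomS subSn// gbinomS natrB//; ring.
Qed.

(** Reversing the factors of the product. This is what makes the expansions of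
    (z2 + z0)^n and (z1 - z0)^m correspond under the delta function. *)
Lemma gbinom_reflect a k : gbinom a k * (-1) ^+ k = gbinom (k%:R - 1 - a) k.
Proof.
rewrite /gbinom mulrAC; congr (_ / _).
have -> : (-1) ^+ k = \prod_(j < k) (-1 : C) by rewrite prodr_const card_ord.
rewrite -big_split /= (reindex_inj rev_ord_inj) /=.
apply: eq_bigr => j _; rewrite natrB; last exact: ltn_ord.
by rewrite -natr1; ring.
Qed.

Lemma gbinom_nat (n k : nat) : (n < k)%N -> gbinom (n%:R : C) k = 0.
Proof.
by move=> nk; rewrite /gbinom (bigD1 (Ordinal nk))//= subrr !mul0r.
Qed.

End Gbinom.

Section Exponents.
Context (R : realType).
Local Notation C := R[i].

(** The three variables in some order: w is the variable in the denominator of a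
    delta function, and x + s y its numerator, expanded in powers of y. *)
Definition triple (w x y : 'I_3) : Prop := uniq [:: w; x; y].

(** The exponent of the monomial w^p x^q y^r. *)
Definition ex3 (w x y : 'I_3) (p q r : rat) : expo :=
  [ffun v => if v == w then p else if v == x then q else r].

Lemma triple_cover w x y : triple w x y -> forall v, [|| v == w, v == x | v == y].
Proof.
by move: w x y => [[|[|[|//]]] ?] [[|[|[|//]]] ?] [[|[|[|//]]] ?] // _
  [[|[|[|//]]] ?].
Qed.

Lemma triple_neq w x y : triple w x y ->
  (x == w = false) * (y == w = false) * (y == x = false) *
  (w == x = false) * (w == y = false) * (x == y = false).
Proof.
rewrite /triple /= !inE !negb_or => /andP[/andP[wx wy] /andP[xy _]].
by rewrite !(eq_sym _ w) !(eq_sym y x) (negPf wx) (negPf wy) (negPf xy).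
Qed.

Lemma ex3_eval w x y p q r : triple w x y ->
  (ex3 w x y p q r w = p) * (ex3 w x y p q r x = q) * (ex3 w x y p q r y = r).
Proof. by move=> t; rewrite !ffunE ?(triple_neq t) !eqxx. Qed.

Lemma expo_ext w x y (e e' : expo) : triple w x y ->
  e w = e' w -> e x = e' x -> e y = e' y -> e = e'.
Proof.
move=> t ew ex ey; apply/ffunP => v.
by case/or3P: (triple_cover t v) => /eqP ->.
Qed.

Lemma xpow_eval x q y : xpow x q y = if y == x then q else 0.
Proof. by rewrite ffunE. Qed.

Lemma smul_monoml (W : lmodType C) x q (A : series W) e :
  smul (monom R x q) A e = A (e - xpow x q).
Proof.
rewrite /smul (fsum_single (i := xpow x q)) /monom ?eqxx ?scale1r//.
by move=> d /negPf ->; rewrite scale0r.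
Qed.

Lemma smul_monomr x q (A : series C^o) e :
  smul A (monom R x q) e = A (e - xpow x q).
Proof.
rewrite /smul (fsum_single (i := e - xpow x q)) /monom.
  by rewrite subKr eqxx; apply: mulr1.
move=> d /negP dn; case: eqP => [de|_]; last exact: mulr0.
by exfalso; apply: dn; rewrite -de subKr.
Qed.

Lemma binpow_ex3 w x y s a p q k : triple w x y ->
  binpow x s y a (ex3 w x y p q k%:R) =
  if (p == 0) && (q + k%:R == a) then gbinom (ratr a) k * s ^+ k else 0 :> C.
Proof.
move=> t; have eqE i : (ex3 w x y p q k%:R == xpow x (a - i%:R) + xpow y i%:R) =
    [&& p == 0, q == a - i%:R & i == k].
  apply/eqP/and3P => [h|[/eqP -> /eqP -> /eqP ->]]; last first.
    by apply: (expo_ext t); rewrite !(ex3_eval _ _ _ t) ffunE !xpow_eval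
      ?(triple_neq t) ?eqxx ?addr0 ?add0r.
  have := congr1 (fun d : expo => d w) h; have := congr1 (fun d : expo => d x) h; have := congr1 (fun d : expo => d y) h.
  rewrite !(ex3_eval _ _ _ t) !ffunE ?(triple_neq t) !eqxx !addr0 !add0r.
  by move=> /eqP; rewrite eqr_nat eq_sym => ik -> ->; rewrite !eqxx.
rewrite /binpow (fsum_single (i := k)); last first.
  by move=> i /negPf ik; rewrite eqE ik !andbF mulr0.
rewrite eqE eqxx andbT [q == _]eq_sym subr_eq [a == _]eq_sym.
by case: ifP => _; rewrite ?mulr1 ?mulr0.
Qed.

Lemma binpow_supp w x y s a e : triple w x y -> binpow x s y a e != 0 :> C ->
  exists k : nat, e = ex3 w x y 0 (a - k%:R) k%:R.
Proof.
move=> t; apply: contra_neqP => h; rewrite /binpow fsbig1// => i _.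
case: eqP => [ei|_]; last by rewrite mulr0.
exfalso; apply: h; exists i; rewrite ei; apply: (expo_ext t);
  by rewrite !(ex3_eval _ _ _ t) ffunE !xpow_eval ?(triple_neq t) ?eqxx
    ?addr0 ?add0r.
Qed.

Lemma ratioE x s y w a e : Defs.ratio x s y w a e = binpow x s y a (e + xpow w a) :> C.
Proof.
rewrite /Defs.ratio smul_monomr; congr (binpow _ _ _ _ _).
by apply/ffunP => v; rewrite !ffunE; case: ifP; rewrite ?subrr ?opprK ?oppr0.
Qed.

Lemma ex3_shift w x y p q r p' : triple w x y ->
  ex3 w x y p q r + xpow w p' = ex3 w x y (p + p') q r.
Proof.
move=> t; apply: (expo_ext t);
  by rewrite ffunE !(ex3_eval _ _ _ t) xpow_eval ?(triple_neq t) ?eqxx ?addr0.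
Qed.

Lemma ratio_supp w x y s a e : triple w x y -> Defs.ratio x s y w a e != 0 :> C ->
  exists k : nat, e = ex3 w x y (- a) (a - k%:R) k%:R.
Proof.
move=> t; rewrite ratioE => /(binpow_supp t)[k ek]; exists k.
by rewrite -[e](addrK (xpow w a)) ek; apply: (expo_ext t);
  rewrite !ffunE ?(triple_neq t) ?eqxx ?subr0 ?add0r.
Qed.

Lemma ratio_ex3 w x y s a p q k : triple w x y ->
  Defs.ratio x s y w a (ex3 w x y p q k%:R) =
  if (p == - a) && (q + k%:R == a) then gbinom (ratr a) k * s ^+ k else 0 :> C.
Proof.
by move=> t; rewrite ratioE ex3_shift// binpow_ex3// addr_eq0.
Qed.

Definition dkernel (w x y : 'I_3) (s t : C) : series C^o :=
  smul (monom R w (-1)) (delta x s y t w).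

Lemma dkernelE w x y s t e :
  dkernel w x y s t e = delta x s y t w (e + xpow w 1).
Proof.
rewrite /dkernel smul_monoml; congr (delta _ _ _ _ _ _).
by apply/ffunP => v; rewrite !ffunE; case: ifP; rewrite ?opprK ?oppr0.
Qed.

Lemma dkernel_int w x y s t (n : int) q (k : nat) : triple w x y ->
  dkernel w x y s t (ex3 w x y (- n%:~R - 1) q k%:R) =
  if q + k%:R == n%:~R then t ^ (- n) * (gbinom n%:~R k * s ^+ k) else 0.
Proof.
move=> tr; rewrite dkernelE ex3_shift// subrK /delta (fsum_single (i := n)).
  by rewrite ratio_ex3// eqxx /= ratr_int; case: ifP => // _; rewrite mulr0.
move=> m mn; rewrite ratio_ex3// eqr_opp eqr_int eq_sym (negPf mn) /=.
by rewrite mulr0.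
Qed.

Lemma dkernel_nint w x y s t p q (k : nat) : triple w x y ->
  p \isn't a Num.int -> dkernel w x y s t (ex3 w x y p q k%:R) = 0.
Proof.
move=> tr pn; rewrite dkernelE ex3_shift// /delta fsbig1// => n _.
rewrite ratio_ex3//; case: eqP => [pe|]; last by rewrite mulr0.
by move: pn; rewrite -[p](addrK 1) pe rpredB ?rpred1// rpredN rpred_int.
Qed.

(** Delta functions satisfy the hypothesis of [smul_nsum] on the left factor. *)
Lemma dkernel_supp w x y s t e : triple w x y -> dkernel w x y s t e != 0 ->
  exists k : nat, e = ex3 w x y (e w) (-1 - e w - k%:R) k%:R.
Proof.
move=> tr; rewrite dkernelE; apply: contra_neqP => h; rewrite /delta fsbig1//.
move=> n _; apply/eqP/negPn/negP => n0.
have /(ratio_supp tr)[k ek] : Defs.ratio x s y w n%:~R (e + xpow w 1) != 0 :> C.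
  by apply: contraNneq n0 => ->; rewrite mulr0.
apply: h; exists k; move: (ek); rewrite -[e + _](subrK 0) => _.
have := congr1 (fun d : expo => d w) ek; have := congr1 (fun d : expo => d x) ek; have := congr1 (fun d : expo => d y) ek.
rewrite !(ex3_eval _ _ _ tr) !ffunE ?(triple_neq tr) !eqxx !addr0.
move=> ey ex ew; apply: (expo_ext tr); rewrite !(ex3_eval _ _ _ tr)//.
by rewrite ex; lra.
Qed.

Definition nsum (W : lmodType C) (c : nat -> C) (B : nat -> W) : W :=
  \sum_(k \in [set: nat]) c k *: B k.

(** In a product whose left factor is supported in the nonnegative integral powers
    of y and in total degree -1, and whose right factor involves a single power
    of w, the exponent of y determines the left monomial, so that the product is
    a sum over one natural number. *)
Lemma smul_nsum (W : lmodType C) w x y (K : series C^o) (A : series W) c (e : expo) :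
    triple w x y ->
    (forall d, K d != 0 ->
       exists k : nat, d = ex3 w x y (d w) (-1 - d w - k%:R) k%:R) ->
    (forall d, A d != 0 -> d w = c) ->
  let dk (k : nat) := ex3 w x y (e w - c) (-1 - (e w - c) - k%:R) k%:R in
  smul K A e = nsum (fun k => K (dk k)) (fun k => A (e - dk k)).
Proof.
move=> tr hK hA dk; rewrite /smul.
have dk_inj : injective dk.
  move=> i j /(congr1 (fun d : expo => d y)); rewrite !(ex3_eval _ _ _ tr) => /eqP.
  by rewrite eqr_nat => /eqP.
rewrite -(fsbig_widen (range dk)) ?fsbig_image//.
  by move=> i j _ _; exact: dk_inj.
move=> d [_ /= nd]; apply/eqP; rewrite scaler_eq0; apply/norP => -[/hK[k dE]].
move=> /hA; rewrite ffunE ffunE => h; apply: nd; exists k => //.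
have dw : e w - c = d w by rewrite -h opprB addrC subrK.
by rewrite /dk dw.
Qed.

(** A coefficient of the product of a delta function with the two-variable series
    of coefficients B: one exponent increases as the other decreases. *)
Definition strip (W : lmodType C) (c : nat -> C) (B : rat -> rat -> W)
    (p q : rat) : W :=
  nsum c (fun k => B (p + k%:R) (q - k%:R)).

Lemma eq_strip (W : lmodType C) (c : nat -> C) (B B' : rat -> rat -> W) p q :
  (forall a b, B a b = B' a b) -> strip c B p q = strip c B' p q.
Proof.
by move=> h; have -> : B = B' by apply/funext => a; apply/funext => b.
Qed.

Lemma eq_strip_coef (W : lmodType C) (c c' : nat -> C) (B : rat -> rat -> W) p q :
  (forall k, c k = c' k) -> strip c B p q = strip c' B p q.
Proof. by move=> /funext ->. Qed.

Lemma smul_series2 (W : lmodType C) w x y (K : series C^o)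
    (B : rat -> rat -> W) (e : expo) :
    triple w x y ->
    (forall d, K d != 0 ->
       exists k : nat, d = ex3 w x y (d w) (-1 - d w - k%:R) k%:R) ->
  smul K (series2 x y B) e =
  strip (fun k => K (ex3 w x y (e w) (-1 - e w - k%:R) k%:R)) B
    (e x + 1 + e w) (e y).
Proof.
move=> tr hK; rewrite (smul_nsum (c := 0) e tr hK); last first.
  move=> d; rewrite /series2; case: (d =P _) => [dE _|_]; last by rewrite eqxx.
  by rewrite dE ffunE !xpow_eval ?(triple_neq tr) addr0.
rewrite subr0; congr nsum; apply/funext => k; rewrite /series2 ifT.
  rewrite !ffunE ?(triple_neq tr) !eqxx; congr B.
  by ring.
apply/eqP/(expo_ext tr); rewrite !ffunE ?(triple_neq tr) ?eqxx ?addr0 ?add0r//.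
by rewrite subrr.
Qed.

Lemma series2C (W : lmodType C) x y (B : rat -> rat -> W) :
  series2 x y B = series2 y x (fun b a => B a b).
Proof. by apply/funext => e; rewrite /series2 addrC. Qed.

End Exponents.

(** * The Jacobi identity as a sum over natural numbers *)

Section Jacobi.
Context (R : realType).
Local Notation C := R[i].

(** The coefficients of z0^-1 delta ((z1 - z2) / z0), with p the exponent of z0. *)
Definition jcoef12 (p : rat) (k : nat) : C :=
  delta_z0_12 R (ex3 z0 z1 z2 p (-1 - p - k%:R) k%:R).

Definition jcoef21 (p : rat) (k : nat) : C :=
  delta_z0_21 R (ex3 z0 z2 z1 p (-1 - p - k%:R) k%:R).

(** The coefficients of z2^-1 delta ((z1 - z0) / z2) ((z1 - z0) / z2)^b, with q the
    exponent of z1. The twist b only decides which exponents q occur. *)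
Definition jcoef_iter (b q : rat) (k : nat) : C :=
  if q - b \is a Num.int then gbinom (ratr (- q - 1)) k else 0.

Lemma jacobi12 (W : lmodType C) (B : rat -> rat -> W) (e : expo) :
  smul (delta_z0_12 R) (series2 z1 z2 B) e =
  strip (jcoef12 (e z0)) B (e z1 + 1 + e z0) (e z2).
Proof.
rewrite (smul_series2 (w := z0))// => d.
exact: (@dkernel_supp R z0 z1 z2).
Qed.

Lemma jacobi21 (W : lmodType C) (B : rat -> rat -> W) (e : expo) :
  smul (delta_z0_21 R) (series2 z1 z2 B) e =
  strip (jcoef21 (e z0)) (fun b a => B a b) (e z2 + 1 + e z0) (e z1).
Proof.
rewrite series2C (smul_series2 (w := z0))// => d.
exact: (@dkernel_supp R z0 z2 z1).
Qed.

(** For p = -1 the delta function contributes (z1 - z2)^0 = 1. So the coefficients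
    of z0^-1 in a Jacobi identity form a commutator formula. *)
Lemma jcoef12_m1 k : jcoef12 (-1) k = (k == 0%N)%:R.
Proof.
rewrite /jcoef12 -[delta_z0_12 R]/(dkernel z0 z1 z2 (-1) 1).
rewrite (_ : -1 = - (0 : int)%:~R - 1 :> rat); last by rewrite oppr0 add0r.
rewrite dkernel_int// oppr0 expr0z mul1r ifT; last by apply/eqP; ring.
case: k => [|k]; first by rewrite gbinom0 mulr1.
by rewrite (gbinom_nat R (ltn0Sn k)) mul0r.
Qed.

Lemma jcoef21_m1 k : jcoef21 (-1) k = (k == 0%N)%:R.
Proof.
rewrite /jcoef21 -[delta_z0_21 R]/(dkernel z0 z2 z1 (-1) (-1)).
rewrite (_ : -1 = - (0 : int)%:~R - 1 :> rat); last by rewrite oppr0 add0r.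
rewrite dkernel_int// oppr0 expr0z mul1r ifT; last by apply/eqP; ring.
case: k => [|k]; first by rewrite gbinom0 mulr1.
by rewrite (gbinom_nat R (ltn0Sn k)) mul0r.
Qed.

(** By the reflection formula, z1^-1 delta ((z2 + z0) / z1) has the same
    coefficients as z2^-1 delta ((z1 - z0) / z2), which is [jacobi_z2_10]. *)
Lemma jacobi_z1_20 (W : lmodType C) (B : rat -> rat -> W) (e : expo) :
  smul (delta_z1_20 R) (series2 z0 z2 B) e =
  strip (jcoef_iter 0 (e z1)) (fun b a => B a b) (e z2 + 1 + e z1) (e z0).
Proof.
rewrite series2C (smul_series2 (w := z1))//; last first.
  by move=> d; exact: (@dkernel_supp R z1 z2 z0).
apply: eq_strip_coef => k; rewrite -[delta_z1_20 R]/(dkernel z1 z2 z0 1 1).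
rewrite /jcoef_iter subr0; case: ifPn => [/intrP[m em]|ne]; last by rewrite dkernel_nint.
have -> : e z1 = - (- m - 1)%:~R - 1.
  by rewrite intrD rmorphN /= em opprD !opprK addrK.
rewrite dkernel_int// exp1rz mul1r expr1n mulr1 ifT; last by apply/eqP; ring.
by rewrite opprD !opprK addrK ratr_int.
Qed.

(** Both factors are expanded in z0, so that their product is computed by
    Vandermonde's identity and behaves as a power of z1 - z0 with rational
    exponent. *)
Definition twisted_dkernel (b : rat) : series C^o :=
  smul (delta_z2_10 R) (Defs.ratio z1 (-1) z0 z2 b).

Lemma twisted_dkernelE b (e : expo) : twisted_dkernel b e =
  nsum (fun k => dkernel z2 z1 z0 (-1) 1
          (ex3 z2 z1 z0 (e z2 + b) (-1 - (e z2 + b) - k%:R) k%:R))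
       (fun k => Defs.ratio z1 (-1) z0 z2 b
          (e - ex3 z2 z1 z0 (e z2 + b) (-1 - (e z2 + b) - k%:R) k%:R) : C^o).
Proof.
rewrite /twisted_dkernel -[delta_z2_10 R]/(dkernel z2 z1 z0 (-1) 1).
rewrite (smul_nsum (w := z2) (x := z1) (y := z0) (c := - b) e)// ?opprK//.
  by move=> d; exact: (@dkernel_supp R z2 z1 z0).
by move=> d /(@ratio_supp R z2 z1 z0)[]// k ->; rewrite !ffunE.
Qed.

Lemma twisted_dkernel_supp b (e : expo) : twisted_dkernel b e != 0 ->
  exists k : nat, e = ex3 z2 z1 z0 (e z2) (-1 - e z2 - k%:R) k%:R.
Proof.
apply: contra_neqP => h; rewrite twisted_dkernelE /nsum fsbig1// => i _.
apply/eqP; rewrite scaler_eq0; apply/orP; right; apply/negPn/negP.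
move=> /(@ratio_supp R z2 z1 z0)[]// k ek; apply: h; exists (i + k)%N.
have h0 := congr1 (fun d : expo => d z0) ek.
have h1 := congr1 (fun d : expo => d z1) ek.
move: h0 h1; rewrite !ffunE /= => h0 h1.
apply: (@expo_ext z2 z1 z0) => //; rewrite !ffunE//=.
  by rewrite natrD -[LHS](subrK (-1 - (e z2 + b) - i%:R)) h1; ring.
by rewrite natrD -[LHS](subrK i%:R) h0 addrC.
Qed.

Lemma twisted_dkernel_ex3 b q (k : nat) :
  twisted_dkernel b (ex3 z2 z1 z0 (-1 - q - k%:R) q k%:R) = jcoef_iter b q k.
Proof.
rewrite twisted_dkernelE.
have ev : (ex3 z2 z1 z0 (-1 - q - k%:R) q k%:R z2 = -1 - q - k%:R)%R.
  by rewrite ffunE.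
rewrite ev.
have intE : (-1 - q - k%:R + b \is a Num.int) = (q - b \is a Num.int).
  rewrite (_ : _ + b = - (q - b + (1 + k%:R))); last by ring.
  by rewrite rpredN rpredDr// rpredD ?rpred1 ?rpred_nat.
rewrite /jcoef_iter; case: ifPn => [qb|qb]; last first.
  rewrite /nsum fsbig1// => i _; rewrite dkernel_nint ?scale0r//.
  by rewrite intE.
have /intrP[m qbm] : q - b \is a Num.int by [].
rewrite /nsum (fsum_trunc (N := k.+1)); last first.
  move=> i ki; apply/eqP; rewrite scaler_eq0; apply/orP; right.
  apply/negPn/negP => /(@ratio_supp R z2 z1 z0)[]// j.
  move=> /(congr1 (fun d : expo => d z0)); rewrite !ffunE /= => h.
  have /eqP : (k = i + j)%N by apply/eqP; rewrite -(eqr_nat rat) natrD -h addrC subrK.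
  by rewrite ltn_eqF// ltn_addr.
have -> : ratr (- q - 1) = k%:R - 1 - ((m + k%:Z)%:~R + ratr b) :> C.
  have -> : q = m%:~R + b by rewrite -qbm subrK.
  rewrite intrD -pmulrn rmorphB rmorphN rmorphD /= rmorph1. rewrite ratr_int; ring.
rewrite -gbinom_reflect gbinomD mulr_suml; apply: eq_bigr => i _.
have ik : (i <= k)%N by rewrite -ltnS.
have -> : -1 - q - k%:R + b = - (m + k%:Z)%:~R - 1.
  by rewrite intrD -pmulrn -qbm; ring.
rewrite dkernel_int// ifT; last first.
  by apply/eqP; ring.
rewrite exp1rz mul1r.
have -> : ex3 z2 z1 z0 (-1 - q - k%:R) q k%:R -
    ex3 z2 z1 z0 (- (m + k%:Z)%:~R - 1)
      (-1 - (- (m + k%:Z)%:~R - 1) - i%:R) i%:R =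
    ex3 z2 z1 z0 (- b) (b - (k - i)%:R) (k - i)%:R.
  apply: (@expo_ext z2 z1 z0) => //; rewrite !ffunE /= ?natrB// intrD -pmulrn -?qbm; ring.
rewrite ratio_ex3// eqxx subrK eqxx /=.
rewrite -[_ *: _]/(_ * _) mulrACA -exprD subnKC//; ring.
Qed.

Lemma jacobi_twist (W : lmodType C) b (B : rat -> rat -> W) (e : expo) :
  smul (smul (delta_z2_10 R) (Defs.ratio z1 (-1) z0 z2 b)) (series2 z0 z2 B) e =
  strip (jcoef_iter b (e z1)) (fun b a => B a b) (e z2 + 1 + e z1) (e z0).
Proof.
rewrite series2C (smul_series2 (w := z1))//; last first.
  move=> d /twisted_dkernel_supp[k ->]; exists k.
  apply: (@expo_ext z1 z2 z0) => //; rewrite !ffunE//=; ring.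
apply: eq_strip_coef => k; rewrite -twisted_dkernel_ex3 /twisted_dkernel.
congr (smul _ _ _); apply: (@expo_ext z1 z2 z0) => //; by rewrite !ffunE.
Qed.

(** The untwisted identity is the case b = 0, as ((z1 - z0) / z2)^0 = 1. *)
Lemma jacobi_z2_10 (W : lmodType C) (B : rat -> rat -> W) (e : expo) :
  smul (delta_z2_10 R) (series2 z0 z2 B) e =
  strip (jcoef_iter 0 (e z1)) (fun b a => B a b) (e z2 + 1 + e z1) (e z0).
Proof.
rewrite -jacobi_twist.
suff one : smul (delta_z2_10 R) (Defs.ratio z1 (-1) z0 z2 0) = delta_z2_10 R.
  by rewrite one.
apply/funext => d.
rewrite /smul (fsum_single (i := d)) ?subrr.
  rewrite ratioE -(_ : ex3 z2 z1 z0 0 0 0%:R = 0 + xpow z2 0).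
    by rewrite binpow_ex3// addr0 eqxx /= gbinom0 mulr1; exact: mulr1.
  by apply: (@expo_ext z2 z1 z0) => //; rewrite !ffunE.
move=> d' /negP dd; apply/eqP; rewrite scaler_eq0; apply/orP; right.
have [//|] := eqVneq (Defs.ratio z1 (-1) z0 z2 0 (d - d') : C) 0.
move=> /[dup] /(@ratio_supp R z2 z1 z0)[]// k ek; rewrite ek ratio_ex3//.
case: k => [|k] in ek *; last first.
  by rewrite rmorph0 (gbinom_nat R (ltn0Sn k)) mul0r if_same eqxx.
move=> _; exfalso; apply: dd; rewrite -[d'](subKr d) ek; apply/eqP.
by apply/ffunP => v; rewrite !ffunE oppr0 subr0 !if_same subr0.
Qed.


(** The two ways in which all but finitely many terms of [strip c B p q] can
    vanish: exponents bounded above in the first variable, as for coactions, or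
    bounded below in the second one, as for modes. *)
Definition strip_finite (W : lmodType C) (B : rat -> rat -> W) : Prop :=
  (exists c, forall a b, c < a -> B a b = 0) \/
  (exists c, forall a b, b < c -> B a b = 0).

Lemma natr_gt (x : rat) : exists N : nat, forall k, (N <= k)%N -> x < k%:R.
Proof.
exists (Num.bound `|x|) => k Nk.
rewrite (le_lt_trans (ler_norm _))//.
by rewrite (lt_le_trans (archi_boundP (normr_ge0 x)))// ler_nat.
Qed.

Lemma strip_finiteP (W : lmodType C) (B : rat -> rat -> W) p q : strip_finite B ->
  exists N : nat, forall k, (N <= k)%N -> B (p + k%:R) (q - k%:R) = 0.
Proof.
case=> -[c h].
  have [N hN] := natr_gt (c - p); exists N => k /hN ck; apply: h.
  by rewrite -ltrBlDl.
have [N hN] := natr_gt (q - c); exists N => k /hN ck; apply: h.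
by rewrite ltrBlDl -ltrBlDr.
Qed.

Lemma strip_lin (W W' : lmodType C) (phi : W -> W') c
    (B : rat -> rat -> W) p q : linear phi -> strip_finite B ->
  phi (strip c B p q) = strip c (fun a b => phi (B a b)) p q.
Proof.
move=> lphi /(strip_finiteP p q)[N hN].
rewrite /strip /nsum !(fsum_trunc (N := N)).
- by rewrite linear_sum_bare//; apply: eq_bigr => k _; rewrite linearZ_bare.
- by move=> k /hN ->; rewrite linear0_bare// scaler0.
- by move=> k /hN ->; rewrite scaler0.
Qed.

Lemma strip_sum (W : lmodType C) n c (B : 'I_n -> rat -> rat -> W) p q :
  (forall r, strip_finite (B r)) ->
  \sum_(r < n) strip c (B r) p q = strip c (fun a b => \sum_(r < n) B r a b) p q.
Proof.
move=> ok; have [N hN] : exists N : nat, forall r k, (N <= k)%N ->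
    B r (p + k%:R) (q - k%:R) = 0.
  pose N r := projT1 (cid (strip_finiteP p q (ok r))).
  exists (\max_r N r)%N => r k rk.
  by apply: (projT2 (cid (strip_finiteP p q (ok r)))); rewrite (leq_trans _ rk)// leq_bigmax.
rewrite /strip /nsum (fsum_trunc (N := N)); last first.
  by move=> k kN; rewrite big1 ?scaler0// => r _; apply: hN.
transitivity (\sum_(r < n) \sum_(k < N) c k *: B r (p + k%:R) (q - k%:R)).
  by apply: eq_bigr => r _; rewrite (fsum_trunc (N := N))// => k /hN ->; rewrite scaler0.
by rewrite exchange_big /=; apply: eq_bigr => k _; rewrite scaler_sumr.
Qed.

Lemma strip_delta (W : lmodType C) (B : rat -> rat -> W) p q c :
  (forall k, c k = (k == 0%N)%:R) -> strip c B p q = B p q.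
Proof.
move=> h; rewrite /strip /nsum (fsum_single (i := 0%N)).
  by rewrite h scale1r addr0 subr0.
by move=> k /negPf k0; rewrite h k0 scale0r.
Qed.

Lemma strip0 (W : lmodType C) (B : rat -> rat -> W) p q c :
  (forall k : nat, B (p + k%:R) (q - k%:R) = 0) -> strip c B p q = 0.
Proof. by move=> h; rewrite /strip /nsum fsbig1// => k _; rewrite h scaler0. Qed.

(** Enough terms for the bracket of two Virasoro modes, where omega_i omega = 0 for
    i > 3. *)
Lemma strip_four (W : lmodType C) (B : rat -> rat -> W) p q c :
  (forall k : nat, (3 < k)%N -> c k *: B (p + k%:R) (q - k%:R) = 0) ->
  strip c B p q = c 0%N *: B p q + c 1%N *: B (p + 1) (q - 1) +
    c 2%N *: B (p + 2) (q - 2) + c 3%N *: B (p + 3) (q - 3).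
Proof.
move=> h; rewrite /strip /nsum (fsum_trunc h) !big_ord_recr /= big_ord0 (add0r (_ : W)).
by rewrite /= addr0 subr0.
Qed.

Lemma strip_two (W : lmodType C) (B : rat -> rat -> W) p q c :
  (forall k : nat, (1 < k)%N -> c k *: B (p + k%:R) (q - k%:R) = 0) ->
  strip c B p q = c 0%N *: B p q + c 1%N *: B (p + 1) (q - 1).
Proof.
move=> h; rewrite /strip /nsum (fsum_trunc h) !big_ord_recr /= big_ord0 (add0r (_ : W)).
by rewrite /= addr0 subr0.
Qed.

End Jacobi.

(** * Roots of unity and eigenprojections *)

Section RootsOfUnity.
Context (R : realType).
Local Notation C := R[i].

Lemma zeta0 T : zeta R T 0 = 1.
Proof. by rewrite /zeta mulr0 mul0r cos0 sin0. Qed.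

Lemma zetaD T r s : zeta R T (r + s) = zeta R T r * zeta R T s.
Proof.
rewrite /zeta natrD mulrDr mulrDl cosD sinD.
apply/eqP; rewrite eq_complex /=; apply/andP; split=> //.
by apply/eqP; rewrite addrC.
Qed.

(** The numbers e^(2 pi i r / T) are the powers of the one for r = 1, so that
    orthogonality reduces to geometric sums. *)
Lemma zetaE T r : zeta R T r = zeta R T 1 ^+ r.
Proof.
elim: r => [|r IH]; first by rewrite zeta0.
by rewrite -addn1 zetaD IH exprD.
Qed.

Lemma zetaT T : (0 < T)%N -> zeta R T T = 1.
Proof.
move=> T0; rewrite /zeta mulfK ?pnatr_eq0 -?lt0n// mulr_natl.
by rewrite cos2pi sin2pi.
Qed.

(** Through cos (2 y) = 1 - 2 sin^2 y, since 0 < y = pi r / T < pi has a nonzero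
    sine. *)
Lemma zeta_neq1 T r : (0 < r < T)%N -> zeta R T r != 1.
Proof.
case/andP=> r0 rT; have T0 : (0 < T)%N by exact: leq_ltn_trans rT.
have T0' : 0 < T%:R :> R by rewrite ltr0n.
apply/negP; rewrite /zeta eq_complex /= => /andP[/eqP + _].
pose y : R := pi * r%:R / T%:R.
have -> : 2 * pi * r%:R / T%:R = y *+ 2 by rewrite -mulr_natl /y; ring.
have : 0 < sin y.
  apply: sin_gt0_pi; rewrite divr_gt0 ?mulr_gt0 ?pi_gt0 ?ltr0n//=.
  by rewrite ltr_pdivrMr// ltr_pM2l ?pi_gt0// ltr_nat.
rewrite cos_mulr2n => s0 h.
have := cos2Dsin2 y; have : 0 < sin y ^+ 2 by rewrite exprn_gt0.
by move: h; set c := cos y ^+ 2; set s := sin y ^+ 2; lra.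
Qed.

Lemma geom_zero (x : C) T : x ^+ T = 1 -> x != 1 -> \sum_(i < T) x ^+ i = 0.
Proof.
move=> xT x1; apply/eqP; have := subrX1 x T; rewrite xT subrr => /esym/eqP.
by rewrite mulf_eq0 subr_eq0 (negPf x1).
Qed.

Lemma zeta_unit T r : (0 < T)%N -> zeta R T r != 0.
Proof.
move=> T0; rewrite zetaE; apply: expf_neq0; apply/eqP => z0.
have := zetaT T0; rewrite zetaE z0 expr0n eqn0Ngt T0 => /esym/eqP.
by rewrite oner_eq0.
Qed.

Lemma zetaVX T r j : zeta R T r ^- j = (zeta R T j)^-1 ^+ r.
Proof. by rewrite zetaE (zetaE T j) -exprM mulnC exprM exprVn. Qed.

Lemma zeta_expT T r : (0 < T)%N -> zeta R T r ^+ T = 1.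
Proof. by move=> T0; rewrite zetaE -exprM mulnC exprM -zetaE zetaT// expr1n. Qed.

Lemma zeta_ratio_neq1 T r s : (r < T)%N -> (s < T)%N -> r != s ->
  zeta R T r / zeta R T s != 1.
Proof.
wlog sr : r s / (s < r)%N.
  move=> h rT sT rs; move: (rs); rewrite neq_ltn => /orP[] lt; last exact: h.
  by rewrite -invr_eq1 invf_div; apply: h => //; rewrite eq_sym.
move=> rT sT _; have T0 : (0 < T)%N by exact: leq_ltn_trans rT.
rewrite -(subnK (ltnW sr)) zetaD mulfK ?zeta_unit//.
by apply: zeta_neq1; rewrite subn_gt0 sr (leq_ltn_trans (leq_subr _ _)).
Qed.

End RootsOfUnity.

Section Eigenprojections.
Context (R : realType).
Local Notation C := R[i].
Context (V : lmodType C) (g : V -> V) (lg : linear g) (T : nat) (T0 : (0 < T)%N)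
  (gT : forall v, iter T g v = v).

Let TC : T%:R != 0 :> C. Proof. by rewrite pnatr_eq0 -lt0n. Qed.

Lemma iter_linear (W : lmodType C) (f : W -> W) j : linear f -> linear (iter j f).
Proof. by move=> lf; elim: j => // j IH a x y /=; rewrite IH lf. Qed.

Lemma eigproj_linear r : linear (eigproj g T r).
Proof.
move=> a x y; rewrite /eigproj scalerA mulrC -scalerA -scalerDr.
congr (_ *: _); rewrite scaler_sumr -big_split /=; apply: eq_bigr => j _.
by rewrite (iter_linear j lg) scalerDr !scalerA mulrC.
Qed.

(** Applying g shifts the terms of the sum cyclically. *)
Lemma eigproj_eigen r v : eigen g T r (eigproj g T r v).
Proof.
rewrite /eigen /= /eigproj linearZ_bare// scalerA mulrC -scalerA.
congr (_ *: _); rewrite linear_sum_bare// scaler_sumr.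
have z0 := zeta_unit R r T0.
case: T T0 gT z0 => // S _ gS z0.
rewrite big_ord_recr [RHS]big_ord_recl /= addrC; congr (_ + _).
  rewrite linearZ_bare// -[g (iter S g v)]/(iter S.+1 g v) gS scalerA expr0 invr1.
  by rewrite mulr1 -[_ ^- S]mul1r -{1}(zeta_expT R r (ltn0Sn S)) exprS mulfK ?expf_neq0.
apply: eq_bigr => j _; rewrite linearZ_bare// scalerA; congr (_ *: _).
by rewrite /bump /= add1n exprS invfM mulVKf.
Qed.

(** Exchanging the sums leaves, for each power g^j, a geometric sum of T-th roots of
    unity, which vanishes unless j = 0. *)
Lemma eigproj_sum v : \sum_(r < T) eigproj g T r v = v.
Proof.
rewrite -scaler_sumr exchange_big /=.
have E (j : 'I_T) : \sum_(r < T) zeta R T r ^- j *: iter j g v =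
    (j == 0%N :> nat)%:R *: (T%:R *: v).
  rewrite -scaler_suml; case: eqVneq => [->|j0].
    rewrite scale1r; congr (_ *: _).
    by under eq_bigr do rewrite expr0 invr1; rewrite sumr_const card_ord.
  have zj : zeta R T j != 1 by apply: zeta_neq1; rewrite lt0n j0 ltn_ord.
  under eq_bigr do rewrite zetaVX.
  rewrite geom_zero ?scale0r//; last by rewrite invr_eq1.
  by rewrite exprVn zeta_expT// invr1.
rewrite (eq_bigr _ (fun j _ => E j)) (bigD1 (Ordinal T0))//= scale1r big1.
  by rewrite addr0 scalerA mulVf// scale1r.
by move=> j; rewrite -val_eqE /= => /negPf ->; rewrite scale0r.
Qed.

Lemma iter_eigen r v j : eigen g T r v -> iter j g v = zeta R T r ^+ j *: v.
Proof.
move=> ev; elim: j => [|j IH] /=; first by rewrite scale1r.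
by rewrite IH linearZ_bare// ev scalerA exprSr.
Qed.

(** On an eigenvector, the sum is geometric in the quotient of two T-th roots of
    unity, hence 0 unless they are equal. *)
Lemma eigproj_id r s v : (r < T)%N -> (s < T)%N -> eigen g T s v ->
  eigproj g T r v = if r == s then v else 0.
Proof.
move=> rT sT ev; rewrite /eigproj.
under eq_bigr do rewrite (iter_eigen _ ev) scalerA.
rewrite -scaler_suml; case: eqVneq => [->|rs].
  under eq_bigr do rewrite mulVf ?expf_neq0 ?zeta_unit//.
  by rewrite sumr_const card_ord scalerA mulVf ?scale1r.
under eq_bigr do rewrite mulrC -exprVn -exprMn.
rewrite geom_zero ?scale0r ?scaler0//.
  by rewrite exprMn exprVn !zeta_expT// invr1 mulr1.
by apply: zeta_ratio_neq1; rewrite // eq_sym.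
Qed.

End Eigenprojections.

(** * Graded duals and dual bases *)

Section Gradings.
Context (F : fieldType) (I : choiceType) (V : lmodType F) (gr : grading I V).

Lemma gproj_same s v : gproj gr s (gproj gr s v) = gproj gr s v.
Proof. by rewrite gproj_orth eqxx. Qed.

Lemma gproj_homog s t v : homog gr s v -> gproj gr t v = if t == s then v else 0.
Proof. by move=> <-; rewrite gproj_orth. Qed.

Lemma gproj_cover v : exists X : {fset I}, forall s, s \notin X -> gproj gr s v = 0.
Proof.
have /finite_fsetP[X hX] := gproj_fin gr v; exists X => s sX.
have : ~ [set` X] s by apply/negP.
by rewrite -hX /= => /negP/negPn/eqP.
Qed.

Lemma gproj_sum_fset v (X : {fset I}) : (forall s, s \notin X -> gproj gr s v = 0) ->
  v = \sum_(s <- X) gproj gr s v.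
Proof. by move=> h; rewrite -{1}(gproj_sum gr v) (fsbigTE X). Qed.

Lemma gproj_ext v w : (forall s, gproj gr s v = gproj gr s w) -> v = w.
Proof. by move=> h; rewrite -(gproj_sum gr v) -(gproj_sum gr w); apply: eq_fsbigr. Qed.

Lemma homogP s v : (forall t, t != s -> gproj gr t v = 0) -> homog gr s v.
Proof.
move=> h; apply: gproj_ext => t; rewrite gproj_orth; case: eqVneq => [->//|ts].
by rewrite h.
Qed.

Lemma homogZ s a v : homog gr s v -> homog gr s (a *: v).
Proof. by rewrite /homog /= => hv; rewrite linearZ /= hv. Qed.

Lemma homog_sum s (J : Type) (r : seq J) (P : pred J) (G : J -> V) :
  (forall j, P j -> homog gr s (G j)) -> homog gr s (\sum_(j <- r | P j) G j).
Proof.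
by move=> h; rewrite /homog /= linear_sum; apply: eq_bigr => j /h.
Qed.

Lemma homog_ext (W : lmodType F) (f g : V -> W) : linear f -> linear g ->
  (forall s v, homog gr s v -> f v = g v) -> f =1 g.
Proof.
move=> lf lg h v; have [X hX] := gproj_cover v.
rewrite (gproj_sum_fset hX) !linear_sum_bare//; apply: eq_bigr => s _.
by apply: (h s); exact: gproj_same.
Qed.

Lemma eval_scalar u : scalar (fun f : gdual gr => f u).
Proof. by []. Qed.

Lemma gdual0 (f : gdual gr) : f 0 = 0.
Proof. exact: linear0_bare (gdual_linear f). Qed.

Lemma gdual_sum (f : gdual gr) (J : Type) (r : seq J) (P : pred J) (E : J -> V) :
  f (\sum_(j <- r | P j) E j) = \sum_(j <- r | P j) f (E j).
Proof. exact: linear_sum_bare (gdual_linear f) _ _ _ _. Qed.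

Lemma gdualZ (f : gdual gr) a v : f (a *: v) = a * f v.
Proof. exact: linearZ_bare (gdual_linear f) _ _. Qed.

Lemma sum_gdual (J : Type) (r : seq J) (P : pred J) (E : J -> gdual gr) v :
  (\sum_(j <- r | P j) E j) v = \sum_(j <- r | P j) E j v.
Proof.
exact: (linear_sum_bare (W := F^o) (f := fun f : gdual gr => f v)
  (eval_scalar v)).
Qed.

Lemma gdual_subE (f g : gdual gr) v : (f - g) v = f v - g v.
Proof. by []. Qed.

Lemma gdual_addE (f g : gdual gr) v : (f + g) v = f v + g v.
Proof. by []. Qed.

Lemma gdual_scaleE a (f : gdual gr) v : (a *: f) v = a * f v.
Proof. by []. Qed.

Lemma gdual_homogP s (f : gdual gr) :
  homog (gdual_grading gr) s f <-> forall v, f (gproj gr s v) = f v.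
Proof.
split=> [h v|h]; last exact: gdual_ext.
by rewrite -[in RHS]h.
Qed.

Lemma gdual_homog_eval s t (f : gdual gr) v :
  homog (gdual_grading gr) s f -> homog gr t v -> f v != 0 -> s = t.
Proof.
move=> /gdual_homogP hf hv; rewrite -hf (gproj_homog _ hv).
by case: (eqVneq s t) => // _; rewrite gdual0 eqxx.
Qed.

Lemma gdual_cover (f : gdual gr) :
  exists X : {fset I}, forall s, s \notin X -> forall v, f (gproj gr s v) = 0.
Proof.
have /finite_fsetP[X hX] := gdual_fin f; exists X => s sX v.
have : ~ [set` X] s by apply/negP.
rewrite -hX /= => h; apply/eqP/negPn/negP => n0; apply: h; by exists v.
Qed.

Lemma gdual_predP (f : V -> F) : scalar f ->
  (exists X : {fset I}, forall s, s \notin X -> forall v, f (gproj gr s v) = 0) ->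
  (f : V -> F^o) \in gdual_pred gr.
Proof.
move=> lf [X hX]; apply/asboolP; split=> //.
apply: (@sub_finite_set _ _ [set` X]); last exact: finite_fset.
move=> s /= [v]; apply: contraNT => /hX ->; exact: eqxx.
Qed.

Section DualBasis.
Context (s : I).

(** A spanning family of minimal length is free: a relation with a nonzero
    coefficient a_j would allow the j-th vector to be dropped. *)
Lemma free_spanning : finite_dim (homog gr s) -> exists (n : nat) (b : 'I_n -> V),
  [/\ forall i, homog gr s (b i),
      forall v, homog gr s v -> exists a : 'I_n -> F, v = \sum_i a i *: b i &
      forall a : 'I_n -> F, \sum_i a i *: b i = 0 -> forall i, a i = 0].
Proof.
pose P n := `[< exists b : 'I_n -> V, forall v, homog gr s v ->
  exists a : 'I_n -> F, v = \sum_i a i *: b i >].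
move=> [n0 [b0 h0]]; have exP : exists n, P n by exists n0; apply/asboolP; exists b0.
case: (ex_minnP exP) => n /asboolP[b hb] nmin.
exists n, (fun i => gproj gr s (b i)); have sp v : homog gr s v ->
    exists a : 'I_n -> F, v = \sum_i a i *: gproj gr s (b i).
  move=> hv; have [a va] := hb v hv; exists a.
  rewrite -{1}hv {1}va linear_sum; apply: eq_bigr => i _; exact: linearZ.
split=> // [i|a a0 j]; first exact: gproj_same.
apply/eqP/negPn/negP => aj; case: n => [|n] in b hb nmin sp a a0 j aj *.
  by case: j aj.
have : (n.+1 <= n)%N; last by rewrite ltnn.
apply: nmin; apply/asboolP; exists (fun i => gproj gr s (b (lift j i))) => v hv.
have [c vc] := sp v hv.
exists (fun i => c (lift j i) - c j / a j * a (lift j i)).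
have : v = \sum_i (c i - c j / a j * a i) *: gproj gr s (b i).
  transitivity (\sum_i (c i *: gproj gr s (b i) +
     (- (c j / a j)) *: (a i *: gproj gr s (b i)))).
    by rewrite big_split /= -scaler_sumr a0 scaler0 addr0.
  by apply: eq_bigr => i _; rewrite scalerBl scalerA mulNr scaleNr.
by rewrite (bigD1_ord j)//= divfK// subrr scale0r add0r.
Qed.

(** A basis of V_s with the coordinate functionals, extended by 0 to the other
    degrees. It is recorded as the decomposition of the projection onto V_s that
    it provides, which is the only form in which it is used. *)
Lemma dual_basis : finite_dim (homog gr s) -> exists b : seq (V * gdual gr),
  (forall p, p \in b -> homog gr s p.1 /\ homog (gdual_grading gr) s p.2) /\
  (forall v, gproj gr s v = \sum_(p <- b) p.2 v *: p.1).
Proof.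
move=> /free_spanning[n [b [hb sp free]]].
have ex v : exists a : 'I_n -> F, gproj gr s v = \sum_i a i *: b i.
  by apply: sp; exact: gproj_same.
pose co v := projT1 (cid (ex v)).
have coE v : gproj gr s v = \sum_i co v i *: b i by exact: projT2 (cid (ex v)).
have uniq_co (a a' : 'I_n -> F) :
    \sum_i a i *: b i = \sum_i a' i *: b i -> a =1 a'.
  move=> aa i; apply/eqP; rewrite -subr_eq0; apply/eqP.
  apply: (free (fun i => a i - a' i)).
  under eq_bigr do rewrite scalerBl.
  by rewrite sumrB aa subrr.
have phiP i : ((fun v => co v i) : V -> F^o) \in gdual_pred gr.
  apply: gdual_predP => [a x y|].
    apply: (uniq_co (co (a *: x + y)) (fun i => a * co x i + co y i)).
    rewrite -coE linearP !coE scaler_sumr -big_split /=.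
    by apply: eq_bigr => k _; rewrite scalerDl scalerA.
  exists [fset s]%fset => t; rewrite inE => ts v.
  apply: (uniq_co (co (gproj gr t v)) (fun=> 0)).
  rewrite -coE gproj_orth eq_sym (negPf ts) big1// => k _; exact: scale0r.
exists [seq (b i, GDual (phiP i)) | i <- enum 'I_n]; split.
  move=> p /mapP[i _ ->] /=; split; first exact: hb.
  apply/gdual_homogP => v /=.
  by apply: (uniq_co (co (gproj gr s v)) (co v)); rewrite -!coE gproj_same.
by move=> v; rewrite coE big_map big_enum.
Qed.

End DualBasis.

(** The dual basis spans V_s^*, since f = sum_i f(b_i) phi_i. *)
Lemma gdual_finite_dim s :
  finite_dim (homog gr s) -> finite_dim (homog (gdual_grading gr) s).
Proof.
move=> /dual_basis[b [hb bE]].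
exists (size b), (fun i => (tnth (in_tuple b) i).2) => f /gdual_homogP hf.
exists (fun i => f (tnth (in_tuple b) i).1); apply: gdual_ext => v.
rewrite -hf bE gdual_sum sum_gdual (big_tnth _ _ b) /=.
by apply: eq_bigr => i _; rewrite gdualZ; exact: mulrC.
Qed.

Lemma gdual_homog_triv s :
  homog gr s = [set 0] -> homog (gdual_grading gr) s = [set 0].
Proof.
move=> h; apply/seteqP; split=> [f /gdual_homogP hf|f -> /=]; last exact: linear0.
apply: gdual_ext => v; rewrite -hf.
have : homog gr s (gproj gr s v) by exact: gproj_same.
by rewrite h => ->; rewrite gdual0.
Qed.

End Gradings.

Section Reconstruction.
Context (F : fieldType) (I : choiceType) (A : lmodType F) (gr : grading I A)
  (fin : forall s, finite_dim (homog gr s)).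

Definition hbasis (s : I) : seq (A * gdual gr) := projT1 (cid (dual_basis (fin s))).

Lemma hbasis_homog s p : p \in hbasis s ->
  homog gr s p.1 /\ homog (gdual_grading gr) s p.2.
Proof. exact: (projT2 (cid (dual_basis (fin s)))).1. Qed.

Lemma hbasis_sum s v : gproj gr s v = \sum_(p <- hbasis s) p.2 v *: p.1.
Proof. exact: (projT2 (cid (dual_basis (fin s)))).2. Qed.

(** The tensor is sum_s sum_i phi_(s,i) (x) B(b_(s,i)) over the dual bases of the
    finitely many degrees s on which B does not vanish. *)
Lemma tensor_of_map (W : lmodType F) (B : A -> W) : linear B ->
  (exists X : {fset I}, forall s, s \notin X -> forall v, B (gproj gr s v) = 0) ->
  exists x : gdual gr ⊗ W, forall u, tcontr_l (fun f : gdual gr => f u) x = B u.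
Proof.
move=> lB [X hX].
exists (\sum_(s <- X) \sum_(p <- hbasis s) tpure p.2 (B p.1)) => u.
have lu := @tcontr_l_lin _ _ W _ (@eval_scalar _ _ _ gr u).
rewrite linear_sum_bare//.
transitivity (\sum_(s <- X) B (gproj gr s u)).
  apply: eq_bigr => s _; rewrite linear_sum_bare// hbasis_sum linear_sum_bare//.
  apply: eq_bigr => p _; rewrite linearZ_bare//.
  by rewrite tcontr_l_pure//; exact: eval_scalar.
have [Y hY] := gproj_cover gr u.
have hXY : forall s, s \notin (X `|` Y)%fset -> gproj gr s u = 0.
  by move=> s; rewrite inE => /norP[_ /hY].
rewrite [in RHS](gproj_sum_fset hXY) linear_sum_bare//.
rewrite -(fsbigTE X); last by move=> s /hX.
rewrite -(fsbigTE (X `|` Y)%fset)// => s.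
by rewrite inE => /norP[/hX].
Qed.

(** The first factors of x involve finitely many degrees, and each is the
    combination of the dual basis given by its own values on the basis. *)
Lemma tensor_expand (W : lmodType F) (x : gdual gr ⊗ W) : exists X : {fset I},
  x = \sum_(s <- X) \sum_(p <- hbasis s)
        tpure p.2 (tcontr_l (fun f : gdual gr => f p.1) x).
Proof.
pose E (X : {fset I}) (y : gdual gr ⊗ W) := \sum_(s <- X) \sum_(p <- hbasis s)
  tpure p.2 (tcontr_l (fun f : gdual gr => f p.1) y).
have El X : linear (E X).
  move=> a y z; rewrite /E scaler_sumr -big_split /=; apply: eq_bigr => s _.
  rewrite scaler_sumr -big_split /=; apply: eq_bigr => p _.
  by rewrite tcontr_l_lin; [exact: tpure_linr | exact: eval_scalar].
have Epure (X : {fset I}) (f : gdual gr) w :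
    (forall s, s \notin X -> forall v, f (gproj gr s v) = 0) ->
    E X (tpure f w) = tpure f w.
  move=> hX; have lw := @tpure_linl _ (gdual gr) W w.
  have {2}-> : f = \sum_(s <- X) gdual_proj s f.
    rewrite -[LHS]gdual_proj_sum (fsbigTE X)// => s /hX h; exact: gdual_ext.
  rewrite /E [RHS](linear_sum_bare lw); apply: eq_bigr => s _.
  have -> : gdual_proj s f = \sum_(p <- hbasis s) (f p.1 : F) *: p.2.
    apply: gdual_ext => v /=; rewrite hbasis_sum gdual_sum sum_gdual.
    by apply: eq_bigr => p _; rewrite gdualZ; exact: mulrC.
  rewrite [RHS](linear_sum_bare lw); apply: eq_bigr => p _.
  rewrite tcontr_l_pure; last exact: eval_scalar.
  by rewrite tpureZr tpureZl.
have [X hX] : exists X : {fset I}, forall p, p \in repr x ->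
    forall s, s \notin X -> forall v, p.1 (gproj gr s v) = 0.
  elim: (repr x) => [|p l [X hX]]; first by exists fset0.
  have [Y hY] := gdual_cover p.1; exists (X `|` Y)%fset => q.
  rewrite inE => /predU1P[->|/hX h] s; rewrite inE => /norP[sX sY]; first exact: hY.
  exact: h.
exists X; rewrite -[RHS]/(E X x); apply/esym.
have : E X (sum_of (@tpure F _ W) (repr x)) = sum_of (@tpure F _ W) (repr x).
  rewrite /sum_of linear_sum_bare// !big_seq; apply: eq_bigr => p pl.
  by rewrite Epure//; exact: hX.
by rewrite -tensor_sum_pure.
Qed.

(** Tensors with first factor in a graded dual are separated by evaluation at
    vectors; in [tensor_expand] only the contractions of x occur. *)
Lemma gdual_tensor_ext (W : lmodType F) (x y : gdual gr ⊗ W) :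
  (forall u, tcontr_l (fun f : gdual gr => f u) x =
             tcontr_l (fun f : gdual gr => f u) y) -> x = y.
Proof.
move=> h; apply/eqP; rewrite -subr_eq0; apply/eqP.
have [X ->] := tensor_expand (x - y).
rewrite big1// => s _; rewrite big1// => p _.
rewrite (linearB_bare (tcontr_l_lin (@eval_scalar _ _ _ gr _))) h subrr.
exact: tpure0r.
Qed.

End Reconstruction.

(** * Vertex operator algebras and their twisted modules *)

Section Modes.
Context (R : realType).
Local Notation C := R[i].

(** The exponent -k-1 carries the index k; non-integral exponents carry nothing. *)
Lemma coser_int (V W : lmodType C) (D : int -> V -> W) (k : int) v :
  coser D (- k%:~R - 1) v = D k v.
Proof.
rewrite /coser (fsum_single (i := k)) ?eqxx// => j jk.
by rewrite (inj_eq (addIr _)) eqr_opp eqr_int eq_sym (negPf jk).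
Qed.

Lemma coser_nint (V W : lmodType C) (D : int -> V -> W) q v :
  q \isn't a Num.int -> coser D q v = 0.
Proof.
move=> qn; rewrite /coser fsbig1// => k _; case: eqP => // qk.
by move: qn; rewrite qk rpredB ?rpred1// rpredN rpred_int.
Qed.

Lemma rat_intP (q : rat) :
  (exists k : int, q = - k%:~R - 1) \/ q \isn't a Num.int.
Proof.
have [/intrP[m qm]|] := boolP (q \is a Num.int); last by right.
by left; exists (- m - 1); rewrite intrD rmorphN /= qm opprD !opprK addrK.
Qed.

Lemma coser_linear (V W : lmodType C) (D : int -> V -> W) q :
  (forall k, linear (D k)) -> linear (coser D q).
Proof.
move=> lD; case: (rat_intP q) => [[k ->]|qn] a x y.
  by rewrite !coser_int lD.
by rewrite !coser_nint// scaler0 addr0.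
Qed.

End Modes.

Section IterateCoefficient.
Context (R : realType).

Lemma jcoef_iter_int (m : int) k : jcoef_iter R 0 (- m%:~R - 1) k = gbinom m%:~R k.
Proof.
rewrite /jcoef_iter subr0 rpredB ?rpred1 ?rpredN ?rpred_int//.
by rewrite opprD !opprK addrK ratr_int.
Qed.

End IterateCoefficient.

Section VOA.
Context (R : realType).
Local Notation C := R[i].
Context (V : lmodType C) (gr : grading int V) (aV : voa gr).
Local Notation S := (voa_S aV).
Local Notation one := (voa_one aV).
Local Notation om := (voa_omega aV).
Local Notation L := (voa_L aV).

Lemma voa_S_linr u q : linear (S u q).
Proof. by apply: coser_linear => k; exact: linearP. Qed.

Lemma voa_S_linl q v : linear (fun u => S u q v).
Proof.
case: (rat_intP q) => [[k ->]|qn] a x y; rewrite /voa_S.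
  by rewrite !coser_int voa_linear.
by rewrite !coser_nint// scaler0 addr0.
Qed.

Lemma voa_S_trunc u v : exists c : rat, forall q, q < c -> S u q v = 0.
Proof.
have [k0 h] := voa_trunc aV u v; exists (- k0%:~R - 1) => q.
case: (rat_intP q) => [[k ->]|qn] lt; rewrite /voa_S.
  by rewrite coser_int h//; move: lt; rewrite ltrD2r ltrN2 ltr_int.
by rewrite coser_nint.
Qed.

Lemma voa_L_S k v : L k v = S om (- k%:~R - 2) v.
Proof.
have -> : - k%:~R - 2 = - (k + 1)%:~R - 1 :> rat by rewrite intrD; ring.
exact: (esym (coser_int (fun k => voa_Y aV om k) (k + 1) v)).
Qed.

(** The coefficient of z0^p z1^q z2^r in the Jacobi identity, known as Borcherds'
    identity in terms of modes. *)
Lemma voa_borcherds u v w p q r :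
  strip (jcoef12 R p) (fun a b => S u a (S v b w)) (q + 1 + p) r
  - strip (jcoef21 R p) (fun b a => S v b (S u a w)) (r + 1 + p) q
  = strip (jcoef_iter R 0 q) (fun b a => S (S u a v) b w) (r + 1 + q) p.
Proof.
have := voa_jacobi aV u v w (ex3 z0 z1 z2 p q r).
rewrite jacobi12 jacobi21 jacobi_z2_10.
by rewrite !(ex3_eval p q r (isT : triple z0 z1 z2)).
Qed.

(** The creation property for the vector L(-1) u, whose field is the derivative of
    that of u. *)
Lemma voa_derivation u : S u 1 one = L (-1) u.
Proof.
have [_ <-] := voa_creation aV (L (-1) u).
by rewrite voa_deriv /dz add0r rmorph1 scale1r.
Qed.

Lemma voa_commutator u v w q r :
  S u q (S v r w) - S v r (S u q w) =
  strip (jcoef_iter R 0 q) (fun b a => S (S u a v) b w) (r + 1 + q) (-1).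
Proof.
have := voa_borcherds u v w (-1) q r.
by rewrite !(strip_delta _ _ _ (jcoef12_m1 R)) !(strip_delta _ _ _ (jcoef21_m1 R)) !addrK.
Qed.

(** The commutator formula with omega_1 = L(0) has only two terms, coming from
    omega_0 v = L(-1) v and omega_1 v = L(0) v; the first is the derivative. *)
Lemma voa_comm_L0 v r w :
  L 0 (S v r w) - S v r (L 0 w) = ratr r *: S v r w + S (L 0 v) r w.
Proof.
have m2 : -2 = - (1 : int)%:~R - 1 :> rat by [].
rewrite !voa_L_S oppr0 add0r voa_commutator strip_two; last first.
  by move=> k k2; rewrite m2 jcoef_iter_int (gbinom_nat R k2) scale0r.
rewrite m2 !jcoef_iter_int gbinom0 gbinom1 !scale1r -m2.
have -> : S om (-1) v = L (-1) v by rewrite voa_L_S.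
rewrite voa_deriv /dz.
by have -> : r + 1 - 2 + 1 = r by ring.
Qed.

Lemma voa_L_linear k : linear (L k).
Proof. exact: linearP. Qed.

Lemma gproj_voa_L0 s v : gproj gr s (L 0 v) = s%:~R *: gproj gr s v.
Proof.
move: v; apply: (homog_ext (gr := gr)).
- exact: (linear_comp (voa_L_linear 0) (linearP _)).
- by move=> a x y; rewrite linearP scalerDr !scalerA mulrC.
move=> t v hv; rewrite (voa_weight aV hv) linearZ /= (gproj_homog _ hv).
by case: eqVneq => [->|_]; rewrite ?scaler0.
Qed.

(** L(0) acts on V_s as s, and V is the sum of the V_s, so that V_s is the whole
    eigenspace. *)
Lemma voa_L0_homog s v : L 0 v = s%:~R *: v -> homog gr s v.
Proof.
move=> h; apply: homogP => t /negPf ts; have := gproj_voa_L0 t v; rewrite h linearZ /=.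
move/eqP; rewrite -subr_eq0 -scalerBl scaler_eq0 subr_eq0 eqr_int eq_sym ts.
by move/eqP.
Qed.

(** Homogeneity of the modes is not an axiom: [voa_comm_L0] shows that, for u and
    v homogeneous, the vector S u q v is an eigenvector of L(0). *)
Lemma voa_S_deg a t s u v q : homog gr a u -> homog gr t v ->
  gproj gr s (S u q v) != 0 -> s%:~R = a%:~R + t%:~R + q.
Proof.
move=> hu hv; have := voa_comm_L0 u q v.
rewrite (voa_weight aV hu) (voa_weight aV hv).
rewrite (linearZ_bare (voa_S_linr u q)) (linearZ_bare (voa_S_linl q v)).
move=> /(canRL (subrK _)) h n0.
have := gproj_voa_L0 s (S u q v); rewrite h !linearD !linearZ /= -!scalerDl.
move/eqP; rewrite -subr_eq0 -scalerBl scaler_eq0 (negPf n0) orbF subr_eq0 => /eqP.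
rewrite -!(ratr_int R[i]) -!rmorphD /= => /(fmorph_inj (ratr : rat -> C)) <-.
by ring.
Qed.

Lemma voa_omega_creation : om = L (-2) one.
Proof.
by rewrite voa_L_S; have [_ {1}<-] := voa_creation aV om.
Qed.

Lemma voa_L_one k : -1 <= k -> L k one = 0.
Proof.
move=> k1; rewrite voa_L_S; apply: (voa_creation aV om).1.
by move: k1; rewrite -(ler_int rat) => k1; lra.
Qed.

(** From omega = L(-2) 1 and L(k) 1 = 0 for k >= -1, the bracket [L(k), L(-2)]
    computes all the vectors L(k) omega for k >= 0. *)
Lemma voa_L_omega k : 0 <= k ->
  L k om = (k + 2)%:~R *: L (k - 2) one
           + ((k ^+ 3 - k)%:~R / 12 * (k == 2)%:R * voa_d aV) *: one.
Proof.
move=> k0; rewrite {1}voa_omega_creation.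
have k1 : -1 <= k by exact: le_trans k0.
have := voa_virasoro aV (-2) k one.
rewrite (voa_L_one k1) (linear0_bare (voa_L_linear (-2))) subr0 opprK => ->.
by rewrite subr_eq0.
Qed.

Lemma voa_aut_omega_mode (h : voa_aut aV) q v : h (S om q v) = S om q (h v).
Proof.
case: (rat_intP q) => [[k ->]|qn]; rewrite /voa_S.
  by rewrite !coser_int voa_aut_Y voa_aut_omega.
by rewrite !coser_nint// linear0.
Qed.

(** An automorphism fixes omega, hence commutes with L(0). *)
Lemma voa_aut_homog (h : voa_aut aV) s v : homog gr s v -> homog gr s (h v).
Proof.
move=> hv; apply: voa_L0_homog.
by rewrite voa_L_S -voa_aut_omega_mode -voa_L_S (voa_weight aV hv) linearZ.
Qed.

Lemma voa_aut_L (h : voa_aut aV) k v : h (L k v) = L k (h v).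
Proof. by rewrite !voa_L_S voa_aut_omega_mode. Qed.

Lemma voa_aut_S (h : voa_aut aV) u q v : h (S u q v) = S (h u) q (h v).
Proof.
case: (rat_intP q) => [[k ->]|qn]; rewrite /voa_S.
  by rewrite !coser_int voa_aut_Y.
by rewrite !coser_nint// linear0.
Qed.

End VOA.

Section TwistedModule.
Context (R : realType).
Local Notation C := R[i].
Context (V : lmodType C) (gr : grading int V) (aV : voa gr) (h : voa_aut aV)
  (T : nat) (T0 : (0 < T)%N) (hT : forall v, iter T h v = v)
  (N : lmodType C) (mN : weak_module h T N).
Local Notation S := (voa_S aV).
Local Notation SN := (wm_S mN).
Local Notation one := (voa_one aV).
Local Notation om := (voa_omega aV).
Local Notation L := (voa_L aV).
Local Notation ep := (eigproj h T).

Lemma wm_S_linr u q : linear (SN u q).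
Proof. exact: linearP. Qed.

Lemma wm_S_linl q n : linear (fun u => SN u q n).
Proof. exact: wm_linear. Qed.

Lemma wm_S_trunc u n : exists c : rat, forall q, q < c -> SN u q n = 0.
Proof.
have [t0 ht] := wm_trunc mN u n; exists (- t0 - 1) => q lt.
by apply: ht; lra.
Qed.

Lemma wm_S_modes r u q n : (r < T)%N -> eigen h T r u ->
  q + r%:R / T%:R \isn't a Num.int -> SN u q n = 0.
Proof.
move=> rT eu qn; apply: (wm_modes mN n rT eu) => -[k qk].
have : q + r%:R / T%:R = - k%:~R - 1 by rewrite -[q]opprK -[- q](subrK 1) qk; ring.
by move=> qE; move: qn; rewrite qE rpredB ?rpred1// rpredN rpred_int.
Qed.

Lemma wm_borcherds (i : nat) u v n p q r : (i < T)%N -> eigen h T i u ->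
  strip (jcoef12 R p) (fun a b => SN u a (SN v b n)) (q + 1 + p) r
  - strip (jcoef21 R p) (fun b a => SN v b (SN u a n)) (r + 1 + p) q
  = strip (jcoef_iter R (- (i%:R / T%:R)) q) (fun b a => SN (S u a v) b n) (r + 1 + q) p.
Proof.
move=> iT eu; have := wm_jacobi mN v n (ex3 z0 z1 z2 p q r) iT eu.
rewrite jacobi12 jacobi21 jacobi_twist.
by rewrite !(ex3_eval p q r (isT : triple z0 z1 z2)).
Qed.

Lemma eigen0 u : h u = u -> eigen h T 0 u.
Proof. by rewrite /eigen /= zeta0 scale1r. Qed.

(** As omega is fixed by h, the twisting factor is trivial here. *)
Lemma wm_commutator v n q r :
  SN om q (SN v r n) - SN v r (SN om q n) =
  strip (jcoef_iter R 0 q) (fun b a => SN (S om a v) b n) (r + 1 + q) (-1).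
Proof.
have := wm_borcherds v n (-1) q r T0 (eigen0 (voa_aut_omega h)).
rewrite !(strip_delta _ _ _ (jcoef12_m1 R)) !(strip_delta _ _ _ (jcoef21_m1 R)) !addrK.
by rewrite mul0r oppr0.
Qed.

(** The derivative of Y_N is read off the Jacobi identity for the pair (u, 1), in
    the coefficient of z0 z1^q z2^-1. The left-hand side contains z2 only through
    the two expansions of (z1 - z2)^-2, as Y_N(1, z2) = Id. Neither of them has a
    power z2^-1, so it vanishes. On the
    right, u_(-2) 1 = L(-1) u and u_(-1) 1 = u are the only contributions. *)
Lemma wm_deriv_eigen (i : nat) u q n : (i < T)%N -> eigen h T i u ->
  SN (L (-1) u) q n = ratr (q + 1) *: SN u (q + 1) n.
Proof.
move=> iT eu; have [qi|qi] := boolP (q + i%:R / T%:R \is a Num.int); last first.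
  rewrite (wm_S_modes n iT _ qi); last first.
    by rewrite /eigen /= voa_aut_L eu (linearZ_bare (voa_L_linear _ _)).
  rewrite (wm_S_modes n iT eu) ?scaler0//.
  by rewrite addrAC rpredDr ?rpred1.
have := wm_borcherds one n 1 q (-1) iT eu.
rewrite strip0; last first.
  move=> k; rewrite wm_vacuum ifF ?(linear0_bare (wm_S_linr _ _))//.
  by apply/negP => /eqP; have : 0 <= k%:R :> rat by []; lra.
rewrite strip0; last first.
  move=> k; rewrite wm_vacuum ifF//.
  by apply/negP => /eqP; have : 0 <= k%:R :> rat by []; lra.
rewrite subrr strip_two; last first.
  move=> k k2; rewrite (voa_creation aV u).1 ?(linear0_bare (wm_S_linl _ _)) ?scaler0//.
  by rewrite subr_lt0 ltr1n.
rewrite subrr (voa_creation aV u).2 voa_derivation /jcoef_iter opprK qi gbinom0 gbinom1.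
rewrite !add0r scale1r => /esym/eqP; rewrite addr_eq0 => /eqP ->.
by rewrite -scaleNr -rmorphN opprD !opprK.
Qed.

(** The eigencomponents of u have different exponents but satisfy the same formula. *)
Lemma wm_deriv u q n : SN (L (-1) u) q n = ratr (q + 1) *: SN u (q + 1) n.
Proof.
have lh : linear h := linearP _.
rewrite -(eigproj_sum h T0 u) linear_sum_bare; last exact: voa_L_linear.
rewrite !(linear_sum_bare (wm_S_linl _ _)) scaler_sumr.
apply: eq_bigr => i _; apply: (wm_deriv_eigen (i := i)) => //.
exact: eigproj_eigen.
Qed.

(** The commutator formula for omega_0 = L(-1), followed by [wm_deriv]. *)
Lemma wm_comm_deriv v r n :
  SN om (-1) (SN v r n) - SN v r (SN om (-1) n) = ratr (r + 1) *: SN v (r + 1) n.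
Proof.
have cE : jcoef_iter R 0 (-1) = gbinom 0.
  apply/funext => k; rewrite (_ : -1 = - (0 : int)%:~R - 1)//.
  exact: jcoef_iter_int.
rewrite wm_commutator strip_two; last first.
  by move=> k k2; rewrite cE (gbinom_nat R (ltnW k2)) scale0r.
rewrite cE gbinom0 gbinom1 scale1r scale0r addr0 addrK.
by rewrite -wm_deriv voa_L_S.
Qed.

(** With omega_(k+1) = L(k), the commutator formula for omega with itself has four
    terms: omega_0 omega = L(-1) omega is a derivative, omega_1 omega = 2 omega,
    omega_2 omega = 0, and omega_3 omega = (d / 2) 1 gives the central term with
    coefficient binomial(k + 1, 3) / 2 = (k^3 - k) / 12. *)
Lemma wm_virasoro_modes (k j : int) n :
  SN om (- k%:~R - 2) (SN om (- j%:~R - 2) n) -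
  SN om (- j%:~R - 2) (SN om (- k%:~R - 2) n) =
  (k - j)%:~R *: SN om (- (k + j)%:~R - 2) n +
  ((k ^+ 3 - k)%:~R / 12 * (k + j == 0)%:R * voa_d aV) *: n.
Proof.
have qE : - k%:~R - 2 = - (k + 1)%:~R - 1 :> rat by rewrite intrD; ring.
have LE m : S om (-1 - m%:R) om = L (m%:Z - 1) om.
  rewrite voa_L_S; have -> // : -1 - m%:R = - (m%:Z - 1)%:~R - 2 :> rat.
    by rewrite intrD -pmulrn; ring.
rewrite wm_commutator strip_four; last first.
  move=> m m3; rewrite LE voa_L_omega; last by lia.
  rewrite voa_L_one; last by lia.
  rewrite scaler0 add0r (_ : (m%:Z - 1 == 2) = false); last by lia.
  by rewrite mulr0 mul0r scale0r (linear0_bare (wm_S_linl _ _)) scaler0.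
have E0 : S om (-1) om = L (-1) om by rewrite voa_L_S.
have E1 : S om (-1 - 1) om = 2 *: om.
  by rewrite (LE 1%N) voa_L_omega// mulr0 !mul0r scale0r addr0 -voa_omega_creation.
have E2 : S om (-1 - 2) om = 0.
  by rewrite (LE 2%N) voa_L_omega// voa_L_one// mulr0 !mul0r scale0r scaler0 addr0.
have E3 : S om (-1 - 3) om = (voa_d aV / 2) *: one.
  rewrite (LE 3%N) voa_L_omega// voa_L_one// scaler0 add0r; congr (_ *: _).
  by rewrite /= mulr1; field.
rewrite qE !jcoef_iter_int E0 E1 E2 E3 gbinom0 gbinom1 wm_deriv.
rewrite !(linearZ_bare (wm_S_linl _ _)) (linear0_bare (wm_S_linl _ _)) scaler0 addr0.
rewrite wm_vacuum scale1r !scalerA.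
have -> : - j%:~R - 2 + 1 + (- (k + 1)%:~R - 1) + 1 = - (k + j)%:~R - 2 :> rat.
  by rewrite !intrD; ring.
have -> : - j%:~R - 2 + 1 + (- (k + 1)%:~R - 1) + 3 = - (k + j)%:~R :> rat.
  by rewrite !intrD; ring.
have -> : ratr (- (k + j)%:~R - 2) = - (k + j)%:~R - 2 :> C.
  by rewrite rmorphB rmorphN /= ratr_int ratr_nat.
rewrite -scalerDl oppr_eq0 intr_eq0; congr (_ *: _ + _).
  by rewrite !(intrD, rmorphN) /=; ring.
(* (k + 1) k (k - 1) / 6 *)
have bE : gbinom (k + 1)%:~R 3 = (k ^+ 3 - k)%:~R / 6 :> C.
  have g3 := gbinomS ((k + 1)%:~R : C) 2; have g2 := gbinomS ((k + 1)%:~R : C) 1.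
  move: g2 g3; rewrite gbinom1 intrD rmorphB rmorphXn /= => g2 g3.
  have {}g2 : gbinom (k%:~R + 1) 2 = k%:~R * (k%:~R + 1) / 2 :> C.
    by apply: (canRL (mulfK _)); [rewrite pnatr_eq0 | rewrite mulrC g2; ring].
  have {g3} : gbinom (k%:~R + 1) 3 =
      (k%:~R + 1 - 2) * (k%:~R * (k%:~R + 1) / 2) / 3 :> C.
    by apply: (canRL (mulfK _)); [rewrite pnatr_eq0 | rewrite mulrC g3 g2].
  by move=> ->; field.
rewrite bE; case: eqP => _; last by rewrite scaler0 mulr0 mul0r scale0r.
by congr (_ *: _); rewrite /= mulr1; field.
Qed.

End TwistedModule.

(** * Transposing modes into a coaction *)

Section JacobiContraction.
Context (R : realType).
Local Notation C := R[i].
Context (V M : lmodType C) (U : rat -> M -> V ⊗ M) (lU : forall q, linear (U q))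
  (Utr : forall m, exists c : rat, forall q, c < q -> U q m = 0).
Context (c d : V -> C) (lc : scalar c) (ld : scalar d).
Local Notation T e q m := (tcontr_l e (U q m)).

Context (W : lmodType C) (psi : M -> W) (lpsi : linear psi).

Let lcd : linear (fun x : V ⊗ (V ⊗ M) => psi (tcontr_l d (tcontr_l c x))).
Proof.
have l2 := linear_comp (@tcontr_l_lin _ _ (V ⊗ M) _ lc) (tcontr_l_lin ld).
exact: (linear_comp l2 lpsi).
Qed.

Lemma contr_jacobi12_ok m : strip_finite (fun a b => tmap id (U b) (U a m)).
Proof.
have [k hk] := Utr m; left; exists k => a b /hk ->.
exact: (linear0_bare (tmap_lin (@linear_id _ V) (lU b))).
Qed.

Lemma contr_jacobi21_ok m : strip_finite (fun b a => tswap12 (tmap id (U a) (U b m))).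
Proof.
have [k hk] := Utr m; left; exists k => a b /hk ->.
rewrite (linear0_bare (tmap_lin (@linear_id _ V) (lU b))).
exact: (linear0_bare (@tswap12_lin _ _ _ _)).
Qed.

(** Contracting (Id (x) U_b) U_a with c and then d composes the two contracted
    operators, that of d applied last. *)
Lemma contr_jacobi12 s m p q :
  psi (tcontr_l d (tcontr_l c (strip s (fun a b => tmap id (U b) (U a m)) p q))) =
  strip s (fun a b => psi (T d b (T c a m))) p q.
Proof.
rewrite (strip_lin s p q lcd (contr_jacobi12_ok m)); congr (strip _ _ _ _).
by apply/funext => a; apply/funext => b; rewrite tcontr_l_tmap.
Qed.

(** The transposition of the first two factors reverses the order of composition. *)
Lemma contr_jacobi21 s m p q :
  psi (tcontr_l d (tcontr_l c
    (strip s (fun b a => tswap12 (tmap id (U a) (U b m))) p q))) =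
  strip s (fun b a => psi (T c a (T d b m))) p q.
Proof.
rewrite (strip_lin s p q lcd (contr_jacobi21_ok m)); congr (strip _ _ _ _).
by apply/funext => b; apply/funext => a; rewrite tcontr_swap12// tcontr_l_tmap.
Qed.

Context (UV : rat -> V -> V ⊗ V) (lUV : forall q, linear (UV q)).
Context (e : V -> V) (le : linear e).

Lemma contr_jacobi_iter_ok m :
  strip_finite (fun b a => tmap e id (tassoc (tmap (UV a) id (U b m)))).
Proof.
have [k hk] := Utr m; left; exists k => b a /hk ->.
rewrite (linear0_bare (tmap_lin (lUV a) (@linear_id _ M))).
rewrite (linear0_bare (@tassoc_lin _ _ _ _)).
exact: (linear0_bare (tmap_lin le (@linear_id _ _))).
Qed.

(** The functionals c and d first combine to a functional on V through UV, as in
    the product of the dual algebra, before it is contracted with U. The map e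
    stands for an eigenprojection, or for the identity in the untwisted case. *)
Lemma contr_jacobi_iter s m p q :
  psi (tcontr_l d (tcontr_l c
    (strip s (fun b a => tmap e id (tassoc (tmap (UV a) id (U b m)))) p q))) =
  strip s (fun b a => psi (T (tpair (c \o e) d \o UV a) b m)) p q.
Proof.
have lce : scalar (c \o e) by move=> a x y /=; rewrite le lc.
rewrite (strip_lin s p q lcd (contr_jacobi_iter_ok m)); congr (strip _ _ _ _).
apply/funext => b; apply/funext => a.
rewrite tcontr_l_tmap// tcontr_assoc// tcontr_l_tmap//.
exact: tpair_scalar.
Qed.

End JacobiContraction.

Lemma tmap_id (F : fieldType) (V W : lmodType F) (x : V ⊗ W) : tmap id id x = x.
Proof.
move: x; apply: tensor_linear_eq => // [|v w]; first exact: tmap_lin.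
by rewrite tmap_tpure.
Qed.

Lemma sum_neq0 (V : nmodType) (I : Type) (r : seq I) (E : I -> V) :
  \sum_(i <- r) E i != 0 -> exists i, E i != 0.
Proof.
apply: contra_neqP => h; rewrite big1// => i _.
by apply/eqP/negPn/negP => n0; apply: h; exists i.
Qed.

(** Bounds on degrees give finiteness because V is graded by integers. *)
Lemma int_segment (lo : int) (hi : rat) :
  exists X : {fset int}, forall a : int, lo <= a -> a%:~R <= hi -> a \in X.
Proof.
have [N hN] := natr_gt (hi - lo%:~R).
exists [fset (lo + k%:Z)%R | k in iota 0 N]%fset => a la ah.
apply/imfsetP; exists `|a - lo|%N; last by rewrite gez0_abs ?subr_ge0//; ring.
rewrite /= mem_iota add0n ltnNge; apply/negP => /hN.
rewrite pmulrn gez0_abs ?subr_ge0// rmorphB /=; lra.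
Qed.

Section DegreeBound.
Context (F : fieldType) (I : choiceType) (deg : I -> rat) (N : lmodType F)
  (gr : grading I N).

(** An element of the graded dual involves only finitely many degrees. *)
Lemma gdual_deg_ub (f : gdual gr) :
  exists hi : rat, forall t n, f (gproj gr t n) != 0 -> deg t <= hi.
Proof.
have [X hX] := gdual_cover f.
exists (\sum_(t <- X) `|deg t|) => t n n0.
have tX : t \in X by apply: contraNT n0 => /hX ->.
rewrite (le_trans (ler_norm _))// (big_rem t tX)/= lerDl.
by apply: sumr_ge0.
Qed.

Lemma gdual_neq0_homog (f : gdual gr) n : f n != 0 ->
  exists s v, homog gr s v /\ f v != 0.
Proof.
have [X hX] := gproj_cover gr n.
rewrite {1}(gproj_sum_fset hX) gdual_sum => /sum_neq0[s n0].
by exists s, (gproj gr s n); split=> //; exact: gproj_same.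
Qed.

Lemma gdual_neq0_proj (f : gdual gr) n : f n != 0 ->
  exists s, f (gproj gr s n) != 0.
Proof.
have [X hX] := gproj_cover gr n.
by rewrite {1}(gproj_sum_fset hX) gdual_sum => /sum_neq0[s n0]; exists s.
Qed.

End DegreeBound.

Section DualCoaction.
Context (R : realType).
Local Notation C := R[i].
Context (A : lmodType C) (grA : grading int A)
  (finA : forall s, finite_dim (homog grA s))
  (a0 : int) (bndA : forall s, s < a0 -> homog grA s = [set 0]).
Context (I : choiceType) (deg : I -> rat) (deg_inj : injective deg)
  (N : lmodType C) (grN : grading I N)
  (b0 : rat) (bndN : forall t, deg t < b0 -> homog grN t = [set 0]).
Context (S : A -> rat -> N -> N)
  (S_linl : forall q n, linear (fun u => S u q n))
  (S_linr : forall u q, linear (S u q))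
  (S_deg : forall a t s u n q, homog grA a u -> homog grN t n ->
     gproj grN s (S u q n) != 0 -> deg s = a%:~R + deg t + q).
Implicit Types (f : gdual grN) (u v : A) (n : N) (q : rat).

(** The degree count behind everything that follows: f pairs with S u q n only if
    some degree of f is the sum of q and degrees of u and n. *)
Lemma pairing_deg f u q s n : homog grN s n -> f (S u q n) != 0 ->
  exists a t, [/\ gproj grA a u != 0, f (gproj grN t (S (gproj grA a u) q n)) != 0
    & deg t = a%:~R + deg s + q].
Proof.
move=> hn; have [X hX] := gproj_cover grA u.
rewrite {1}(gproj_sum_fset hX) (linear_sum_bare (S_linl q n)) gdual_sum.
move=> /sum_neq0[a /gdual_neq0_proj[t ft]]; exists a, t; split=> //.
  apply: contraNneq ft => ->.
  by rewrite (linear0_bare (S_linl q n)) linear0 gdual0.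
apply: (S_deg (u := gproj grA a u) (n := n)) => //; first exact: gproj_same.
by apply: contraNneq ft => ->; rewrite gdual0.
Qed.

Lemma dmode_subproof u q f :
  ((fun n => f (S u q n)) : N -> C^o) \in gdual_pred grN.
Proof.
apply/asboolP; split; first exact: (linear_comp (S_linr u q) (gdual_linear f)).
have [X hX] := gdual_cover f; have [Y hY] := gproj_cover grA u.
pose D := [seq deg t - a%:~R - q | t <- X, a <- Y].
apply: (@sub_finite_set _ _ (deg @^-1` [set` D])); last first.
  by apply: finite_preimage; [move=> ? ? _ _; exact: deg_inj | exact: finite_seq].
move=> s /= [n fn]; have [a [t [ua ft dt]]] := pairing_deg (gproj_same grN s n) fn.
have aY : a \in Y by apply: contraNT ua => /hY ->.
have tX : t \in X by apply: contraNT ft => /hX ->.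
apply/allpairsP; exists (t, a); split=> //=.
by rewrite dt; ring.
Qed.

(** The transpose of a mode. It lies in the graded dual since, f, u and q being
    given, [pairing_deg] leaves finitely many degrees for n. *)
Definition dmode u q f : gdual grN := GDual (dmode_subproof u q f).

Lemma dmode_linl q f : linear (fun u => dmode u q f).
Proof.
by move=> a u v; apply: gdual_ext => n /=; rewrite S_linl gdual_linear.
Qed.

Lemma dmode_linr u q : linear (dmode u q).
Proof. by move=> a f f'; apply: gdual_ext. Qed.

Lemma dmode_homog a t b u q f : homog grA a u -> homog (gdual_grading grN) t f ->
  deg b = deg t - a%:~R - q -> homog (gdual_grading grN) b (dmode u q f).
Proof.
move=> hu hf db; apply: homogP => s sb; apply: gdual_ext => n /=.
apply/eqP/negPn/negP => /gdual_neq0_proj[t' n0].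
have tt' : t = t'.
  apply: contraNeq n0 => tt'; move/gdual_homogP : hf => <-.
  by rewrite gproj_orth (negPf tt') gdual0.
have /(S_deg hu (gproj_same _ _ _)) dt : gproj grN t' (S u q (gproj grN s n)) != 0.
  by apply: contraNneq n0 => ->; rewrite gdual0.
by move/eqP: sb; apply; apply: deg_inj; rewrite db tt' dt; ring.
Qed.

(** Degrees of N are bounded below, so f bounds from above the sum of q and the
    degree of u. This yields both the finite support needed for [tensor_of_map]
    and the truncation of the coaction. *)
Lemma pairing_bound f : exists hi : rat, forall a u q n, homog grA a u ->
  f (S u q n) != 0 -> a%:~R + q <= hi /\ a0 <= a.
Proof.
have [hi hhi] := gdual_deg_ub deg f.
exists (hi - b0) => a u q n hu fn.
have u0 : u <> 0 by move=> u0; move: fn; rewrite u0 (linear0_bare (S_linl _ _)) gdual0 eqxx.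
have la : a0 <= a.
  by rewrite leNgt; apply/negP => /bndA h; apply: u0; move: hu; rewrite h.
have [X hX] := gproj_cover grN n.
move: fn; rewrite {1}(gproj_sum_fset hX) (linear_sum_bare (S_linr u q)) gdual_sum.
move=> /sum_neq0[s fs]; have [t ft] := gdual_neq0_proj fs.
have /(S_deg hu (gproj_same _ _ _)) dt : gproj grN t (S u q (gproj grN s n)) != 0.
  by apply: contraNneq ft => ->; rewrite gdual0.
have lb : b0 <= deg s.
  rewrite leNgt; apply/negP => /bndN h; move: fs.
  have : homog grN s (gproj grN s n) by exact: gproj_same.
  by rewrite h => ->; rewrite (linear0_bare (S_linr _ _)) gdual0 eqxx.
by split=> //; have := hhi _ _ ft; rewrite dt; lra.
Qed.

Lemma coact_ex q f : exists x : gdual grA ⊗ gdual grN,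
  forall u, tcontr_l (fun g : gdual grA => g u) x = dmode u q f.
Proof.
apply: (tensor_of_map finA (dmode_linl q f)).
have [hi hhi] := pairing_bound f.
have [X hX] := int_segment a0 (hi - q); exists X => a aX u.
apply: gdual_ext => n /=; apply/eqP/negPn/negP => fn.
have [h1 h2] := hhi _ _ _ _ (gproj_same grA a u) fn.
by move/negP: aX; apply; apply: hX => //; lra.
Qed.

(** The coefficient of z^q in the coaction on the dual: the tensor whose contraction
    with u is the transpose of the mode of u. By [gdual_tensor_ext] it is unique,
    which is why the choice is linear in f. *)
Definition coact q f : gdual grA ⊗ gdual grN := projT1 (cid (coact_ex q f)).

Lemma coactE u q f : tcontr_l (fun g : gdual grA => g u) (coact q f) = dmode u q f.
Proof. exact: (projT2 (cid (coact_ex q f))). Qed.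

Lemma coact_linear q : linear (coact q).
Proof.
move=> a f f'; apply: (gdual_tensor_ext finA) => u.
rewrite (tcontr_l_lin (@eval_scalar _ _ _ grA u)) !coactE.
exact: dmode_linr.
Qed.

Lemma coact_trunc f : exists c : rat, forall q, c < q -> coact q f = 0.
Proof.
have [hi hhi] := pairing_bound f; exists (hi - a0%:~R) => q hq.
apply: (gdual_tensor_ext finA) => u; rewrite coactE.
rewrite (linear0_bare (tcontr_l_lin (@eval_scalar _ _ _ grA u))).
apply: gdual_ext => n /=; apply/eqP/negPn/negP => fn.
have [X hX] := gproj_cover grA u; move: fn.
rewrite (gproj_sum_fset hX) (linear_sum_bare (S_linl q n)) gdual_sum.
move=> /sum_neq0[a fa].
have [h1 h2] := hhi _ _ _ _ (gproj_same grA a u) fa.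
by move: h2; rewrite -(ler_int rat) => h2; lra.
Qed.

Lemma coact_pair u q n f :
  tpair (fun g : gdual grA => g u) (fun g : gdual grN => g n) (coact q f) =
  f (S u q n).
Proof.
rewrite tpair_contr ?coactE//; exact: eval_scalar.
Qed.

Context (S_trunc : forall v n, exists c : rat, forall q, q < c -> S v q n = 0).
Local Notation ev u := (fun g : gdual _ => g u).

Let eval_lin n : linear ((fun f : gdual grN => f n) : gdual grN -> C^o).
Proof. exact: eval_scalar. Qed.

(** Each side is a finite sum for its own reason: the left one because coactions are
    bounded above, the right one because modes are bounded below. The same holds
    for [coact_term21] and [coact_term_iter]. *)
Lemma coact_term12 s u v n f p q :
  (tcontr_l (ev v) (tcontr_l (ev u)
    (strip s (fun a b => tmap id (coact b) (coact a f)) p q))) n =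
  f (strip s (fun a b => S u a (S v b n)) p q).
Proof.
rewrite (contr_jacobi12 coact_linear coact_trunc (eval_scalar u) (eval_scalar v) (eval_lin n)).
rewrite (strip_lin (W' := C^o) s p q (gdual_linear f)).
  apply: eq_strip => a b.
  by rewrite !coactE.
have [c hc] := S_trunc v n; right; exists c => a b /hc ->.
exact: (linear0_bare (S_linr _ _)).
Qed.

Lemma coact_term21 s u v n f p q :
  (tcontr_l (ev v) (tcontr_l (ev u)
    (strip s (fun b a => tswap12 (tmap id (coact a) (coact b f))) p q))) n =
  f (strip s (fun b a => S v b (S u a n)) p q).
Proof.
rewrite (contr_jacobi21 coact_linear coact_trunc (eval_scalar u) (eval_scalar v) (eval_lin n)).
rewrite (strip_lin (W' := C^o) s p q (gdual_linear f)).
  apply: eq_strip => a b.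
  by rewrite !coactE.
have [c hc] := S_trunc u n; right; exists c => b a /hc ->.
exact: (linear0_bare (S_linr _ _)).
Qed.

Context (D : rat -> gdual grA -> gdual grA ⊗ gdual grA) (lD : forall q, linear (D q))
  (SA : A -> rat -> A -> A)
  (SA_trunc : forall u v, exists c : rat, forall q, q < c -> SA u q v = 0)
  (DE : forall u v q (g : gdual grA), tpair (ev u) (ev v) (D q g) = g (SA u q v)).

(** The comultiplication D is transposed to the product SA, and e to e'. *)
Lemma coact_term_iter (e : gdual grA -> gdual grA) (e' : A -> A) (le : linear e)
    (ee' : forall g u, e g u = g (e' u)) s u v n f p q :
  (tcontr_l (ev v) (tcontr_l (ev u)
    (strip s (fun b a => tmap e id (tassoc (tmap (D a) id (coact b f)))) p q))) n =
  f (strip s (fun b a => S (SA (e' u) a v) b n) p q).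
Proof.
rewrite (contr_jacobi_iter coact_trunc (eval_scalar u) (eval_scalar v)
  (eval_lin n) lD le).
rewrite (strip_lin (W' := C^o) s p q (gdual_linear f)).
  apply: eq_strip => b a.
  have -> : tpair ((ev u) \o e) (ev v) \o D a = (ev (SA (e' u) a v)) :> (gdual grA -> C).
    apply/funext => g; rewrite /= -DE; congr (tpair _ _ _).
    by apply/funext => g' /=.
  by rewrite coactE.
have [c hc] := SA_trunc (e' u) v; right; exists c => b a /hc ->.
exact: (linear0_bare (S_linl _ _)).
Qed.

End DualCoaction.

(** * The dual of a vertex operator algebra *)

Section Span.
Context (F : fieldType) (V W : lmodType F) (P : V -> W -> Prop).

Lemma tspan_tpure v w : P v w -> tspan P (tpure v w).
Proof.
move=> Pvw; exists [:: (1, v, w)]; split; last by rewrite big_seq1 scale1r.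
by move=> p; rewrite inE => /eqP ->.
Qed.

Lemma tspanD x y : tspan P x -> tspan P y -> tspan P (x + y).
Proof.
move=> [s [sP ->]] [t [tP ->]]; exists (s ++ t); rewrite big_cat; split=> // p.
by rewrite mem_cat => /orP[/sP|/tP].
Qed.

Lemma tspan0 : tspan P 0.
Proof. by exists [::]; rewrite big_nil. Qed.

Lemma tspan_sum (J : eqType) (r : seq J) (E : J -> V ⊗ W) :
  (forall j, j \in r -> tspan P (E j)) -> tspan P (\sum_(j <- r) E j).
Proof.
move=> h; rewrite big_seq; elim/big_ind: _ => //; last exact: tspanD.
by exists [::]; rewrite big_nil.
Qed.

Lemma tspanZ a x : tspan P x -> tspan P (a *: x).
Proof.
move=> [s [sP ->]]; exists [seq (a * p.1.1, p.1.2, p.2) | p <- s]; split.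
  by move=> _ /mapP[p /sP ps ->].
by rewrite big_map scaler_sumr; apply: eq_bigr => p _; rewrite scalerA.
Qed.


End Span.

Lemma tspan_tmap (F : fieldType) (V W V' W' : lmodType F) (P : V -> W -> Prop)
    (Q : V' -> W' -> Prop) (f : V -> V') (g : W -> W') x :
  linear f -> linear g ->
  (forall v w, P v w -> tspan Q (tpure (f v) (g w))) ->
  tspan P x -> tspan Q (tmap f g x).
Proof.
move=> lf lg PQ [s [sP ->]]; rewrite (linear_sum_bare (tmap_lin lf lg)).
apply: tspan_sum => p /sP ps; rewrite (linearZ_bare (tmap_lin lf lg)).
by apply: tspanZ; rewrite tmap_tpure//; exact: PQ.
Qed.

(** By [tensor_expand], membership in the span can be checked on contractions with
    homogeneous vectors. *)
Lemma tspan_gdual (F : fieldType) (I : choiceType) (A W : lmodType F)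
    (gr : grading I A) (P : gdual gr -> W -> Prop) x :
  (forall s, finite_dim (homog gr s)) ->
  (forall s u g, homog gr s u -> homog (gdual_grading gr) s g ->
     P g (tcontr_l (fun g : gdual gr => g u) x)) ->
  tspan P x.
Proof.
move=> fin h; have [X {1}->] := tensor_expand fin x.
apply: tspan_sum => s _; apply: tspan_sum => p /hbasis_homog[h1 h2].
by apply: tspan_tpure; exact: (h s).
Qed.

Definition scalar_of (F : fieldType) (V : lmodType F) (c : V -> F) (lc : scalar c) :
    {scalar V} := HB.pack c (GRing.isLinear.Build F V F *%R c lc).

Section DualVoc.
Context (R : realType).
Local Notation C := R[i].
Context (A : lmodType C) (gr : grading int A) (aA : voa gr).
Local Notation S := (voa_S aA).
Local Notation one := (voa_one aA).
Local Notation om := (voa_omega aA).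
Local Notation ev u := (fun g : gdual gr => g u).
Implicit Types (f g : gdual gr).

Definition voa_lb : int := projT1 (cid (voa_bound aA)).

Lemma voa_lbP s : s < voa_lb -> homog gr s = [set 0].
Proof. exact: (projT2 (cid (voa_bound aA))). Qed.

Lemma voa_lb_rat (s : int) : s%:~R < voa_lb%:~R :> rat -> homog gr s = [set 0].
Proof. by rewrite ltr_int; exact: voa_lbP. Qed.

Lemma rat_of_int_inj : injective (fun s : int => s%:~R : rat).
Proof. exact: intr_inj. Qed.

(** The case N = A of [coact], graded by the integers. *)
Definition dvoc_U (q : rat) (f : gdual gr) : gdual gr ⊗ gdual gr :=
  coact (voa_fin aA) voa_lbP rat_of_int_inj voa_lb_rat
    (voa_S_linl aA) (voa_S_linr aA) (@voa_S_deg _ _ _ aA) q f.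

Definition dvoc_mode u q f : gdual gr :=
  dmode rat_of_int_inj (voa_S_linl aA) (voa_S_linr aA) (@voa_S_deg _ _ _ aA) u q f.

Lemma dvoc_modeE u q f v : dvoc_mode u q f v = f (S u q v).
Proof. by []. Qed.

Lemma dvoc_UE u q f : tcontr_l (ev u) (dvoc_U q f) = dvoc_mode u q f.
Proof. exact: coactE. Qed.

Lemma dvoc_pair u v q f : tpair (ev u) (ev v) (dvoc_U q f) = f (S u q v).
Proof. exact: coact_pair. Qed.

Lemma dvoc_U_linear q : linear (dvoc_U q).
Proof. exact: coact_linear. Qed.

Definition dvoc_delta (k : int) : {linear gdual gr -> gdual gr ⊗ gdual gr} :=
  linear_of (dvoc_U_linear (- k%:~R - 1)).

Lemma dvoc_coser q f : coser dvoc_delta q f = dvoc_U q f.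
Proof.
case: (rat_intP q) => [[k ->]|qn]; first by rewrite coser_int.
rewrite coser_nint//; apply: (gdual_tensor_ext (voa_fin aA)) => u.
rewrite dvoc_UE (linear0_bare (tcontr_l_lin (@eval_scalar _ _ _ gr u))).
by apply: gdual_ext => v; rewrite dvoc_modeE /voa_S coser_nint// gdual0.
Qed.

Definition dvoc_c : {scalar gdual gr} := scalar_of (eval_scalar one : scalar (ev one)).
Definition dvoc_rho : {scalar gdual gr} := scalar_of (eval_scalar om : scalar (ev om)).

(** The transpose of L(-k): the coefficient z^(k-2) of the coaction, contracted with
    omega, is the transpose of omega_(1-k). *)
Lemma dvoc_L k f v : colie dvoc_rho (coser dvoc_delta) k f v = f (voa_L aA (- k) v).
Proof.
rewrite /colie dvoc_coser dvoc_UE dvoc_modeE voa_L_S; congr (f (S om _ v)).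
by rewrite rmorphN opprK.
Qed.

Lemma dvoc_trunc f : exists k0 : int, forall k, k < k0 -> dvoc_delta k f = 0.
Proof.
have [c hc] := coact_trunc (voa_fin aA) voa_lbP rat_of_int_inj voa_lb_rat
    (voa_S_linl aA) (voa_S_linr aA) (@voa_S_deg _ _ _ aA) f.
have [N hN] := natr_gt c; exists (- N%:Z) => k kN; apply: hc.
rewrite (lt_le_trans (hN N (leqnn _)))// -[N%:R]/(N%:Z%:~R) -[1]/(1%:~R).
by rewrite -rmorphN -rmorphB ler_int; lia.
Qed.

Lemma dvoc_deg k s f : homog (gdual_grading gr) s f ->
  tspan (fun u w => exists a b : int, [/\ homog (gdual_grading gr) a u,
     homog (gdual_grading gr) b w & a + b = s + k + 1]) (dvoc_delta k f).
Proof.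
move=> hf; apply: (tspan_gdual (voa_fin aA)) => a u g hu hg.
exists a, (s + k + 1 - a); split=> //; last by ring.
rewrite dvoc_UE; apply: (dmode_homog _ _ _ _ hu hf).
by rewrite !(rmorphD, rmorphN) /=; ring.
Qed.

Lemma dvoc_counit q f :
  tcontr_l dvoc_c (coser dvoc_delta q f) = if q == 0 then f else 0.
Proof.
rewrite dvoc_coser dvoc_UE; apply: gdual_ext => v.
by rewrite dvoc_modeE voa_vacuum; case: ifP => // _; rewrite gdual0.
Qed.

Lemma dvoc_cocreation f :
  (forall q, q < 0 -> tcontr_r dvoc_c (coser dvoc_delta q f) = 0) /\
  tcontr_r dvoc_c (coser dvoc_delta 0 f) = f.
Proof.
have E q u : tcontr_r dvoc_c (coser dvoc_delta q f) u = f (S u q one).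
  rewrite dvoc_coser -(tcontr_lr (eval_scalar u) (eval_scalar one)).
  by rewrite dvoc_UE.
split=> [q q0|]; apply: gdual_ext => u; rewrite E.
  by rewrite (voa_creation aA u).1// gdual0.
by rewrite (voa_creation aA u).2.
Qed.

(** Tested against two vectors and a third one, the identity becomes the value of f
    on Borcherds' identity. *)
Lemma dvoc_jacobi f e :
  smul (delta_z0_12 R) (series2 z1 z2 (fun a b =>
     tmap id (coser dvoc_delta b) (coser dvoc_delta a f))) e
  - smul (delta_z0_21 R) (series2 z1 z2 (fun a b =>
     tswap12 (tmap id (coser dvoc_delta a) (coser dvoc_delta b f)))) e
  = smul (delta_z1_20 R) (series2 z0 z2 (fun a b =>
     tassoc (tmap (coser dvoc_delta a) id (coser dvoc_delta b f)))) e.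
Proof.
have -> : coser dvoc_delta = dvoc_U.
  by apply/funext => q; apply/funext => g; exact: dvoc_coser.
rewrite jacobi12 jacobi21 jacobi_z1_20.
apply: (gdual_tensor_ext (voa_fin aA)) => u.
apply: (gdual_tensor_ext (voa_fin aA)) => v.
apply: gdual_ext => n.
rewrite !(linearB_bare (tcontr_l_lin (@eval_scalar _ _ _ gr _))).
rewrite gdual_subE.
have -> : (fun b a => tassoc (tmap (dvoc_U a) id (dvoc_U b f))) =
    (fun b a => tmap id id (tassoc (tmap (dvoc_U a) id (dvoc_U b f)))).
  by apply/funext => b; apply/funext => a; rewrite tmap_id.
have t12 c p q := coact_term12 (voa_fin aA) voa_lbP rat_of_int_inj voa_lb_rat
  (voa_S_linl aA) (voa_S_linr aA) (@voa_S_deg _ _ _ aA) (voa_S_trunc aA) c u v n f p q.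
have t21 c p q := coact_term21 (voa_fin aA) voa_lbP rat_of_int_inj voa_lb_rat
  (voa_S_linl aA) (voa_S_linr aA) (@voa_S_deg _ _ _ aA) (voa_S_trunc aA) c u v n f p q.
have tit c p q := coact_term_iter (voa_fin aA) voa_lbP rat_of_int_inj voa_lb_rat
  (voa_S_linl aA) (voa_S_linr aA) (@voa_S_deg _ _ _ aA)
  dvoc_U_linear (voa_S_trunc aA) dvoc_pair (e := id) (e' := id) (@linear_id _ _)
  (fun _ _ => erefl) c u v n f p q.
rewrite [X in X - _ = _]t12 [X in _ - X = _]t21 [RHS]tit.
by rewrite -voa_borcherds (linearB_bare (gdual_linear f)).
Qed.

(** Transposition reverses brackets and k |-> -k changes the sign back. *)
Lemma dvoc_virasoro : virasoro (colie dvoc_rho (coser dvoc_delta)) (voa_d aA).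
Proof.
move=> j k f; apply: gdual_ext => v.
rewrite gdual_subE gdual_addE !gdual_scaleE !dvoc_L.
rewrite -(linearB_bare (gdual_linear f)) (voa_virasoro aA (- k) (- j) v).
rewrite (linearD_bare (gdual_linear f)) !gdualZ; congr (_ * f _ + _ * _).
- by congr _%:~R; ring.
- by congr (voa_L aA _ v); ring.
rewrite (_ : - j + - k == 0 = (k + j == 0)); last by lia.
case: eqP => [kj|_]; last by rewrite !mulr0 !mul0r.
congr (_%:~R / _ * _ * _); have -> : j = - k by lia.
by ring.
Qed.

(** The transpose of L(0) acts on V_t^* as t, and the graded dual is the sum of these
    spaces. *)
Lemma dvoc_weight s f : homog (gdual_grading gr) s f <->
  colie dvoc_rho (coser dvoc_delta) 0 f = s%:~R *: f.
Proof.
split=> [hf|h].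
  apply: gdual_ext => v; rewrite dvoc_L gdual_scaleE oppr0; move: v.
  apply: (@homog_ext _ _ _ gr C^o) => [||t v hv].
  - exact: (linear_comp (voa_L_linear aA 0) (gdual_linear f)).
  - by move=> a x y; rewrite gdual_linear mulrDr mulrCA.
  rewrite (voa_weight aA hv) gdualZ.
  have [->|fv] := eqVneq (f v) 0; first by rewrite !mulr0.
  by rewrite (gdual_homog_eval hf hv fv).
apply/gdual_homogP; apply: (@homog_ext _ _ _ gr C^o) => [||t v hv].
- exact: (linear_comp (linearP _) (gdual_linear f)).
- exact: gdual_linear.
rewrite (gproj_homog _ hv); case: (eqVneq s t) => // /negPf st; rewrite gdual0.
have : colie dvoc_rho (coser dvoc_delta) 0 f v = (s%:~R *: f) v by rewrite h.
rewrite dvoc_L gdual_scaleE oppr0 (voa_weight aA hv) gdualZ => /eqP.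
rewrite -subr_eq0 -mulrBl mulf_eq0 subr_eq0 eqr_int eq_sym st.
by move/eqP.
Qed.

Lemma dvoc_deriv f q : tmap (colie dvoc_rho (coser dvoc_delta) 1) id (coser dvoc_delta q f)
  = dz (fun p => coser dvoc_delta p f) q.
Proof.
have lL : linear (colie dvoc_rho (coser dvoc_delta) 1).
  by move=> a g g'; apply: gdual_ext => v; rewrite gdual_addE gdual_scaleE !dvoc_L.
apply: (gdual_tensor_ext (voa_fin aA)) => u.
rewrite (tcontr_l_tmap (@eval_scalar _ _ _ gr u) lL (@linear_id _ _)).
have -> : (ev u) \o colie dvoc_rho (coser dvoc_delta) 1 = ev (voa_L aA (-1) u).
  by apply/funext => g; exact: dvoc_L.
rewrite /dz (linearZ_bare (tcontr_l_lin (@eval_scalar _ _ _ gr u))).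
rewrite !dvoc_coser !dvoc_UE; apply: gdual_ext => v.
by rewrite gdual_scaleE !dvoc_modeE voa_deriv /dz gdualZ.
Qed.

Definition dvoc : voc (gdual_grading gr).
Proof.
apply: (@Voc _ _ (gdual_grading gr) dvoc_delta dvoc_c dvoc_rho (voa_d aA)).
- by move=> s; apply/gdual_finite_dim/(voa_fin aA).
- by exists voa_lb => s /voa_lbP; exact: gdual_homog_triv.
- exact: dvoc_trunc.
- exact: dvoc_deg.
- exact: dvoc_counit.
- exact: dvoc_cocreation.
- exact: dvoc_jacobi.
- exact: dvoc_virasoro.
- exact: dvoc_weight.
- exact: dvoc_deriv.
Defined.

Lemma dvoc_UvE q f : voc_U dvoc q f = dvoc_U q f.
Proof. exact: dvoc_coser. Qed.

Lemma dvoc_is_dual : is_dual_voc aA dvoc.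
Proof. by split=> // f q u v; rewrite dvoc_UvE dvoc_pair. Qed.

End DualVoc.

(** * Pullback along automorphisms, twisted exponents *)

Section Pullback.
Context (F : fieldType) (I : choiceType) (V : lmodType F) (gr : grading I V).
Context (k : V -> V) (lk : linear k) (hk : forall s v, homog gr s v -> homog gr s (k v)).

(** A linear map that preserves degrees commutes with the projections. *)
Lemma gproj_comm s v : gproj gr s (k v) = k (gproj gr s v).
Proof.
move: v; apply: (homog_ext (gr := gr)) => [||t v hv].
- exact: (linear_comp lk (linearP _)).
- exact: (linear_comp (linearP _) lk).
rewrite (gproj_homog _ hv) (gproj_homog _ (hk hv)).
by case: eqVneq => // _; rewrite (linear0_bare lk).
Qed.

Lemma gpull_subproof (f : gdual gr) : ((f \o k) : V -> F^o) \in gdual_pred gr.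
Proof.
apply: gdual_predP; first exact: (linear_comp lk (gdual_linear f)).
have [X hX] := gdual_cover f; exists X => s /hX h v /=.
by rewrite -gproj_comm h.
Qed.

Definition gpull_fun (f : gdual gr) : gdual gr := GDual (gpull_subproof f).

Lemma gpull_linear : linear gpull_fun.
Proof. by move=> a f g; exact: gdual_ext. Qed.

Definition gpull : {linear gdual gr -> gdual gr} := linear_of gpull_linear.

Lemma gpullE f v : gpull f v = f (k v). Proof. by []. Qed.

Lemma iter_gpull j f v : iter j gpull f v = f (iter j k v).
Proof. by elim: j v => // j IH v; rewrite iterS gpullE IH -iterSr. Qed.

Lemma gpull_homog s f : homog (gdual_grading gr) s f ->
  homog (gdual_grading gr) s (gpull f).
Proof.
by move=> /gdual_homogP h; apply/gdual_homogP => v; rewrite !gpullE -gproj_comm h.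
Qed.

Lemma gdual_separates (fin : forall s, finite_dim (homog gr s)) v w :
  (forall f : gdual gr, f v = f w) -> v = w.
Proof.
move=> h; apply: (gproj_ext (gr := gr)) => s.
by rewrite !(hbasis_sum fin); apply: eq_bigr => p _; rewrite h.
Qed.

(** The order is not smaller on the dual, because the dual separates vectors. *)
Lemma gpull_order (fin : forall s, finite_dim (homog gr s)) T :
  has_order k T -> has_order gpull T.
Proof.
case=> T0 kT kn; split=> // [f|m mT h].
  by apply: gdual_ext => v; rewrite iter_gpull kT.
apply: (kn m mT) => v; apply: (gdual_separates fin) => f.
by rewrite -iter_gpull h.
Qed.

End Pullback.

Section PullbackEigen.
Context (R : realType).
Local Notation C := R[i].
Context (I : choiceType) (V : lmodType C) (gr : grading I V).
Context (k : V -> V) (lk : linear k) (hk : forall s v, homog gr s v -> homog gr s (k v)).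
Local Notation K := (gpull lk hk).

(** Eigenprojections are polynomials in k, so they are exchanged by transposition
    with those of the pullback. *)
Lemma eigproj_gpull T r f v : eigproj K T r f v = f (eigproj k T r v).
Proof.
rewrite /eigproj gdual_scaleE sum_gdual gdualZ gdual_sum; congr (_ * _).
by apply: eq_bigr => j _; rewrite gdual_scaleE gdualZ iter_gpull.
Qed.

Lemma eigproj_homog T r s v : homog gr s v -> homog gr s (eigproj k T r v).
Proof.
move=> hv; apply: homogZ; apply: homog_sum => j _; apply: homogZ.
by elim: (j : nat) => //= i; exact: hk.
Qed.

End PullbackEigen.

Section Tcoser.
Context (R : realType).
Local Notation C := R[i].
Context (V M : lmodType C) (g : V -> V) (T : nat) (T0 : (0 < T)%N)
  (D : int -> M -> V ⊗ M).

(** Since 0 <= r < T, the exponent determines both k and r: every exponent of z in a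
    twisted coaction carries one eigencomponent of one coefficient. *)
Lemma twist_inj (k k' : int) (r r' : nat) : (r < T)%N -> (r' < T)%N ->
  - (r%:R / T%:R) - k%:~R - 1 = - (r'%:R / T%:R) - k'%:~R - 1 :> rat ->
  k = k' /\ r = r'.
Proof.
move=> rT rT' E; have TT : T%:R != 0 :> rat by rewrite pnatr_eq0 -lt0n.
have : r%:R + k%:~R * T%:R = r'%:R + k'%:~R * T%:R :> rat.
  rewrite -[r%:R](divfK TT) -[in RHS](divfK TT r'%:R) -!mulrDl; congr (_ * _).
  by move/addIr: E; rewrite -!opprD => /oppr_inj.
rewrite !pmulrn -!rmorphM -!rmorphD /= => /eqP; rewrite eqr_int => /eqP {}E.
have [kk|kk|kk] := ltgtP k k'; [exfalso; nia | exfalso; nia | split=> //; nia].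
Qed.

Lemma tcoser_at (k : int) (r : nat) m : (r < T)%N ->
  tcoser g T D (- (r%:R / T%:R) - k%:~R - 1) m = tmap (eigproj g T r) id (D k m).
Proof.
move=> rT; rewrite /tcoser (fsum_single (i := k)) => [|j jk].
  rewrite (bigD1 (Ordinal rT))//= eqxx big1 ?addr0// => i ir.
  case: eqP => // /(twist_inj rT (ltn_ord i))[_ E].
  by move: ir; rewrite -val_eqE /= E eqxx.
rewrite big1// => i _; case: eqP => // /(twist_inj rT (ltn_ord i))[E _].
by move: jk; rewrite E eqxx.
Qed.

Lemma tcoser_none q m :
  (forall (r : nat), (r < T)%N -> q + r%:R / T%:R \isn't a Num.int) ->
  tcoser g T D q m = 0.
Proof.
move=> h; rewrite /tcoser fsbig1// => k _; rewrite big1// => r _.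
case: eqP => // E; have := h r (ltn_ord r); rewrite E.
have -> : - (r%:R / T%:R) - k%:~R - 1 + r%:R / T%:R = - k%:~R - 1 :> rat by ring.
by rewrite rpredB ?rpred1// rpredN rpred_int.
Qed.

Lemma twist_case (q : rat) :
  (exists (k : int) (r : nat), (r < T)%N /\ q = - (r%:R / T%:R) - k%:~R - 1) \/
  (forall (r : nat), (r < T)%N -> q + r%:R / T%:R \isn't a Num.int).
Proof.
case: (pselect (exists r : nat, (r < T)%N /\ q + r%:R / T%:R \is a Num.int)).
  move=> [r [rT /intrP[m qm]]]; left; exists (- m - 1), r; split=> //.
  rewrite -[q](addrK (r%:R / T%:R)) qm rmorphB rmorphN /=; ring.
by move=> h; right => r rT; apply/negP => qr; apply: h; exists r.
Qed.

End Tcoser.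

(** * The dual of a twisted module *)

Section DualComodule.
Context (R : realType).
Local Notation C := R[i].
Context (A : lmodType C) (grA : grading int A) (aA : voa grA) (h : voa_aut aA)
  (T : nat) (hh : has_order h T)
  (N : lmodType C) (mN : weak_module h T N)
  (grN : grading rat N) (hN : module_admissible mN grN).
Local Notation S := (voa_S aA).
Local Notation SN := (wm_S mN).
Local Notation one := (voa_one aA).
Local Notation om := (voa_omega aA).
Local Notation ev u := (fun g : gdual _ => g u).
Local Notation hinv := (voa_aut_inv h).
Local Notation ep := (eigproj h T).
Implicit Types (f : gdual grN) (g : gdual grA).

Let T0 : (0 < T)%N. Proof. by case: hh. Qed.
Let hT v : iter T h v = v. Proof. by case: hh => _ ->. Qed.
Let lh : linear h. Proof. exact: linearP. Qed.
Let lep r : linear (ep r). Proof. exact: eigproj_linear. Qed.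

(* the action of an automorphism of a vertex operator algebra on the dual *)
Section PullbackAut.
Context (k : voa_aut aA).

Definition pullA : {linear gdual grA -> gdual grA} :=
  gpull (linearP k) (@voa_aut_homog _ _ _ _ k).

Lemma pullAE g v : pullA g v = g (k v). Proof. by []. Qed.

(** The transpose of the fact that automorphisms preserve the product. *)
Lemma pullA_delta j g : dvoc_delta aA j (pullA g) = tmap pullA pullA (dvoc_delta aA j g).
Proof.
apply: (gdual_tensor_ext (voa_fin aA)) => u.
rewrite (tcontr_l_tmap (@eval_scalar _ _ _ grA u) (linearP _) (linearP _)).
rewrite -[X in _ = pullA X]/(tcontr_l (ev (k u)) _) !dvoc_UE.
apply: gdual_ext => v; rewrite pullAE !dvoc_modeE pullAE.
by rewrite voa_aut_S.
Qed.

End PullbackAut.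

(** The action f |-> f o h^-1. The twisting automorphism of the dual comodule is its
    inverse f |-> f o h. *)
Definition dual_voc_aut : voc_aut (dvoc aA).
Proof.
apply: (@VocAut _ _ _ (dvoc aA) (pullA hinv) (pullA h)).
- by move=> g; apply: gdual_ext => v; rewrite !pullAE /= voa_autK.
- by move=> g; apply: gdual_ext => v; rewrite !pullAE /= voa_autVK.
- by move=> g; congr (g _); exact: (voa_aut_one hinv).
- by move=> g; congr (g _); exact: (voa_aut_omega hinv).
- by move=> j g; exact: pullA_delta.
Defined.

Local Notation G := (voc_aut_inv dual_voc_aut).

Lemma dual_voc_aut_order : has_order G T.
Proof. exact: (gpull_order (linearP h) (@voa_aut_homog _ _ _ _ h) (voa_fin aA) hh). Qed.

Lemma dual_eigproj r g v : eigproj G T r g v = g (ep r v).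
Proof. exact: (eigproj_gpull (linearP h) (@voa_aut_homog _ _ _ _ h)). Qed.

Let lepG r : linear (eigproj G T r).
Proof. by apply: eigproj_linear; exact: linearP. Qed.

(** The degrees in (1/T) N are bounded below by 0. *)
Lemma frac_ge0 (M : lmodType C) (gr : grading rat M) t :
  frac_supported gr T -> t < 0 -> homog gr t = [set 0].
Proof.
move=> hM t0; apply: hM => -[n tn]; move: t0; rewrite tn ltNge.
by rewrite divr_ge0.
Qed.

Lemma wm_S_deg a t s u n q : homog grA a u -> homog grN t n ->
  gproj grN s (SN u q n) != 0 -> s = a%:~R + t + q.
Proof.
move=> hu hn; have /(gproj_homog s) -> := hN.2 u a (- q - 1) t n hu hn.
by case: (eqVneq s _) => [-> _|_]; [ring | rewrite eqxx].
Qed.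

Lemma rat_id_inj : injective (id : rat -> rat). Proof. by []. Qed.

Definition dcomod_U (q : rat) f : gdual grA ⊗ gdual grN :=
  coact (voa_fin aA) (@voa_lbP _ _ _ aA) rat_id_inj (fun t => @frac_ge0 _ _ t hN.1)
    (wm_S_linl mN) (wm_S_linr mN) wm_S_deg q f.

Definition dcomod_mode u q f : gdual grN :=
  dmode rat_id_inj (wm_S_linl mN) (wm_S_linr mN) wm_S_deg u q f.

Lemma dcomod_modeE u q f n : dcomod_mode u q f n = f (SN u q n).
Proof. by []. Qed.

Lemma dcomod_UE u q f : tcontr_l (ev u) (dcomod_U q f) = dcomod_mode u q f.
Proof. exact: coactE. Qed.

Lemma dcomod_U_linear q : linear (dcomod_U q).
Proof. exact: coact_linear. Qed.

Lemma dcomod_pair u n q f : tpair (ev u) (ev n) (dcomod_U q f) = f (SN u q n).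
Proof. exact: coact_pair. Qed.

(** For an eigenvector u of h with eigenvalue e^(2 pi i r / T), the coefficient of
    index k has to carry the mode u_(k + r/T). The eigenprojections select these
    modes from the coefficients of the coaction for all r. *)
Definition dcomod_delta_fun (k : int) f : gdual grA ⊗ gdual grN :=
  \sum_(r < T) tmap (eigproj G T r) id (dcomod_U (- (r%:R / T%:R) - k%:~R - 1) f).

Lemma dcomod_delta_linear k : linear (dcomod_delta_fun k).
Proof.
move=> a f f'; rewrite /dcomod_delta_fun scaler_sumr -big_split /=.
apply: eq_bigr => r _; rewrite dcomod_U_linear.
exact: (tmap_lin (lepG r) (@linear_id _ _)).
Qed.

Definition dcomod_delta k : {linear gdual grN -> gdual grA ⊗ gdual grN} :=
  linear_of (dcomod_delta_linear k).

(** Modes of the other eigencomponents of u vanish at this exponent. *)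
Lemma wm_S_eigproj r u q n : (r < T)%N -> q + r%:R / T%:R \is a Num.int ->
  SN (ep r u) q n = SN u q n.
Proof.
move=> rT qr; rewrite -[in RHS](eigproj_sum h T0 u) (linear_sum_bare (wm_S_linl _ _ _)).
rewrite (bigD1 (Ordinal rT))//= big1 ?addr0// => s sr.
apply: (wm_S_modes mN n (ltn_ord s)); first exact: eigproj_eigen.
apply/negP => /intrP[m hm]; move/intrP: qr => [m' hm'].
have E : - (r%:R / T%:R) - (- m' - 1)%:~R - 1 = - (s%:R / T%:R) - (- m - 1)%:~R - 1 :> rat.
  by rewrite !rmorphB !rmorphN /= -hm -hm'; ring.
have [_ rs] := twist_inj T0 rT (ltn_ord s) E.
by move: sr; rewrite -val_eqE /= rs eqxx.
Qed.

Lemma wm_S_twist0 u q n :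
  (forall r : nat, (r < T)%N -> q + r%:R / T%:R \isn't a Num.int) -> SN u q n = 0.
Proof.
move=> qn; rewrite -[u](eigproj_sum h T0) (linear_sum_bare (wm_S_linl _ _ _)).
rewrite big1// => s _; apply: (wm_S_modes mN n (ltn_ord s)); last exact: qn.
exact: eigproj_eigen.
Qed.

(** The coefficients of the twisted coaction are those of the transposed modes: at
    every exponent all eigencomponents but one vanish on both sides. *)
Lemma dcomod_tcoser q f : tcoser G T dcomod_delta q f = dcomod_U q f.
Proof.
apply: (gdual_tensor_ext (voa_fin aA)) => u; rewrite dcomod_UE.
have [[k [r [rT qE]]]|qn] := twist_case T q; last first.
  rewrite tcoser_none// (linear0_bare (tcontr_l_lin (@eval_scalar _ _ _ grA u))).
  by apply: gdual_ext => n; rewrite dcomod_modeE wm_S_twist0// gdual0.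
have qr : q + r%:R / T%:R \is a Num.int.
  rewrite qE (_ : _ + _ = - k%:~R - 1); last by ring.
  by rewrite rpredB ?rpred1// rpredN rpred_int.
have evr s v : (ev v : gdual grA -> C) \o eigproj G T s = ev (ep s v).
  by apply/funext => g; exact: dual_eigproj.
rewrite {1}qE tcoser_at// (tcontr_l_tmap (@eval_scalar _ _ _ grA u) (lepG r) (@linear_id _ _)).
rewrite evr (linear_sum_bare (tcontr_l_lin (@eval_scalar _ _ _ grA _))).
rewrite (bigD1 (Ordinal rT))//= big1 => [|s sr]; last first.
  rewrite (tcontr_l_tmap (@eval_scalar _ _ _ grA _) (lepG s) (@linear_id _ _)) evr.
  rewrite dcomod_UE (eigproj_id lh T0 (ltn_ord s) rT (eigproj_eigen lh T0 hT r u)).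
  move: sr; rewrite -val_eqE /= => /negPf ->.
  by apply: gdual_ext => n; rewrite dcomod_modeE (linear0_bare (wm_S_linl _ _ _)) gdual0.
rewrite addr0 (tcontr_l_tmap (@eval_scalar _ _ _ grA _) (lepG r) (@linear_id _ _)) evr.
rewrite (eigproj_id lh T0 rT rT (eigproj_eigen lh T0 hT r u)) eqxx -qE dcomod_UE.
by apply: gdual_ext => n; rewrite !dcomod_modeE wm_S_eigproj.
Qed.

Lemma dcomod_trunc f : exists k0 : int, forall k, k < k0 -> dcomod_delta k f = 0.
Proof.
have [c hc] := coact_trunc (voa_fin aA) (@voa_lbP _ _ _ aA) rat_id_inj
  (fun t => @frac_ge0 _ _ t hN.1) (wm_S_linl mN) (wm_S_linr mN) wm_S_deg f.
have [M hM] := natr_gt (c + 1); exists (- M%:Z) => k kM.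
rewrite /dcomod_delta /= /dcomod_delta_fun big1// => r _.
have -> : dcomod_U (- (r%:R / T%:R) - k%:~R - 1) f = 0.
  apply: hc; have := hM M (leqnn _).
  have : M%:R + 1 <= - k%:~R :> rat.
    by rewrite -[M%:R]/(M%:Z%:~R) -[1]/(1%:~R) -rmorphN -rmorphD ler_int; lia.
  have : r%:R / T%:R <= 1 :> rat.
    by rewrite ler_pdivrMr ?ltr0n// mul1r ler_nat ltnW.
  by set x := r%:R / T%:R; lra.
exact: (linear0_bare (tmap_lin (lepG r) (@linear_id _ _))).
Qed.

(** The Jacobi identity of a twisted module for arbitrary u, as a sum over its
    eigencomponents. This is the shape of the identity for comodules. *)
Lemma wm_borcherds_sum u v n p q r :
  strip (jcoef12 R p) (fun a b => SN u a (SN v b n)) (q + 1 + p) r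
  - strip (jcoef21 R p) (fun b a => SN v b (SN u a n)) (r + 1 + p) q
  = \sum_(i < T) strip (jcoef_iter R (- (i%:R / T%:R)) q)
      (fun b a => SN (S (ep i u) a v) b n) (r + 1 + q) p.
Proof.
under eq_bigr do rewrite -(wm_borcherds mN v n p q r (ltn_ord _)
  (eigproj_eigen lh T0 hT _ u)).
rewrite sumrB; congr (_ - _).
  rewrite strip_sum => [|i].
    apply: eq_strip => a b.
    by rewrite -(linear_sum_bare (wm_S_linl _ _ _)) eigproj_sum.
  have [c hc] := wm_S_trunc mN v n; right; exists c => a b /hc ->.
  exact: (linear0_bare (wm_S_linr _ _ _)).
rewrite strip_sum => [|i].
  apply: eq_strip => b a.
  by rewrite -(linear_sum_bare (wm_S_linr _ _ _)) -(linear_sum_bare (wm_S_linl _ _ _)) eigproj_sum.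
have [c hc] := wm_S_trunc mN (ep i u) n; right; exists c => b a /hc ->.
exact: (linear0_bare (wm_S_linr _ _ _)).
Qed.

Let UE : tcoser G T dcomod_delta = dcomod_U.
Proof. by apply/funext => q; apply/funext => f; exact: dcomod_tcoser. Qed.

Lemma dcomod_counit q f :
  tcontr_l (voc_c (dvoc aA)) (tcoser G T dcomod_delta q f) = if q == 0 then f else 0.
Proof.
rewrite UE -[LHS]/(tcontr_l (ev one) _) dcomod_UE; apply: gdual_ext => n.
by rewrite dcomod_modeE wm_vacuum; case: ifP => // _; rewrite gdual0.
Qed.

Lemma dcomod_L k f n : colie (voc_rho (dvoc aA)) (tcoser G T dcomod_delta) k f n =
  f (SN om (k%:~R - 2) n).
Proof. by rewrite /colie UE -[tcontr_l _ _]/(tcontr_l (ev om) _) dcomod_UE. Qed.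

Lemma dcomod_jacobi f e :
  smul (delta_z0_12 R) (series2 z1 z2 (fun a b =>
     tmap id (tcoser G T dcomod_delta b) (tcoser G T dcomod_delta a f))) e
  - smul (delta_z0_21 R) (series2 z1 z2 (fun a b =>
     tswap12 (tmap id (tcoser G T dcomod_delta a) (tcoser G T dcomod_delta b f)))) e
  = \sum_(r < T) smul (smul (delta_z2_10 R) (Defs.ratio z1 (-1) z0 z2 (- (r%:R / T%:R))))
     (series2 z0 z2 (fun a b => tmap (eigproj G T r) id
       (tassoc (tmap (voc_U (dvoc aA) a) id (tcoser G T dcomod_delta b f))))) e.
Proof.
have -> : voc_U (dvoc aA) = dvoc_U aA.
  by apply/funext => q; apply/funext => g; exact: dvoc_UvE.
rewrite UE jacobi12 jacobi21; under eq_bigr do rewrite jacobi_twist.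
apply: (gdual_tensor_ext (voa_fin aA)) => u.
apply: (gdual_tensor_ext (voa_fin aA)) => v.
apply: gdual_ext => n.
pose phi (x : gdual grA ⊗ (gdual grA ⊗ gdual grN)) : C^o :=
  tcontr_l (ev v) (tcontr_l (ev u) x) n.
have lphi : linear phi.
  move=> a x y; rewrite /phi (tcontr_l_lin (@eval_scalar _ _ _ grA u)).
  by rewrite (tcontr_l_lin (@eval_scalar _ _ _ grA v)).
rewrite -[LHS]/(phi (_ - _)) -[RHS]/(phi _) (linearB_bare lphi) [RHS](linear_sum_bare lphi).
have t12 c p q := coact_term12 (voa_fin aA) (@voa_lbP _ _ _ aA) rat_id_inj
  (fun t => @frac_ge0 _ _ t hN.1) (wm_S_linl mN) (wm_S_linr mN) wm_S_deg
  (wm_S_trunc mN) c u v n f p q.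
have t21 c p q := coact_term21 (voa_fin aA) (@voa_lbP _ _ _ aA) rat_id_inj
  (fun t => @frac_ge0 _ _ t hN.1) (wm_S_linl mN) (wm_S_linr mN) wm_S_deg
  (wm_S_trunc mN) c u v n f p q.
have tit (i : 'I_T) c p q := coact_term_iter (voa_fin aA) (@voa_lbP _ _ _ aA) rat_id_inj
  (fun t => @frac_ge0 _ _ t hN.1) (wm_S_linl mN) (wm_S_linr mN) wm_S_deg
  (dvoc_U_linear aA) (voa_S_trunc aA) (dvoc_pair aA) (lepG i) (dual_eigproj i)
  c u v n f p q.
rewrite [X in X - _ = _]t12 [X in _ - X = _]t21.
rewrite -(linearB_bare (gdual_linear f)) wm_borcherds_sum gdual_sum.
by apply: eq_bigr => i _; rewrite -[LHS]tit.
Qed.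

(** As for [dvoc_virasoro], from the Virasoro relations on the twisted module. *)
Lemma dcomod_virasoro :
  virasoro (colie (voc_rho (dvoc aA)) (tcoser G T dcomod_delta)) (voc_d (dvoc aA)).
Proof.
move=> j k f; apply: gdual_ext => n.
rewrite gdual_subE gdual_addE !gdual_scaleE !dcomod_L -(linearB_bare (gdual_linear f)).
have E m : m%:~R - 2 = - (- m)%:~R - 2 :> rat by rewrite rmorphN opprK.
rewrite !E (wm_virasoro_modes T0 hT mN (- j) (- k)).
rewrite (linearD_bare (gdual_linear f)) !gdualZ; congr (_ * f _ + _ * _).
- by congr _%:~R; ring.
- by congr (SN om _ n); congr (- _%:~R - _); ring.
rewrite (_ : - j + - k == 0 = (k + j == 0)); last by lia.
case: eqP => [kj|_]; last by rewrite !mulr0 !mul0r.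
congr (_%:~R / _ * _ * _); have -> : j = - k by lia.
by ring.
Qed.

(** Both derivative axioms compare a contraction with this pairing. *)
Lemma dcomod_dz q f u n :
  tcontr_l (ev u) (dz (fun p => tcoser G T dcomod_delta p f) q) n =
  ratr (q + 1) * f (SN u (q + 1) n).
Proof.
rewrite /dz (linearZ_bare (tcontr_l_lin (@eval_scalar _ _ _ grA u))) UE dcomod_UE.
by rewrite gdual_scaleE dcomod_modeE.
Qed.

Lemma dcomod_deriv f q :
  tmap (voc_L (dvoc aA) 1) id (tcoser G T dcomod_delta q f) =
  dz (fun p => tcoser G T dcomod_delta p f) q.
Proof.
have LE g v : voc_L (dvoc aA) 1 g v = g (voa_L aA (-1) v) by exact: dvoc_L.
have lL : linear (voc_L (dvoc aA) 1).
  by move=> a g g'; apply: gdual_ext => v; rewrite gdual_addE gdual_scaleE !LE.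
apply: (gdual_tensor_ext (voa_fin aA)) => u; apply: gdual_ext => n.
rewrite dcomod_dz (tcontr_l_tmap (@eval_scalar _ _ _ grA u) lL (@linear_id _ _)).
have -> : (ev u : gdual grA -> C) \o voc_L (dvoc aA) 1 = ev (voa_L aA (-1) u).
  by apply/funext => g; exact: LE.
by rewrite UE dcomod_UE dcomod_modeE (wm_deriv T0 hT) gdualZ.
Qed.

Lemma dcomod_comm f q :
  dz (fun p => tcoser G T dcomod_delta p f) q =
  tcoser G T dcomod_delta q (colie (voc_rho (dvoc aA)) (tcoser G T dcomod_delta) 1 f)
  - tmap id (colie (voc_rho (dvoc aA)) (tcoser G T dcomod_delta) 1)
      (tcoser G T dcomod_delta q f).
Proof.
have lL : linear (colie (voc_rho (dvoc aA)) (tcoser G T dcomod_delta) 1).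
  by move=> a g g'; apply: gdual_ext => v; rewrite gdual_addE gdual_scaleE !dcomod_L.
apply: (gdual_tensor_ext (voa_fin aA)) => u; apply: gdual_ext => n.
rewrite dcomod_dz (linearB_bare (tcontr_l_lin (@eval_scalar _ _ _ grA u))).
rewrite (tcontr_l_tmap (@eval_scalar _ _ _ grA u) (@linear_id _ _) lL).
rewrite gdual_subE dcomod_L !dcomod_tcoser !dcomod_UE !dcomod_modeE dcomod_L.
have m1 : 1%:~R - 2 = -1 :> rat by [].
by rewrite m1 -(linearB_bare (gdual_linear f)) (wm_comm_deriv T0 hT) gdualZ.
Qed.

Definition dual_comodule : weak_comodule G T (gdual grN).
Proof.
apply: (@WeakComodule _ _ _ (dvoc aA) G T (gdual grN) dcomod_delta).
- exact: dcomod_trunc.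
- exact: dcomod_counit.
- exact: dcomod_jacobi.
- exact: dcomod_virasoro.
- exact: dcomod_deriv.
- exact: dcomod_comm.
Defined.

(** The eigenprojections of the first factor put it in the prescribed eigenspace,
    and do not change its degree. *)
Lemma dual_comodule_admissible :
  comodule_admissible dual_comodule (gdual_grading grN).
Proof.
split=> [t ht|k t f hf]; first by apply: gdual_homog_triv; exact: hN.1.
rewrite -[wc_delta _ _ _]/(dcomod_delta_fun k f) /dcomod_delta_fun.
apply: tspan_sum => r _.
pose P g (w : gdual grN) := exists (a : int) (b : rat),
  [/\ homog (gdual_grading grA) a g, homog (gdual_grading grN) b w &
     a%:~R + b = t + k%:~R + 1 + r%:R / T%:R].
apply: (@tspan_tmap _ _ _ _ _ P _ _ id _ (lepG r) (@linear_id _ _)).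
  move=> g w [a [b [hg hw ab]]]; apply: tspan_tpure; exists r, a, b; split=> //.
    by apply: eigproj_eigen => //; [exact: linearP | case: dual_voc_aut_order].
  exact: (eigproj_homog (gpull_homog (linearP h) (@voa_aut_homog _ _ _ _ h))).
apply: (tspan_gdual (voa_fin aA)) => a u g hu hg.
exists a, (t + k%:~R + 1 + r%:R / T%:R - a%:~R); split=> //; last by ring.
rewrite dcomod_UE; apply: (dmode_homog _ _ _ _ hu hf).
by rewrite /=; ring.
Qed.

Lemma dual_comodule_pair f q u n :
  tpair (ev u) (ev n) (wc_U dual_comodule q f) = f (SN u q n).
Proof. by rewrite -[wc_U _ _ _]/(tcoser G T dcomod_delta q f) UE dcomod_pair. Qed.

Lemma twisted_module_dual :
  exists (cA' : voc (gdual_grading grA)) (h' : voc_aut cA')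
         (cN' : weak_comodule (voc_aut_inv h') T (gdual grN)),
    [/\ is_dual_voc aA cA',
        is_dual_action (voa_aut_inv h) h',
        has_order (voc_aut_inv h') T,
        comodule_admissible cN' (gdual_grading grN) &
        forall (f : gdual grN) (q : rat) (v : A) (n : N),
          tpair (fun f1 : gdual grA => f1 v) (fun f2 : gdual grN => f2 n)
            (wc_U cN' q f) = f (wm_S mN v q n)].
Proof.
exists (dvoc aA), dual_voc_aut, dual_comodule; split=> //.
- exact: dvoc_is_dual.
- exact: dual_voc_aut_order.
- exact: dual_comodule_admissible.
- by move=> f q v n; exact: dual_comodule_pair.
Qed.

End DualComodule.

(** * Transposing a coaction into modes *)

Section DualModes.
Context (R : realType).
Local Notation C := R[i].
Context (V : lmodType C) (grV : grading int V).
Context (I : choiceType) (deg : I -> rat) (deg_inj : injective deg)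
  (M : lmodType C) (grM : grading I M)
  (b0 : rat) (bndM : forall t, deg t < b0 -> homog grM t = [set 0]).
Context (U : rat -> M -> V ⊗ M) (U_lin : forall q, linear (U q))
  (U_deg : forall q t m, homog grM t m ->
     tspan (fun v n => exists (a : int) (b : I),
              [/\ homog grV a v, homog grM b n & a%:~R + deg b = deg t - q]) (U q m))
  (U_trunc : forall m, exists c : rat, forall q, c < q -> U q m = 0).
Implicit Types (f : gdual grV) (phi : gdual grM) (q : rat) (m : M).

(** The degree count dual to [pairing_deg]: the pairing is nonzero only if the
    degree of m is the sum of q and degrees of f and phi. *)
Lemma tpair_U_deg f phi q s m : homog grM s m -> tpair f phi (U q m) != 0 ->
  exists a b, [/\ exists v, f (gproj grV a v) != 0,
    exists n, phi (gproj grM b n) != 0 & a%:~R + deg b = deg s - q].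
Proof.
move=> hm; apply: contra_neqP => none.
apply: (@tspan_contr _ _ _ C^o _ (tpair f phi) (fun=> 0) _ _ _ _ (U_deg q hm)).
- exact: (tpair_scalar (gdual_linear f) (gdual_linear phi)).
- by move=> a x y; rewrite scaler0 addr0.
move=> v n [a [b [hv hn ab]]].
rewrite /tpair tlift_pure; last exact: (tpair_bilin (gdual_linear f) (gdual_linear phi)).
have [->|fv] := eqVneq (f v) 0; first by rewrite mul0r.
have [->|fn] := eqVneq (phi n) 0; first by rewrite mulr0.
exfalso; apply: none; exists a, b; split=> //; first by exists v; rewrite hv.
by exists n; rewrite hn.
Qed.

Lemma comode_subproof f q phi :
  ((fun m => tpair f phi (U q m)) : M -> C^o) \in gdual_pred grM.
Proof.
apply/asboolP; split.
  exact: (linear_comp (U_lin q) (tpair_scalar (gdual_linear f) (gdual_linear phi))).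
have [X hX] := gdual_cover f; have [Y hY] := gdual_cover phi.
pose D := [seq a%:~R + deg b + q | a <- X, b <- Y].
apply: (@sub_finite_set _ _ (deg @^-1` [set` D])); last first.
  by apply: finite_preimage; [move=> ? ? _ _; exact: deg_inj | exact: finite_seq].
move=> s /= [m fm]; have [a [b [[v fv] [n fn] ab]]] := tpair_U_deg (gproj_same grM s m) fm.
have aX : a \in X by apply: contraNT fv => /hX ->.
have bY : b \in Y by apply: contraNT fn => /hY ->.
by apply/allpairsP; exists (a, b); split=> //=; rewrite ab subrK.
Qed.

(** The mode of f on the dual of a comodule: the transpose of the contraction of the
    coaction with f. *)
Definition comode f q phi : gdual grM := GDual (comode_subproof f q phi).

Lemma comodeE f q phi m : comode f q phi m = tpair f phi (U q m).
Proof. by []. Qed.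

Lemma comode_contr f q phi m : comode f q phi m = phi (tcontr_l f (U q m)).
Proof. by rewrite comodeE tpair_contr//; exact: gdual_linear. Qed.

Lemma comode_linr f q : linear (comode f q).
Proof. by move=> a g g'; apply: gdual_ext => m; rewrite gdual_addE gdual_scaleE !comode_contr. Qed.

Lemma tcontr_l_linc (W : lmodType C) (x : V ⊗ W) :
  linear (fun f : gdual grV => tcontr_l f x).
Proof.
move=> a f g; move: x; apply: tensor_linear_eq => [||v w].
- exact: (tcontr_l_lin (gdual_linear _)).
- move=> b x y; rewrite !(tcontr_l_lin (gdual_linear _)).
  by rewrite !scalerDr !scalerA mulrC addrACA.
rewrite !tcontr_l_pure; try exact: gdual_linear.
by rewrite gdual_addE gdual_scaleE scalerDl scalerA.
Qed.

Lemma comode_linl q phi : linear (fun f => comode f q phi).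
Proof.
move=> a g g'; apply: gdual_ext => m; rewrite gdual_addE gdual_scaleE !comode_contr.
by rewrite tcontr_l_linc gdual_linear.
Qed.

Lemma comode_homog a b s f q phi : homog (gdual_grading grV) a f ->
  homog (gdual_grading grM) b phi -> deg s = a%:~R + deg b + q ->
  homog (gdual_grading grM) s (comode f q phi).
Proof.
move=> /gdual_homogP hf /gdual_homogP hphi ds; apply: homogP => t ts.
apply: gdual_ext => m; apply/eqP/negPn/negP.
move=> /(tpair_U_deg (gproj_same grM t m))[a' [b' [[v fv] [n fn] ab]]].
have aa : a = a'.
  by apply: contraNeq fv => aa; rewrite -hf gproj_orth (negPf aa) gdual0.
have bb : b = b'.
  by apply: contraNeq fn => bb; rewrite -hphi gproj_orth (negPf bb) gdual0.
move/eqP: ts; apply; apply: deg_inj; rewrite ds aa bb ab; ring.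
Qed.

(** Since the degrees of f and phi are bounded above and those of M are bounded
    below, a nonzero pairing bounds q from below. *)
Lemma comode_trunc f phi : exists c : rat, forall q, q < c -> comode f q phi = 0.
Proof.
have [hi hhi] := gdual_deg_ub (fun a : int => a%:~R) f.
have [hi' hhi'] := gdual_deg_ub deg phi.
exists (b0 - hi - hi') => q qc; apply: (gdual_ext) => m; apply/eqP/negPn/negP.
move=> /gdual_neq0_homog[s [n [hn fn]]].
have [a [b [[v fv] [w fw] ab]]] := tpair_U_deg hn fn.
have lb : b0 <= deg s.
  rewrite leNgt; apply/negP => /bndM h; move: fn hn; rewrite h => + n0.
  by rewrite n0 gdual0 eqxx.
by have := hhi _ _ fv; have := hhi' _ _ fw; lra.
Qed.

(** For m homogeneous, the degrees of the two factors of U_q m have a fixed sum.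
    Hence restricting c to V_a selects one component of the contraction with c. *)
Lemma contr_component (c : V -> C) (a : int) (t s : I) q m : scalar c ->
  homog grM s m -> deg t = deg s - q - a%:~R ->
  tcontr_l (fun v => c (gproj grV a v)) (U q m) = gproj grM t (tcontr_l c (U q m)).
Proof.
move=> lc hm dt.
have lca : scalar (fun v => c (gproj grV a v)).
  by move=> b x y; rewrite linearP lc.
apply: (@tspan_contr _ _ _ M _ (tcontr_l (fun v => c (gproj grV a v)))
  (fun x => gproj grM t (tcontr_l c x)) _ _ _ _ (U_deg q hm)).
- exact: tcontr_l_lin.
- exact: (linear_comp (tcontr_l_lin lc) (linearP _)).
move=> v n [a' [b [hv hn ab]]].
rewrite !tcontr_l_pure// linearZ /= (gproj_homog _ hv) (gproj_homog _ hn).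
have -> : (a == a') = (t == b).
  have E : deg t = a'%:~R - a%:~R + deg b by rewrite dt -ab; ring.
  apply/eqP/eqP => [aa|tb]; first by apply: deg_inj; rewrite E aa subrr add0r.
  apply/eqP; rewrite -(eqr_int rat) eq_sym -subr_eq0; apply/eqP/(addIr (deg b)).
  by rewrite -E add0r tb.
by case: eqP => _ //; rewrite (linear0_bare (W := C^o) lc) scale0r scaler0.
Qed.

Section Jacobi.
Context (UV : rat -> V -> V ⊗ V) (UV_lin : forall q, linear (UV q))
  (modeV : gdual grV -> rat -> gdual grV -> gdual grV)
  (modeVE : forall f q (g : gdual grV) v, modeV f q g v = tpair f g (UV q v))
  (modeV_trunc : forall f g, exists c : rat, forall q, q < c -> modeV f q g = 0).
Variables (f g : gdual grV) (phi : gdual grM) (m : M).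

Let eval_lin : linear ((fun phi : gdual grM => phi m) : gdual grM -> C^o).
Proof. exact: eval_scalar. Qed.

(** Here the left side is a finite sum of functionals because modes are bounded
    below, and the right side a finite sum of tensors because coactions are
    bounded above. *)
Lemma comode_term12 s p q :
  strip s (fun a b => comode f a (comode g b phi)) p q m =
  phi (tcontr_l g (tcontr_l f (strip s (fun a b => tmap id (U b) (U a m)) p q))).
Proof.
rewrite (contr_jacobi12 U_lin U_trunc (gdual_linear f) (gdual_linear g) (gdual_linear phi)).
rewrite [LHS](strip_lin s p q eval_lin).
  apply: eq_strip => a b.
  by rewrite !comode_contr.
have [c hc] := comode_trunc g phi; right; exists c => a b /hc ->.
exact: (linear0_bare (comode_linr _ _)).
Qed.

Lemma comode_term21 s p q :
  strip s (fun b a => comode g b (comode f a phi)) p q m =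
  phi (tcontr_l g (tcontr_l f
    (strip s (fun b a => tswap12 (tmap id (U a) (U b m))) p q))).
Proof.
rewrite (contr_jacobi21 U_lin U_trunc (gdual_linear f) (gdual_linear g) (gdual_linear phi)).
rewrite [LHS](strip_lin s p q eval_lin).
  apply: eq_strip => a b.
  by rewrite !comode_contr.
have [c hc] := comode_trunc f phi; right; exists c => b a /hc ->.
exact: (linear0_bare (comode_linr _ _)).
Qed.

Lemma comode_term_iter (e : V -> V) (fe : gdual grV) (le : linear e)
    (feE : forall v, fe v = f (e v)) s p q :
  strip s (fun b a => comode (modeV fe a g) b phi) p q m =
  phi (tcontr_l g (tcontr_l f
    (strip s (fun b a => tmap e id (tassoc (tmap (UV a) id (U b m)))) p q))).
Proof.
rewrite (contr_jacobi_iter U_trunc (gdual_linear f) (gdual_linear g) (gdual_linear phi) UV_lin le).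
rewrite [LHS](strip_lin s p q eval_lin).
  apply: eq_strip => b a.
  rewrite comode_contr; congr (phi (tcontr_l _ _)); apply/funext => v /=.
  by rewrite modeVE; congr (tpair _ _ _); apply/funext.
have [c hc] := modeV_trunc fe g; right; exists c => b a /hc ->.
exact: (linear0_bare (comode_linl _ _)).
Qed.

End Jacobi.

End DualModes.

(** * The dual of a vertex operator coalgebra *)

Section DualVoa.
Context (R : realType).
Local Notation C := R[i].
Context (V : lmodType C) (gr : grading int V) (cV : voc gr).
Local Notation U := (voc_U cV).
Local Notation L := (voc_L cV).
Local Notation c := (voc_c cV).
Local Notation rho := (voc_rho cV).
Implicit Types (f g : gdual gr).

Lemma voc_U_lin q : linear (U q).
Proof. by apply: coser_linear => k; exact: linearP. Qed.

Lemma voc_U_nint q v : q \isn't a Num.int -> U q v = 0.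
Proof. exact: coser_nint. Qed.

Lemma voc_U_deg q t v : homog gr t v ->
  tspan (fun u w => exists a b : int,
    [/\ homog gr a u, homog gr b w & a%:~R + b%:~R = t%:~R - q]) (U q v).
Proof.
move=> hv; case: (rat_intP q) => [[k ->]|qn]; last by rewrite voc_U_nint//; exact: tspan0.
rewrite /voc_U coser_int; have [s [sP ->]] := voc_deg cV k hv.
exists s; split=> // p /sP[a [b [hu hw ab]]]; exists a, b; split=> //.
by rewrite -rmorphD ab !rmorphD /=; ring.
Qed.

Lemma voc_U_trunc v : exists k : rat, forall q, k < q -> U q v = 0.
Proof.
have [k0 hk] := voc_trunc cV v; exists (- k0%:~R - 1) => q.
case: (rat_intP q) => [[k ->]|qn] lt; last by rewrite voc_U_nint.
by rewrite /voc_U coser_int hk//; move: lt; rewrite ltrD2r ltrN2 ltr_int.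
Qed.

Definition voc_lb : int := projT1 (cid (voc_bound cV)).

Lemma voc_lbP s : s < voc_lb -> homog gr s = [set 0].
Proof. exact: (projT2 (cid (voc_bound cV))). Qed.

Lemma voc_lb_rat (s : int) : s%:~R < voc_lb%:~R :> rat -> homog gr s = [set 0].
Proof. by rewrite ltr_int; exact: voc_lbP. Qed.

Lemma c_scalar : scalar c. Proof. exact: linearP. Qed.
Lemma rho_scalar : scalar rho. Proof. exact: linearP. Qed.

Definition dvoa_mode f q g : gdual gr :=
  comode rat_of_int_inj voc_U_lin voc_U_deg f q g.

Lemma dvoa_modeE f q g v : dvoa_mode f q g v = tpair f g (U q v).
Proof. by []. Qed.

Lemma dvoa_mode_contr f q g v : dvoa_mode f q g v = g (tcontr_l f (U q v)).
Proof. exact: comode_contr. Qed.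

Lemma dvoa_mode_linr f q : linear (dvoa_mode f q).
Proof. exact: comode_linr. Qed.

Lemma dvoa_mode_linl q g : linear (fun f => dvoa_mode f q g).
Proof. exact: comode_linl. Qed.

Lemma dvoa_mode_trunc f g : exists k : rat, forall q, q < k -> dvoa_mode f q g = 0.
Proof. exact: (comode_trunc rat_of_int_inj voc_lb_rat voc_U_lin voc_U_deg). Qed.

Definition dvoa_Y f (k : int) : {linear gdual gr -> gdual gr} :=
  linear_of (dvoa_mode_linr f (- k%:~R - 1)).

Lemma dvoa_coser f q g : coser (dvoa_Y f) q g = dvoa_mode f q g.
Proof.
case: (rat_intP q) => [[k ->]|qn]; first by rewrite coser_int.
rewrite coser_nint//; apply: gdual_ext => v.
rewrite dvoa_mode_contr voc_U_nint//.
by rewrite (linear0_bare (tcontr_l_lin (gdual_linear f))) gdual0.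
Qed.

Lemma gpart_subproof (d : V -> C) (ld : scalar d) a :
  ((fun v => d (gproj gr a v)) : V -> C^o) \in gdual_pred gr.
Proof.
apply: gdual_predP => [k x y|]; first by rewrite linearP ld.
exists [fset a]%fset => s; rewrite inE => sa v.
by rewrite gproj_orth eq_sym (negPf sa) (linear0_bare (W := C^o) ld).
Qed.

Definition gpart (d : V -> C) (ld : scalar d) a : gdual gr := GDual (gpart_subproof ld a).

Definition dvoa_one : gdual gr := gpart c_scalar 0.
Definition dvoa_omega : gdual gr := gpart rho_scalar 2.

(** By the counit identity, contraction with c preserves degrees or vanishes; by
    [contr_component] the contraction with c|V_0 is its degree-preserving part. *)
Lemma dvoa_one_contr q v : tcontr_l dvoa_one (U q v) = if q == 0 then v else 0.
Proof.
case: (rat_intP q) => [[k qE]|qn]; last first.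
  rewrite voc_U_nint// (linear0_bare (tcontr_l_lin (gdual_linear _))).
  by case: eqP => // q0; move: qn; rewrite q0 rpred0.
have lif : linear (fun v : V => if q == 0 then v else 0).
  by move=> a x y; case: ifP => // _; rewrite scaler0 addr0.
move: v; apply: (homog_ext (gr := gr)) => //.
  exact: (linear_comp (voc_U_lin q) (tcontr_l_lin (gdual_linear _))).
move=> s v hv.
rewrite (contr_component rat_of_int_inj voc_U_deg (t := s + k + 1) c_scalar hv).
  rewrite voc_counit qE; case: eqP => [k0|_]; last by rewrite linear0.
  have -> : s + k + 1 = s; last exact: hv.
  have : (k + 1)%:~R == 0 :> rat by rewrite rmorphD -(oppr_eq0) opprD /= k0.
  by rewrite intr_eq0; lia.
by rewrite qE !rmorphD /=; ring.
Qed.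

(** The same argument in the second factor, for the cocreation property. *)
Lemma dvoa_creation f :
  (forall q, q < 0 -> dvoa_mode f q dvoa_one = 0) /\ dvoa_mode f 0 dvoa_one = f.
Proof.
have lc0 : scalar dvoa_one by exact: gdual_linear.
have E q v : dvoa_mode f q dvoa_one v = f (tcontr_r dvoa_one (U q v)).
  by rewrite dvoa_mode_contr (tcontr_lr (gdual_linear f) lc0).
have K q s t v : homog gr s v -> t%:~R = s%:~R - q ->
    tcontr_r dvoa_one (U q v) = gproj gr t (tcontr_r c (U q v)).
  move=> hv ts.
  apply: (@tspan_contr _ _ _ V _ (tcontr_r dvoa_one)
    (fun x => gproj gr t (tcontr_r c x)) _ _ _ _ (voc_U_deg q hv)).
  - exact: tcontr_r_lin.
  - exact: (linear_comp (tcontr_r_lin c_scalar) (linearP _)).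
  move=> u w [a [b [hu hw ab]]].
  rewrite !tcontr_r_pure//; last exact: c_scalar.
  rewrite linearZ /= (gproj_homog _ hw) (gproj_homog _ hu).
  have -> : (0 == b) = (t == a).
    have : t = a + b.
      by apply: rat_of_int_inj; rewrite ts -ab rmorphD.
    by lia.
  by case: eqP => _ //; rewrite linear0 scale0r scaler0.
split=> [q q0|]; apply: gdual_ext => v.
  rewrite E; case: (rat_intP q) => [[k qE]|qn]; last first.
    rewrite voc_U_nint// (linear0_bare (tcontr_r_lin lc0)); exact: gdual0.
  move: v; apply: (@homog_ext _ _ _ gr C^o) => [||s v hv].
  - have l1 := linear_comp (voc_U_lin q) (tcontr_r_lin lc0).
    exact: (linear_comp l1 (gdual_linear f)).
  - exact: (gdual_linear (0 : gdual gr)).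
  rewrite (K q s (s + k + 1) v hv) ?(voc_cocreation cV v).1// ?linear0 ?gdual0//.
  by rewrite qE !rmorphD /=; ring.
rewrite E; move: v; apply: (@homog_ext _ _ _ gr C^o) => [||s v hv].
- have l1 := linear_comp (voc_U_lin 0) (tcontr_r_lin lc0).
  exact: (linear_comp l1 (gdual_linear f)).
- exact: gdual_linear.
rewrite (K 0 s s v hv) ?subr0// (voc_cocreation cV v).2.
by congr (f _); exact: hv.
Qed.

Lemma voc_L_lin k : linear (L k).
Proof. exact: (linear_comp (voc_U_lin _) (tcontr_l_lin rho_scalar)). Qed.

(** Since [L(0), L(k)] = - k L(k), and V_s is the s-eigenspace of L(0). *)
Lemma voc_L_homog k s v : homog gr s v -> homog gr (s - k) (L k v).
Proof.
move=> hv; apply/(voc_weight cV).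
have := voc_virasoro cV k 0 v; rewrite ((voc_weight cV s v).1 hv).
rewrite (linearZ_bare (voc_L_lin k)) !add0r oppr0 !mul0r scale0r addr0.
move=> /(canRL (subrK _)) ->; rewrite -scalerDl.
by rewrite -rmorphD /= addrC.
Qed.

(** L(k) lowers degrees by k, and the contraction with rho|V_2 is the component of
    L(k) that does so. *)
Lemma dvoa_omega_contr k v : tcontr_l dvoa_omega (U (k%:~R - 2) v) = L k v.
Proof.
move: v; apply: (homog_ext (gr := gr)).
- exact: (linear_comp (voc_U_lin _) (tcontr_l_lin (gdual_linear _))).
- exact: voc_L_lin.
move=> s v hv.
rewrite (contr_component rat_of_int_inj voc_U_deg (t := s - k) rho_scalar hv).
  exact: (voc_L_homog k hv).
by rewrite rmorphB /=; ring.
Qed.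

Lemma dvoa_LE k g v : dvoa_Y dvoa_omega (k + 1) g v = g (L (- k) v).
Proof.
rewrite -[LHS]/(dvoa_mode dvoa_omega (- (k + 1)%:~R - 1) g v) dvoa_mode_contr.
rewrite -dvoa_omega_contr; congr (g (tcontr_l _ (U _ v))).
by rewrite rmorphN rmorphD /=; ring.
Qed.

(** Evaluated at a vector m, the identity for modes is the value on m of the
    coalgebraic one, contracted with f, g and x. *)
Lemma dvoa_jacobi f g x e :
  smul (delta_z0_12 R) (series2 z1 z2 (fun a b =>
     coser (dvoa_Y f) a (coser (dvoa_Y g) b x))) e
  - smul (delta_z0_21 R) (series2 z1 z2 (fun a b =>
     coser (dvoa_Y g) b (coser (dvoa_Y f) a x))) e
  = smul (delta_z2_10 R) (series2 z0 z2 (fun a b =>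
     coser (dvoa_Y (coser (dvoa_Y f) a g)) b x)) e.
Proof.
have E : forall f q g, coser (dvoa_Y f) q g = dvoa_mode f q g by exact: dvoa_coser.
rewrite jacobi12 jacobi21 jacobi_z2_10.
rewrite (_ : (fun a b => coser (dvoa_Y f) a (coser (dvoa_Y g) b x)) =
             (fun a b => dvoa_mode f a (dvoa_mode g b x))); last first.
  by apply/funext => a; apply/funext => b; rewrite !E.
rewrite (_ : (fun b a => coser (dvoa_Y g) b (coser (dvoa_Y f) a x)) =
             (fun b a => dvoa_mode g b (dvoa_mode f a x))); last first.
  by apply/funext => a; apply/funext => b; rewrite !E.
rewrite (_ : (fun b a => coser (dvoa_Y (coser (dvoa_Y f) a g)) b x) =
             (fun b a => dvoa_mode (dvoa_mode f a g) b x)); last first.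
  by apply/funext => a; apply/funext => b; rewrite !E.
apply: gdual_ext => m; rewrite gdual_subE.
have t12 s p q := comode_term12 rat_of_int_inj voc_lb_rat voc_U_lin voc_U_deg
  voc_U_trunc f g x m s p q.
have t21 s p q := comode_term21 rat_of_int_inj voc_lb_rat voc_U_lin voc_U_deg
  voc_U_trunc f g x m s p q.
have tit s p q := comode_term_iter rat_of_int_inj voc_U_lin voc_U_deg voc_U_trunc
  voc_U_lin dvoa_modeE dvoa_mode_trunc g x m (@linear_id _ V)
  (fun v => erefl (f v)) s p q.
rewrite [X in X - _ = _]t12 [X in _ - X = _]t21 [RHS]tit.
rewrite -(linearB_bare (gdual_linear x)) -(linearB_bare (tcontr_l_lin (gdual_linear g))).
rewrite -(linearB_bare (tcontr_l_lin (gdual_linear f))).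
congr (x (tcontr_l g (tcontr_l f _))).
have := voc_jacobi cV m e; rewrite jacobi12 jacobi21 jacobi_z1_20 => ->.
by apply: eq_strip => b a; rewrite tmap_id.
Qed.

Lemma dvoa_virasoro : virasoro (fun k => dvoa_Y dvoa_omega (k + 1) : gdual gr -> gdual gr)
  (voc_d cV).
Proof.
move=> j k f; apply: gdual_ext => v.
rewrite gdual_subE gdual_addE !gdual_scaleE !dvoa_LE.
rewrite -(linearB_bare (gdual_linear f)) (voc_virasoro cV (- k) (- j) v).
rewrite (linearD_bare (gdual_linear f)) !gdualZ; congr (_ * f _ + _ * _).
- by congr _%:~R; ring.
- by congr (L _ v); ring.
rewrite (_ : - j + - k == 0 = (k + j == 0)); last by lia.
case: eqP => [kj|_]; last by rewrite !mulr0 !mul0r.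
congr (_%:~R / _ * _ * _); have -> : j = - k by lia.
by ring.
Qed.

Lemma dvoa_weight s f : homog (gdual_grading gr) s f ->
  dvoa_Y dvoa_omega (0 + 1) f = s%:~R *: f.
Proof.
move=> hf; apply: gdual_ext => v; rewrite dvoa_LE gdual_scaleE oppr0; move: v.
apply: (@homog_ext _ _ _ gr C^o) => [||t v hv].
- exact: (linear_comp (voc_L_lin 0) (gdual_linear f)).
- by move=> a x y; rewrite gdual_linear mulrDr mulrCA.
rewrite ((voc_weight cV t v).1 hv) gdualZ.
have [->|fv] := eqVneq (f v) 0; first by rewrite !mulr0.
by rewrite (gdual_homog_eval hf hv fv).
Qed.

Lemma dvoa_deriv f g q : coser (dvoa_Y (dvoa_Y dvoa_omega (-1 + 1) f)) q g =
  dz (fun p => coser (dvoa_Y f) p g) q.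
Proof.
rewrite /dz !dvoa_coser; apply: gdual_ext => v.
rewrite gdual_scaleE !dvoa_mode_contr.
have -> : (dvoa_Y dvoa_omega (-1 + 1) f : V -> C) = f \o L 1.
  by apply/funext => u; rewrite dvoa_LE opprK.
rewrite -[tcontr_l _ _]/(id (tcontr_l _ _)).
rewrite -(tcontr_l_tmap (gdual_linear f) (voc_L_lin 1) (@linear_id _ _)).
by rewrite voc_deriv /dz (linearZ_bare (tcontr_l_lin (gdual_linear f))) gdualZ.
Qed.

Definition dvoa : voa (gdual_grading gr).
Proof.
apply: (@Voa _ _ (gdual_grading gr) dvoa_Y dvoa_one dvoa_omega (voc_d cV)).
- by move=> k g a f f'; exact: dvoa_mode_linl.
- by move=> s; apply/gdual_finite_dim/(voc_fin cV).
- by exists voc_lb => s /voc_lbP; exact: gdual_homog_triv.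
- move=> f g; have [b hb] := dvoa_mode_trunc f g.
  have [N hN] := natr_gt (- b); exists N%:Z => k kN; apply: hb.
  have : N%:R <= k%:~R :> rat by rewrite -[N%:R]/(N%:Z%:~R) ler_int ltW.
  by have := hN N (leqnn _); lra.
- move=> q g; rewrite dvoa_coser; apply: gdual_ext => v.
  by rewrite dvoa_mode_contr dvoa_one_contr; case: ifP => // _; rewrite gdual0.
- move=> f; rewrite dvoa_coser (dvoa_creation f).2; split=> // q q0.
  by rewrite dvoa_coser (dvoa_creation f).1.
- exact: dvoa_jacobi.
- exact: dvoa_virasoro.
- exact: dvoa_weight.
- by move=> f g q; exact: dvoa_deriv.
Defined.

Lemma dvoa_SE f q g : voa_S dvoa f q g = dvoa_mode f q g.
Proof. exact: dvoa_coser. Qed.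

Lemma dvoa_is_dual : is_dual_voa cV dvoa.
Proof. by split=> // f g q v; rewrite dvoa_SE. Qed.


End DualVoa.

(** * The dual of a twisted comodule *)

Lemma tpair_tmap (F : fieldType) (V W V' W' : lmodType F) (c : V' -> F) (d : W' -> F)
    (f : V -> V') (g : W -> W') x : scalar c -> scalar d -> linear f -> linear g ->
  tpair c d (tmap f g x) = tpair (c \o f) (d \o g) x.
Proof.
move=> lc ld lf lg.
have lcf : scalar (c \o f) by move=> a u v /=; rewrite lf lc.
have ldg : scalar (d \o g) by move=> a u v /=; rewrite lg ld.
by rewrite !tpair_contr// tcontr_l_tmap.
Qed.

Section DualModule.
Context (R : realType).
Local Notation C := R[i].
Context (V : lmodType C) (grV : grading int V) (cV : voc grV) (g : voc_aut cV)
  (T : nat) (hg : has_order g T)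
  (M : lmodType C) (cM : weak_comodule g T M)
  (grM : grading rat M) (hM : comodule_admissible cM grM).
Local Notation UV := (voc_U cV).
Local Notation U := (wc_U cM).
Local Notation L := (voc_L cV).
Local Notation ginv := (voc_aut_inv g).
Local Notation ep := (eigproj g T).
Local Notation D := (wc_delta cM).
Implicit Types (f : gdual grV) (phi : gdual grM).

Let T0 : (0 < T)%N. Proof. by case: hg. Qed.
Let gT v : iter T g v = v. Proof. by case: hg => _ ->. Qed.
Let lg : linear g. Proof. exact: linearP. Qed.
Let lep r : linear (ep r). Proof. exact: eigproj_linear. Qed.

Section PullbackAut.
Context (k : voc_aut cV).

Lemma voc_aut_U q v : UV q (k v) = tmap k k (UV q v).
Proof.
case: (rat_intP q) => [[j ->]|qn]; rewrite /voc_U.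
  by rewrite !coser_int voc_aut_delta.
by rewrite !coser_nint// (linear0_bare (tmap_lin (linearP k) (linearP k))).
Qed.

(** An automorphism preserves rho and the comultiplication, hence commutes with L(k)
    and preserves degrees. *)
Lemma voc_aut_L j v : L j (k v) = k (L j v).
Proof.
have rs := rho_scalar cV.
rewrite /voc_L /colie -/(voc_U cV) voc_aut_U.
rewrite (tcontr_l_tmap rs (linearP k) (linearP k)); congr (k (tcontr_l _ _)).
by apply/funext => u; exact: voc_aut_rho.
Qed.

Lemma voc_aut_homog s v : homog grV s v -> homog grV s (k v).
Proof.
move=> hv; apply/(voc_weight cV).
by rewrite voc_aut_L ((voc_weight cV s v).1 hv) linearZ.
Qed.

Definition pullV : {linear gdual grV -> gdual grV} := gpull (linearP k) voc_aut_homog.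

Lemma pullVE f v : pullV f v = f (k v). Proof. by []. Qed.

Lemma pullV_one : pullV (dvoa_one cV) = dvoa_one cV.
Proof.
apply: gdual_ext => v; rewrite pullVE /=.
by rewrite (gproj_comm (linearP k) voc_aut_homog) voc_aut_c.
Qed.

Lemma pullV_omega : pullV (dvoa_omega cV) = dvoa_omega cV.
Proof.
apply: gdual_ext => v; rewrite pullVE /=.
by rewrite (gproj_comm (linearP k) voc_aut_homog) voc_aut_rho.
Qed.

Lemma pullV_Y f j f' : pullV (dvoa_Y cV f j f') = dvoa_Y cV (pullV f) j (pullV f').
Proof.
apply: gdual_ext => v; rewrite pullVE.
rewrite -[LHS]/(tpair f f' (UV _ (k v))) voc_aut_U.
by rewrite (tpair_tmap _ (gdual_linear f) (gdual_linear f') (linearP k) (linearP k)).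
Qed.

End PullbackAut.

(** The action f |-> f o g^-1. The twisting automorphism of the dual module is its
    inverse f |-> f o g. *)
Definition dual_voa_aut : voa_aut (dvoa cV).
Proof.
apply: (@VoaAut _ _ _ (dvoa cV) (pullV ginv) (pullV g)).
- by move=> f; apply: gdual_ext => v; rewrite !pullVE /= voc_autK.
- by move=> f; apply: gdual_ext => v; rewrite !pullVE /= voc_autVK.
- exact: (pullV_one ginv).
- exact: (pullV_omega ginv).
- by move=> f j f'; exact: (pullV_Y ginv).
Defined.

Local Notation G := (voa_aut_inv dual_voa_aut).

Lemma dual_voa_aut_order : has_order G T.
Proof. exact: (gpull_order (linearP g) (@voc_aut_homog g) (voc_fin cV) hg). Qed.

Lemma dual_voa_eigproj r f v : eigproj G T r f v = f (ep r v).
Proof. exact: (eigproj_gpull (linearP g) (@voc_aut_homog g)). Qed.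

(** An eigenfunctional of f |-> f o g vanishes on the other eigenspaces of g. *)
Lemma eigen_eigproj i r f v : (i < T)%N -> (r < T)%N -> eigen G T r f ->
  f (ep i v) = if i == r then f v else 0.
Proof.
move=> iT rT ef; rewrite -dual_voa_eigproj.
have lG : linear G by exact: linearP.
by rewrite (eigproj_id lG T0 iT rT ef); case: eqP.
Qed.

Lemma wc_U_lin q : linear (U q).
Proof.
move=> a x y; rewrite /wc_U.
have [[k [r [rT ->]]]|qn] := twist_case T q.
  by rewrite !tcoser_at// linearP (tmap_lin (lep r) (@linear_id _ _)).
by rewrite !tcoser_none// scaler0 addr0.
Qed.

(** Only the eigencomponent r of the coefficient of index k occurs at the exponent
    -r/T - k - 1, and the fractional parts of the degrees cancel. *)
Lemma wc_U_deg q t m : homog grM t m ->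
  tspan (fun v n => exists (a : int) (b : rat),
    [/\ homog grV a v, homog grM b n & a%:~R + b = t - q]) (U q m).
Proof.
move=> hm; have [[k [r [rT qE]]]|qn] := twist_case T q; last first.
  by rewrite /wc_U tcoser_none//; exact: tspan0.
rewrite /wc_U qE tcoser_at//.
apply: (tspan_tmap (lep r) (@linear_id _ _) _ (hM.2 k t m hm)).
move=> v n [r' [a [b [rT' ev hv hn ab]]]].
rewrite (eigproj_id lg T0 rT rT' ev); case: eqP => [rr|_]; last first.
  by rewrite (linear0_bare (tpure_linl _)); exact: tspan0.
apply: tspan_tpure; exists a, b; split=> //.
by rewrite ab rr; ring.
Qed.

Lemma wc_U_trunc m : exists c : rat, forall q, c < q -> U q m = 0.
Proof.
have [k0 hk] := wc_trunc cM m; exists (- k0%:~R) => q cq.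
have [[k [r [rT qE]]]|qn] := twist_case T q; last by rewrite /wc_U tcoser_none.
rewrite /wc_U qE tcoser_at// hk; last first.
  rewrite -(ltr_int rat); move: cq; rewrite qE.
  have : 0 <= r%:R / T%:R :> rat by exact: divr_ge0.
  by set x := r%:R / T%:R; lra.
exact: (linear0_bare (tmap_lin (lep r) (@linear_id _ _))).
Qed.

Definition dmod_mode f q phi : gdual grM :=
  comode rat_id_inj wc_U_lin wc_U_deg f q phi.

Lemma dmod_mode_contr f q phi m : dmod_mode f q phi m = phi (tcontr_l f (U q m)).
Proof. exact: comode_contr. Qed.

Lemma dmod_linr f q : linear (dmod_mode f q).
Proof. exact: comode_linr. Qed.

Definition dmod_Y f (t : rat) : {linear gdual grM -> gdual grM} :=
  linear_of (dmod_linr f (- t - 1)).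

Lemma dmod_S f q phi : dmod_Y f (- q - 1) phi = dmod_mode f q phi.
Proof.
have E : - (- q - 1) - 1 = q by ring.
by rewrite -[LHS]/(dmod_mode f (- (- q - 1) - 1) phi) E.
Qed.

Lemma dmod_trunc f phi : exists c : rat, forall q, q < c -> dmod_mode f q phi = 0.
Proof.
apply: (comode_trunc rat_id_inj _ wc_U_lin wc_U_deg (b0 := 0)).
by move=> t; exact: (frac_ge0 hM.1).
Qed.

(** The reason why a single term of the sum over eigencomponents survives in the
    Jacobi identity for the modes of an eigenfunctional. *)
Lemma contr_eigproj0 i r f (W : lmodType C) (x : V ⊗ W) : (i < T)%N -> (r < T)%N ->
  i != r -> eigen G T r f -> tcontr_l f (tmap (ep i) id x) = 0.
Proof.
move=> iT rT ir ef.
rewrite (tcontr_l_tmap (gdual_linear f) (lep i) (@linear_id _ _)).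
have -> : f \o ep i = (0 : gdual grV).
  by apply/funext => v /=; rewrite (eigen_eigproj v iT rT ef) (negPf ir).
exact: (linear0_bare (tcontr_l_linc x)).
Qed.

Lemma dmod_modes r f t phi : (r < T)%N -> eigen G T r f ->
  ~ (exists k : int, t = k%:~R + r%:R / T%:R) -> dmod_Y f t phi = 0.
Proof.
move=> rT ef nt; apply: gdual_ext => m.
rewrite -[LHS]/(dmod_mode f (- t - 1) phi m) dmod_mode_contr -[RHS]/(0 : C).
have [[k [i [iT qE]]]|qn] := twist_case T (- t - 1); last first.
  rewrite /wc_U tcoser_none// (linear0_bare (tcontr_l_lin (gdual_linear f))).
  exact: gdual0.
have ir : i != r.
  apply/eqP => ir; apply: nt; exists k; rewrite -ir.
  by move/addIr: qE; rewrite -opprD => /oppr_inj ->; rewrite addrC.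
rewrite /wc_U qE tcoser_at// (contr_eigproj0 _ iT rT ir ef).
exact: gdual0.
Qed.

(** The counit identity of the comodule preserves degrees, so it only involves c|V_0. *)
Lemma dmod_vacuum q phi : dmod_mode (dvoa_one cV) q phi = if q == 0 then phi else 0.
Proof.
have lif : linear (fun m : M => if q == 0 then m else 0).
  by move=> a x y; case: ifP => // _; rewrite scaler0 addr0.
apply: gdual_ext => m; rewrite dmod_mode_contr.
have -> : tcontr_l (dvoa_one cV) (U q m) = if q == 0 then m else 0.
  move: m; apply: (homog_ext (gr := grM)) => //.
    exact: (linear_comp (wc_U_lin q) (tcontr_l_lin (gdual_linear _))).
  move=> s m hm; have cs := c_scalar cV.
  rewrite (contr_component rat_id_inj wc_U_deg (t := s - q) cs hm); last first.
    by rewrite /= subr0.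
  rewrite wc_counit; case: eqP => [q0|_]; last by rewrite linear0.
  by rewrite q0 subr0.
by case: ifP => // _; rewrite gdual0.
Qed.

Lemma dmod_jacobi r f f' phi e : (r < T)%N -> eigen G T r f ->
  smul (delta_z0_12 R) (series2 z1 z2 (fun a b =>
     dmod_Y f (- a - 1) (dmod_Y f' (- b - 1) phi))) e
  - smul (delta_z0_21 R) (series2 z1 z2 (fun a b =>
     dmod_Y f' (- b - 1) (dmod_Y f (- a - 1) phi))) e
  = smul (smul (delta_z2_10 R) (Defs.ratio z1 (-1) z0 z2 (- (r%:R / T%:R))))
      (series2 z0 z2 (fun a b => dmod_Y (voa_S (dvoa cV) f a f') (- b - 1) phi)) e.
Proof.
move=> rT ef; rewrite jacobi12 jacobi21 jacobi_twist.
rewrite (_ : (fun a b => dmod_Y f (- a - 1) (dmod_Y f' (- b - 1) phi)) =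
             (fun a b => dmod_mode f a (dmod_mode f' b phi))); last first.
  by apply/funext => a; apply/funext => b; rewrite !dmod_S.
rewrite (_ : (fun b a => dmod_Y f' (- b - 1) (dmod_Y f (- a - 1) phi)) =
             (fun b a => dmod_mode f' b (dmod_mode f a phi))); last first.
  by apply/funext => a; apply/funext => b; rewrite !dmod_S.
rewrite (_ : (fun b a => dmod_Y (voa_S (dvoa cV) f a f') (- b - 1) phi) =
             (fun b a => dmod_mode (dvoa_mode cV f a f') b phi)); last first.
  by apply/funext => a; apply/funext => b; rewrite dmod_S dvoa_SE.
apply: gdual_ext => m; rewrite gdual_subE.
have bnd t : t < 0 -> homog grM t = [set 0] by exact: (frac_ge0 hM.1).
(* f is its own composite with the eigenprojection onto its eigenspace *)
have t12 s p q := comode_term12 rat_id_inj bnd wc_U_lin wc_U_deg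
  wc_U_trunc f f' phi m s p q.
have t21 s p q := comode_term21 rat_id_inj bnd wc_U_lin wc_U_deg
  wc_U_trunc f f' phi m s p q.
have fE v : f v = f (ep r v) by rewrite (eigen_eigproj v rT rT ef) eqxx.
have tit s p q := comode_term_iter rat_id_inj wc_U_lin wc_U_deg wc_U_trunc
  (voc_U_lin cV) (@dvoa_modeE _ _ _ cV) (@dvoa_mode_trunc _ _ _ cV) f' phi m (lep r)
  fE s p q.
rewrite [X in X - _ = _]t12 [X in _ - X = _]t21 [RHS]tit.
rewrite -(linearB_bare (gdual_linear phi)) -(linearB_bare (tcontr_l_lin (gdual_linear f'))).
rewrite -(linearB_bare (tcontr_l_lin (gdual_linear f))).
congr (phi (tcontr_l f' _)).
have := wc_jacobi cM m e; rewrite jacobi12 jacobi21 => ->.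
rewrite (linear_sum_bare (tcontr_l_lin (gdual_linear f))).
rewrite (bigD1 (Ordinal rT))//= big1 ?addr0 ?jacobi_twist// => i ir.
rewrite jacobi_twist.
rewrite (strip_lin _ _ _ (tcontr_l_lin (gdual_linear f))
  (contr_jacobi_iter_ok wc_U_trunc (voc_U_lin cV) (lep i) m)).
by apply: strip0 => k; exact: (contr_eigproj0 _ (ltn_ord i) rT ir ef).
Qed.

Definition dual_module : weak_module G T (gdual grM).
Proof.
apply: (@WeakModule _ _ _ (dvoa cV) G T (gdual grM) dmod_Y).
- by move=> t phi a f f'; exact: comode_linl.
- exact: dmod_modes.
- move=> f phi; have [c hc] := dmod_trunc f phi; exists (- c - 1) => t ct.
  by apply: hc; lra.
- by move=> q phi; rewrite dmod_S; exact: dmod_vacuum.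
- by move=> r f f' phi e rT ef; exact: dmod_jacobi.
Defined.

Lemma dual_module_admissible : module_admissible dual_module (gdual_grading grM).
Proof.
split=> [t ht|f a s t phi hf hphi]; first by apply: gdual_homog_triv; exact: hM.1.
apply: (comode_homog _ _ _ hf hphi).
by rewrite /=; ring.
Qed.

Lemma twisted_comodule_dual :
  exists (aV' : voa (gdual_grading grV)) (g' : voa_aut aV')
         (mM' : weak_module (voa_aut_inv g') T (gdual grM)),
    [/\ is_dual_voa cV aV',
        is_dual_action (voc_aut_inv g) g',
        has_order (voa_aut_inv g') T,
        module_admissible mM' (gdual_grading grM) &
        forall (f : gdual grV) (f' : gdual grM) (q : rat) (m : M),
          wm_S mM' f q f' m = tpair f f' (wc_U cM q m)].
Proof.
exists (dvoa cV), dual_voa_aut, dual_module; split=> //.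
- exact: dvoa_is_dual.
- exact: dual_voa_aut_order.
- exact: dual_module_admissible.
- by move=> f f' q m; rewrite /wm_S -[wm_Y _ _ _]/(dmod_Y f (- q - 1)) dmod_S.
Qed.

End DualModule.

Theorem proposition3p8 (R : realType)
    (* a graded vertex operator coalgebra V, g in Aut V of order Tg *)
    (V : lmodType R[i]) (grV : grading int V) (cV : voc grV)
    (hc : ~ (homog grV 0 `<=` [set v | voc_c cV v = 0]))
    (hrho : ~ (homog grV 2 `<=` [set v | voc_rho cV v = 0]))
    (g : voc_aut cV) (Tg : nat) (hg : has_order g Tg)
    (* a vertex operator algebra A, h in Aut A of order Th *)
    (A : lmodType R[i]) (grA : grading int A) (aA : voa grA)
    (h : voa_aut aA) (Th : nat) (hh : has_order h Th)
    (* an admissible g-twisted V-comodule M *)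
    (M : lmodType R[i]) (cM : weak_comodule g Tg M)
    (grM : grading rat M) (hM : comodule_admissible cM grM)
    (* an admissible h-twisted A-module N *)
    (N : lmodType R[i]) (mN : weak_module h Th N)
    (grN : grading rat N) (hN : module_admissible mN grN) :
  (* (i) N' is an admissible h^-1-twisted A'-comodule *)
  (exists (cA' : voc (gdual_grading grA)) (h' : voc_aut cA')
          (cN' : weak_comodule (voc_aut_inv h') Th (gdual grN)),
    [/\ is_dual_voc aA cA',
        is_dual_action (voa_aut_inv h) h',
        has_order (voc_aut_inv h') Th,
        comodule_admissible cN' (gdual_grading grN) &
        forall (f : gdual grN) (q : rat) (v : A) (n : N),
          tpair (fun f1 : gdual grA => f1 v) (fun f2 : gdual grN => f2 n)
            (wc_U cN' q f) = f (wm_S mN v q n)])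
  /\
  (* (ii) M' is an admissible g^-1-twisted V'-module *)
  (exists (aV' : voa (gdual_grading grV)) (g' : voa_aut aV')
          (mM' : weak_module (voa_aut_inv g') Tg (gdual grM)),
    [/\ is_dual_voa cV aV',
        is_dual_action (voc_aut_inv g) g',
        has_order (voa_aut_inv g') Tg,
        module_admissible mM' (gdual_grading grM) &
        forall (f : gdual grV) (f' : gdual grM) (q : rat) (m : M),
          wm_S mM' f q f' m = tpair f f' (wc_U cM q m)]).
Proof. by split; [exact: twisted_module_dual | exact: twisted_comodule_dual]. Qed.
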